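(* Let $\mathcal{C} = \{C_1,\ldots,C_k\} \subset \mathbb{P}^{2}_{\mathbb{C}}$ be an arrangement of $k\geq 2$ smooth conics whose singular points are only nodes ($A_1$), ordinary triple points, tacnodes ($A_3$), singularities of type $A_5$, and singularities of type $A_7$. If the curve $\mathcal{C}$ (of degree $d=2k$, defined by the product of the conic equations) is free, then $k\in\{2,3,4\}$.
   Context: Let $S=\mathbb{C}[x,y,z]$ and for a homogeneous reduced $f\in S$ of degree $d$ let $J_f=(\partial_x f,\partial_y f,\partial_z f)$ be the Jacobian ideal and $M(f)=S/J_f$ the Milnor algebra. The curve $C: f=0$ is called $m$-syzygy if $M(f)$ has a minimal graded free resolution of the form $0 \to \bigoplus_{i=1}^{m-2} S(-e_i) \to \bigoplus_{i=1}^{m} S(1-d-d_i) \to S^3(1-d) \to S$ with $e_1\le \dots\le e_{m-2}$ and $1\le d_1\le \dots \le d_m$. The curve $C$ is free if it is $2$-syzygy with $d_1+d_2=d-1$. The singularity $A_j$ ($j\ge1$) is the plane curve singularity with local normal form $x^2+y^{j+1}=0$; an ordinary triple point is a point where three smooth branches meet with pairwise distinct tangents. *)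

(* Defs.v *)
From HB Require Import structures.
From mathcomp Require Import all_boot all_order all_algebra.
From mathcomp Require Import reals.
From mathcomp Require Import complex.
From mathcomp Require Import mpoly.

Set Implicit Arguments.
Unset Strict Implicit.
Unset Printing Implicit Defensive.

Import Order.TTheory GRing.Theory Num.Theory.
Local Open Scope ring_scope.

(* A point of P^2 is represented by a nonzero vector v : 'I_3 -> C.    *)
Section Curves.
Variable C : fieldType.

Definition nonzero3 (v : 'I_3 -> C) : Prop := exists i, v i != 0.

Definition pd (f : {mpoly C[3]}) (i : 'I_3) : {mpoly C[3]} := mderiv i f.

Definition sing_point (f : {mpoly C[3]}) (v : 'I_3 -> C) : Prop :=
  nonzero3 v /\ f.@[v] = 0 /\ forall i : 'I_3, (pd f i).@[v] = 0.

Definition smooth_conic (q : {mpoly C[3]}) : Prop :=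
  q \is 2.-homog /\ q != 0 /\ forall v, ~ sing_point q v.

(* Freeness: the graded syzygy module                                 *)
(*   AR(f) = {(a,b,c) | a f_x + b f_y + c f_z = 0}                    *)
(* is free with a homogeneous basis of degrees d1 <= d2, 1 <= d1,     *)
(* d1 + d2 = d - 1; this is exactly the existence of a minimal graded *)
(* free resolution 0 -> S(1-d-d1) (+) S(1-d-d2) -> S^3(1-d) -> S of   *)
(* M(f) = S/J_f  (2-syzygy curve with d1 + d2 = d - 1).               *)
Definition syzygy (f : {mpoly C[3]}) (r : 'I_3 -> {mpoly C[3]}) : Prop :=
  \sum_(i < 3) r i * pd f i = 0.

Definition homog_vec (d : nat) (r : 'I_3 -> {mpoly C[3]}) : Prop :=
  forall i, r i \is d.-homog.

Definition free_curve (f : {mpoly C[3]}) (d : nat) : Prop :=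
  exists (d1 d2 : nat) (r1 r2 : 'I_3 -> {mpoly C[3]}),
    [/\ (1 <= d1 <= d2)%N /\ (d1 + d2 = d - 1)%N,
        homog_vec d1 r1 /\ homog_vec d2 r2,
        syzygy f r1 /\ syzygy f r2,
        (forall r, syzygy f r -> exists a b : {mpoly C[3]},
              forall i, r i = a * r1 i + b * r2 i) &
        (forall a b : {mpoly C[3]},
              (forall i, a * r1 i + b * r2 i = 0) -> a = 0 /\ b = 0)].

Definition ps := nat -> nat -> C.
Definition ps_eq (f g : ps) : Prop := forall i j, f i j = g i j.
Definition ps_const (c : C) : ps :=
  fun i j => if (i == 0%N) && (j == 0%N) then c else 0.
Definition ps_X : ps := fun i j => if (i == 1%N) && (j == 0%N) then 1 else 0.
Definition ps_Y : ps := fun i j => if (i == 0%N) && (j == 1%N) then 1 else 0.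
Definition ps_add (f g : ps) : ps := fun i j => f i j + g i j.
Definition ps_scale (c : C) (f : ps) : ps := fun i j => c * f i j.
Definition ps_mul (f g : ps) : ps := fun i j =>
  \sum_(a < i.+1) \sum_(b < j.+1) f a b * g (i - a)%N (j - b)%N.
Definition ps_pow (f : ps) (n : nat) : ps := iter n (ps_mul f) (ps_const 1).

Definition ps_eval3 (F : {mpoly C[3]}) (w : 'I_3 -> ps) : ps :=
  \big[ps_add/ps_const 0]_(m <- msupp F)
     ps_scale F@_m (\big[ps_mul/ps_const 1]_(i < 3) ps_pow (w i) (m i)).

Definition ps_unit (u : ps) : Prop := u 0%N 0%N != 0.

Definition ps_coord_change (p1 p2 : ps) : Prop :=
  p1 0%N 0%N = 0 /\ p2 0%N 0%N = 0 /\
  p1 1%N 0%N * p2 0%N 1%N - p1 0%N 1%N * p2 1%N 0%N != 0.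

(* affine chart at the point [v]: g invertible with third column v;
   the local equation of F at [v] in chart coordinates (x,y) is
   F(g (x, y, 1)); here it is composed with (x,y) |-> (p1, p2). *)
Definition chart_at (v : 'I_3 -> C) (g : 'M[C]_3) : Prop :=
  g \in unitmx /\ forall i, g i 2%:R = v i.

Definition local_eq (F : {mpoly C[3]}) (g : 'M[C]_3) (p1 p2 : ps) : ps :=
  ps_eval3 F (fun i => ps_add (ps_add (ps_scale (g i 0%:R) p1)
                                      (ps_scale (g i 1%:R) p2))
                              (ps_const (g i 2%:R))).

(* the curve F = 0 has at [v] a singularity (formally, equivalently
   analytically, as the germs are finitely determined) contact
   equivalent to N = 0, N in C[[x,y]] *)
Definition germ_type (F : {mpoly C[3]}) (v : 'I_3 -> C) (N : ps) : Prop :=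
  exists (g : 'M[C]_3) (p1 p2 u : ps),
    [/\ chart_at v g, ps_coord_change p1 p2, ps_unit u &
        ps_eq (local_eq F g p1 p2) (ps_mul u N)].

Definition A_sing (j : nat) (F : {mpoly C[3]}) (v : 'I_3 -> C) : Prop :=
  (1 <= j)%N /\ germ_type F v (ps_add (ps_pow ps_X 2) (ps_pow ps_Y j.+1)).

Definition smooth_branch (b : ps) : Prop :=
  b 0%N 0%N = 0 /\ (b 1%N 0%N != 0 \/ b 0%N 1%N != 0).

Definition distinct_tangents (b c : ps) : Prop :=
  b 1%N 0%N * c 0%N 1%N - b 0%N 1%N * c 1%N 0%N != 0.

Definition ord_triple (F : {mpoly C[3]}) (v : 'I_3 -> C) : Prop :=
  exists (g : 'M[C]_3) (u b1 b2 b3 : ps),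
    [/\ chart_at v g, ps_unit u,
        smooth_branch b1 /\ smooth_branch b2 /\ smooth_branch b3,
        distinct_tangents b1 b2 /\ distinct_tangents b1 b3 /\
        distinct_tangents b2 b3 &
        ps_eq (local_eq F g ps_X ps_Y) (ps_mul u (ps_mul b1 (ps_mul b2 b3)))].

End Curves.

Notation Cplx R := (R[i])%type.

(* Main.v *)
(* A free arrangement of k conics has a nonzero derivation theta of degree m + 1 <= k - 1 killing the
   product f of the equations q_j; assume k >= 5. The allowed singularities have at most three branches,
   and exactly three only with distinct tangents, so every zero of f is a point of multiplicity at most two
   or an ordinary triple point, and |f|^(-2p) is integrable near the unit sphere for p = 61/100 > (m + 3) / 2k.
   If a derivation kills a homogeneous F whose integrability exponent is that large, then integrating
   |div|^2 |F|^(2n) by parts for all n shows that its divergence is zero. Now theta q_j = L_j q_j, and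
   subtracting from theta a multiple of the Euler field gives a derivation killing f^100 q_j; vanishing
   of its divergence forces the L_j to be equal, hence zero as their sum is. So theta kills every conic,
   any three conics have dependent gradients everywhere, and this fails near a point on two of the
   conics but not on a third. Integrals are replaced throughout by finite averages over rotated grids. *)
Require Import Defs.
From HB Require Import structures.
From mathcomp Require Import all_boot all_order all_algebra.
From mathcomp Require Import cyclic separable cyclotomic.
From mathcomp Require Import reals complex mpoly.
From mathcomp Require Import boolp classical_sets topology normedtype sequences derive exp.
From mathcomp Require Import ring lra zify.

Set Implicit Arguments.
Unset Strict Implicit.
Unset Printing Implicit Defensive.

Import Order.TTheory GRing.Theory Num.Theory.
Local Open Scope ring_scope.
Import numFieldNormedType.Exports.

(** * Squared modulus of a complex number *)

Section SquaredModulus.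
Variable R : realType.
Local Notation C := R[i].

(** The cut between 4 and 5 compares two numbers. Two smooth branches meeting with multiplicity at
    most 4, the Bezout bound for two conics, leave |f|^(-2p) integrable for p < 1/2 + 1/8 = 5/8, and
    an ordinary triple point allows p < 2/3. Integration by parts needs p > (m + 3)/2k, where (m +
    3)/2k <= (k + 1)/2k, which is 3/5 at k = 5 but 5/8 at k = 4; 61/100 lies between. The orders of
    contact are never separated: after projection along z a pair of conics is seen only through its
    resultant, a binary quartic, and four equal linear factors are the worst case.

    The averages run over polysquares turned by the powers of a root of unity of order L. This kills
    all mixed moments of degree below L exactly; only the diagonal moments depend on the grid width,
    and M tends to infinity after all degrees are fixed. The integrability bound must be uniform in
    the grid, hence the regularization |f|^2 + e with M^2 e >= 1. Stokes' formula turns into a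
    relation between the limits of boundary and interior moments. *)

Definition nsq (z : C) : R := complex.Re z ^+ 2 + complex.Im z ^+ 2.

Lemma nsq_ge0 z : 0 <= nsq z.
Proof. by rewrite addr_ge0 // sqr_ge0. Qed.

Lemma nsqE z : (nsq z)%:C%C = z * (z^*)%C.
Proof. by rewrite -sqr_normc /nsq add_Re2_Im2. Qed.

Lemma nsq_eq0 z : (nsq z == 0) = (z == 0).
Proof.
by rewrite -(inj_eq (@complexI R)) nsqE mulf_eq0 conjc_eq0 orbb.
Qed.

Lemma nsq_gt0 z : (0 < nsq z) = (z != 0).
Proof. by rewrite lt0r nsq_eq0 nsq_ge0 andbT. Qed.

Lemma nsq0 : nsq 0 = 0.
Proof. by apply/eqP; rewrite nsq_eq0. Qed.

Lemma nsqM : {morph nsq : z w / z * w}.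
Proof. by move=> z w; apply: (@complexI R); rewrite rmorphM /= !nsqE rmorphM /= mulrACA. Qed.

Lemma nsq1 : nsq 1 = 1.
Proof. by rewrite /nsq /= expr1n expr0n addr0. Qed.

Lemma nsqX z n : nsq (z ^+ n) = nsq z ^+ n.
Proof. by elim: n => [|n IH]; rewrite ?expr0 ?nsq1 // !exprS nsqM IH. Qed.

Lemma nsq_prod (I : Type) (r : seq I) (P : pred I) (F : I -> C) :
  nsq (\prod_(i <- r | P i) F i) = \prod_(i <- r | P i) nsq (F i).
Proof. by apply: (big_morph nsq nsqM nsq1). Qed.

Lemma nsqN z : nsq (- z) = nsq z.
Proof. by rewrite /nsq !raddfN /= !sqrrN. Qed.

Lemma nsqJ z : nsq (z^*)%C = nsq z.
Proof. by case: z => a b; rewrite /nsq /= sqrrN. Qed.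

Lemma nsqB z w : nsq (z - w) = nsq (w - z).
Proof. by rewrite -nsqN opprB. Qed.

Lemma nsq_real (x : R) : nsq x%:C%C = x ^+ 2.
Proof. by rewrite /nsq /= expr0n addr0. Qed.

Lemma nsqV z : nsq z^-1 = (nsq z)^-1.
Proof.
have [->|nz] := eqVneq z 0; first by rewrite invr0 nsq0 invr0.
have nz' : nsq z != 0 by rewrite nsq_eq0.
by apply: (mulfI nz'); rewrite -nsqM !divff // nsq1.
Qed.

Lemma nsqD_le z w : nsq (z + w) <= 2 * (nsq z + nsq w).
Proof.
case: z w => [a b] [c d]; rewrite /nsq /=.
rewrite -subr_ge0.
have -> : 2 * (a ^+ 2 + b ^+ 2 + (c ^+ 2 + d ^+ 2)) - ((a + c) ^+ 2 + (b + d) ^+ 2)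
  = (a - c) ^+ 2 + (b - d) ^+ 2 by ring.
by rewrite addr_ge0 // sqr_ge0.
Qed.

End SquaredModulus.

(** * Negative real powers *)

Section NegativePowers.
Variable R : realType.

(* [ng p x] is [x] to the power [-p], for [x > 0]. *)
Definition ng (p x : R) : R := expR (- (p * ln x)).

Lemma ng_gt0 p x : 0 < ng p x.
Proof. exact: expR_gt0. Qed.

Lemma ng_ge0 p x : 0 <= ng p x.
Proof. exact: expR_ge0. Qed.

Lemma ngM p x y : 0 < x -> 0 < y -> ng p (x * y) = ng p x * ng p y.
Proof. by move=> x0 y0; rewrite /ng lnM ?posrE // mulrDr opprD expRD. Qed.

Lemma ngD p q x : ng (p + q) x = ng p x * ng q x.
Proof. by rewrite /ng mulrDl opprD expRD. Qed.

Lemma ng_le p x y : 0 <= p -> 0 < x -> x <= y -> ng p y <= ng p x.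
Proof.
move=> p0 x0 xy; rewrite ler_expR lerN2 ler_wpM2l // ler_ln ?posrE //.
exact: lt_le_trans xy.
Qed.

Lemma ngX p x n : ng p x ^+ n = ng (n%:R * p) x.
Proof.
elim: n => [|n IH]; first by rewrite expr0 /ng mul0r mul0r oppr0 expR0.
by rewrite exprS IH -ngD -natr1 mulrDl mul1r addrC.
Qed.

Lemma ng1 p : ng p 1 = 1.
Proof. by rewrite /ng ln1 mulr0 oppr0 expR0. Qed.

Lemma ng_1E x : 0 < x -> ng 1 x = x^-1.
Proof. by move=> x0; rewrite /ng mul1r expRN lnK ?posrE. Qed.

Lemma ng_le1 p x : 0 <= p -> 1 <= x -> ng p x <= 1.
Proof. by move=> p0 x1; rewrite -(ng1 p); apply: ng_le. Qed.

Lemma ng_prod (I : Type) (r : seq I) p (F : I -> R) :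
  (forall i, 0 < F i) -> ng p (\prod_(i <- r) F i) = \prod_(i <- r) ng p (F i).
Proof.
move=> F0; elim: r => [|i r IH]; first by rewrite !big_nil ng1.
by rewrite !big_cons ngM ?IH // prodr_gt0.
Qed.

Lemma ng_exp p x n : 0 < x -> ng p x ^+ n = ng p (x ^+ n).
Proof.
move=> x0; elim: n => [|n IH]; first by rewrite !expr0 ng1.
by rewrite !exprS IH -ngM // exprn_gt0.
Qed.

(** A crude form of the arithmetic-geometric inequality: the largest of the three cubes already
    suffices. It splits the pole at a triple point into poles of pairs. *)
Lemma mul3_le (a b c : R) : 0 <= a -> 0 <= b -> 0 <= c ->
  a * b * c <= a ^+ 3 + b ^+ 3 + c ^+ 3.
Proof.
move=> a0 b0 c0; set m := Num.max a (Num.max b c).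
have [am bm cm] : [/\ a <= m, b <= m & c <= m] by rewrite /m !le_max !lexx !orbT.
have h : a * b * c <= m ^+ 3.
  by rewrite !exprS expr0 mulr1 mulrA !ler_pM // mulr_ge0.
apply: le_trans h _; rewrite /m /Num.max; case: ifP => _; try case: ifP => _;
  by have := (exprn_ge0 3 a0, exprn_ge0 3 b0, exprn_ge0 3 c0); case=> [[? ?] ?]; lra.
Qed.

End NegativePowers.

(** * Means over finite types *)

Section Means.
Variables (F : numFieldType) (I : finType).

Definition mean (h : I -> F) : F := (\sum_i h i) / #|I|%:R.

Lemma meanD h1 h2 : mean (fun i => h1 i + h2 i) = mean h1 + mean h2.
Proof. by rewrite /mean big_split mulrDl. Qed.

Lemma meanZ c h : mean (fun i => c * h i) = c * mean h.
Proof. by rewrite /mean -mulr_sumr mulrA. Qed.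

Lemma meanZr c h : mean (fun i => h i * c) = mean h * c.
Proof. by rewrite /mean -mulr_suml mulrAC. Qed.

Lemma mean_sum (J : Type) (r : seq J) (P : pred J) (h : J -> I -> F) :
  mean (fun i => \sum_(j <- r | P j) h j i) = \sum_(j <- r | P j) mean (h j).
Proof. by rewrite /mean exchange_big /= mulr_suml. Qed.

Lemma eq_mean h1 h2 : h1 =1 h2 -> mean h1 = mean h2.
Proof. by move=> e; rewrite /mean (eq_bigr h2). Qed.

Lemma le_mean h1 h2 : (forall i, h1 i <= h2 i) -> mean h1 <= mean h2.
Proof. by move=> le12; rewrite ler_wpM2r ?invr_ge0 ?ler0n // ler_sum. Qed.

Lemma mean_ge0 h : (forall i, 0 <= h i) -> 0 <= mean h.
Proof. by move=> h0; rewrite divr_ge0 ?ler0n // sumr_ge0. Qed.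

Lemma mean_cst c : (0 < #|I|)%N -> mean (fun=> c) = c.
Proof.
by move=> I0; rewrite /mean sumr_const -[c *+ _]mulr_natr mulfK // pnatr_eq0 -lt0n.
Qed.

(** Only an inequality, since the mean over an empty type is 0. *)
Lemma mean_cst_le c : 0 <= c -> mean (fun=> c) <= c.
Proof.
move=> c0; case: (posnP #|I|) => [I0|/mean_cst -> //].
by rewrite /mean I0 invr0 mulr0.
Qed.

End Means.

Lemma mean_pair (F : numFieldType) (I J : finType) (h : I -> J -> F) :
  mean (fun k : I * J => h k.1 k.2) = mean (fun i => mean (fun j => h i j)).
Proof.
by rewrite /mean -mulr_suml -mulrA -invfM card_prod natrM [#|J|%:R * _]mulrC pair_bigA.
Qed.

Lemma Re_sum (R : realType) (J : Type) (r : seq J) (h : J -> R[i]) :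
  complex.Re (\sum_(j <- r) h j) = \sum_(j <- r) complex.Re (h j).
Proof. exact: (raddf_sum (@complex.Re R : Rcomplex R -> R)). Qed.

Lemma Re_mean (R : realType) (I : finType) (h : I -> R[i]) :
  complex.Re (mean h) = mean (fun i => complex.Re (h i)).
Proof.
have Rer (z : R[i]) (x : R) : complex.Re (z * x%:C%C) = complex.Re z * x.
  by case: z => a b /=; rewrite mulr0 subr0.
rewrite /mean -Re_sum -Rer; congr (complex.Re (_ * _)).
by rewrite fmorphV rmorph_nat.
Qed.

(** * Rotated grids and the integrability threshold in one variable *)

Section Grid.
Variable R : realType.
Local Notation C := R[i].

(** The midpoints of the M intervals of length 2/M that partition [-1, 1]. *)
Definition grid M (a : 'I_M) : R := ((2 * a + 1)%:R - M%:R) / M%:R.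

Lemma count_interval M (A l : R) : 0 <= l ->
  \sum_(j < M) (A <= j%:R <= A + l)%R%:R <= l + 1.
Proof.
move=> l0; set S := [set j : 'I_M | A <= j%:R <= A + l].
have -> : \sum_(j < M) (A <= j%:R <= A + l)%R%:R = #|S|%:R :> R.
  rewrite -sum1_card natr_sum [RHS]big_mkcond; apply: eq_bigr => j _.
  by rewrite inE; case: ifP.
have [->|[j0 j0S]] := set_0Vmem S.
  by rewrite cards0 addr_ge0.
case: (arg_minnP (P := [pred j | j \in S]) (fun j : 'I_M => val j) j0S) => j1 /= j1S j1min.
have le_card : (#|S| <= (Num.truncn l).+1)%N.
  rewrite cardE -(size_map val) -(size_iota j1 (Num.truncn l).+1).
  apply: uniq_leq_size; first by rewrite (map_inj_uniq val_inj) enum_uniq.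
  move=> _ /mapP [j jS ->]; rewrite mem_enum in jS.
  have lej := j1min j jS.
  rewrite mem_iota lej //=.
  move: jS j1S; rewrite !inE => /andP [_ h1] /andP [h2 _].
  have h3 : (j%:R : R) <= j1%:R + l by lra.
  have h4 : (j - j1)%:R <= l by rewrite natrB //; lra.
  have : (j - j1 <= Num.truncn l)%N by rewrite truncn_ge_nat.
  by move: lej; lia.
apply: (@le_trans _ _ (Num.truncn l).+1%:R); first by rewrite ler_nat.
by rewrite -natr1 lerD2r truncn_le.
Qed.

(** The window has length 2r and the points are 2/M apart, so it contains at most M r + 1 of them.
    The summand 1/M is the price of the discretization. *)
Lemma mean_grid_interval M (c r : R) : (0 < M)%N -> 0 <= r ->
  mean (fun j : 'I_M => (`|grid j - c| <= r)%R%:R) <= r + M%:R^-1.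
Proof.
move=> M0 r0; have M0' : 0 < M%:R :> R by rewrite ltr0n.
have M1 : M%:R != 0 :> R by rewrite gt_eqF.
have e (j : 'I_M) : (`|grid j - c| <= r) =
  ((M%:R * (c - r) + M%:R - 1) / 2 <= j%:R
    <= (M%:R * (c - r) + M%:R - 1) / 2 + M%:R * r).
  have hg : M%:R * grid j = 2 * j%:R + 1 - M%:R by rewrite /grid natrD natrM mulrC divfK.
  have h1 : (- r <= grid j - c) = (M%:R * - r <= M%:R * (grid j - c)) by rewrite ler_pM2l.
  have h2 : (grid j - c <= r) = (M%:R * (grid j - c) <= M%:R * r) by rewrite ler_pM2l.
  rewrite ler_norml h1 h2 mulrBr hg.
  by apply/andP/andP; case=> {}h1 {}h2; split; lra.
rewrite /mean card_ord ler_pdivrMr // mulrDl mulVf //.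
under eq_bigr => j _ do rewrite e.
by rewrite [r * _]mulrC count_interval // mulr_ge0 // ltW.
Qed.

Section Points.
Variables (L M : nat) (zeta : C).

(* Finite models of the square [|Re z|, |Im z| <= 1] and of its boundary. Averaging over the
   rotations by [zeta] kills the moments of [x ^ a * conj x ^ b] with [a != b]. *)
Definition ptA (i : 'I_L * ('I_M * 'I_M)) : C :=
  zeta ^+ i.1 * (grid i.2.1 +i* grid i.2.2)%C.
Definition ptB (i : 'I_L * 'I_M) : C := zeta ^+ i.1 * (1 +i* grid i.2)%C.

Definition EA (F : numFieldType) (h : C -> F) : F := mean (fun i => h (ptA i)).
Definition EB (F : numFieldType) (h : C -> F) : F := mean (fun i => h (ptB i)).

Hypothesis zeta1 : nsq zeta = 1.
Hypotheses (L0 : (0 < L)%N) (M0 : (0 < M)%N).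

Lemma grid_le1 (a : 'I_M) : grid a ^+ 2 <= 1.
Proof.
have M0' : 0 < M%:R :> R by rewrite ltr0n.
have h : -1 <= grid a <= 1.
  rewrite /grid ler_pdivlMr // ler_pdivrMr // mul1r natrD natrM.
  have : (a.+1%:R <= M%:R :> R) by rewrite ler_nat.
  by rewrite -natr1 => h; have := ler0n R a; lra.
by nra.
Qed.

Lemma nsq_zeta n : nsq (zeta ^+ n) = 1.
Proof. by rewrite nsqX zeta1 expr1n. Qed.

Lemma nsq_ptA i : nsq (ptA i) <= 2.
Proof.
rewrite nsqM nsq_zeta mul1r /nsq /=.
by have := (grid_le1 i.2.1, grid_le1 i.2.2); case=> ? ?; lra.
Qed.

Lemma nsq_ptB i : 1 <= nsq (ptB i) <= 2.
Proof.
rewrite nsqM nsq_zeta mul1r /nsq /= expr1n.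
by have := (grid_le1 i.2, sqr_ge0 (grid i.2)); case=> ? ?; apply/andP; split; lra.
Qed.

(** Undoing the rotation moves the centre of the disc only; a disc lies in a square, and the count
    in a square is a product of two counts in intervals. *)
Lemma EA_disc (a : C) (r : R) : 0 <= r ->
  EA (fun z => (nsq (z - a) <= r ^+ 2)%R%:R) <= (r + M%:R^-1) ^+ 2.
Proof.
move=> r0; rewrite /EA.
pose b l := (zeta ^+ l)^-1 * a.
pose g (c : R) (j : 'I_M) : R := (`|grid j - c| <= r)%R%:R.
apply: (@le_trans _ _ (mean (fun i : 'I_L * ('I_M * 'I_M) =>
  g (complex.Re (b i.1)) i.2.1 * g (complex.Im (b i.1)) i.2.2))).
  apply: le_mean => -[l [s t]] /=.
  have zl : zeta ^+ l != 0 by rewrite -nsq_eq0 nsq_zeta oner_eq0.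
  have -> : nsq (ptA (l, (s, t)) - a) = nsq ((grid s +i* grid t)%C - b l).
    rewrite -[RHS]mul1r -(nsq_zeta l) -nsqM mulrBr /b mulrA divff // mul1r.
    by [].
  have [h|h] := boolP (nsq _ <= r ^+ 2); last by rewrite mulr_ge0 // ler0n.
  have sq (x y : R) : x ^+ 2 + y ^+ 2 <= r ^+ 2 -> `|x| <= r.
    move=> h2; rewrite -(ger0_norm r0) -ler_sqr ?nnegrE // !real_normK ?num_real //.
    by have := sqr_ge0 y; lra.
  move: h; rewrite /nsq /g; case: (b l) => u v /= h.
  by rewrite (sq _ _ h) (sq (grid t - v) (grid s - u)) ?mulr1 // addrC.
rewrite (mean_pair (fun (l : 'I_L) (st : 'I_M * 'I_M) =>
  g (complex.Re (b l)) st.1 * g (complex.Im (b l)) st.2)).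
apply: le_trans (mean_cst_le _ _); last by rewrite sqr_ge0.
apply: le_mean => l.
rewrite (mean_pair (fun s t => g (complex.Re (b l)) s * g (complex.Im (b l)) t)).
under eq_mean => s do rewrite meanZ.
rewrite meanZr expr2 ler_pM ?mean_grid_interval // mean_ge0 // => i; exact: ler0n.
Qed.

End Points.

(** Dyadic layers: if 4^-(i+1) < x <= 4^-i, the term of index i alone dominates x^(-p). The constant
    1 covers x > 1, and the lower bound on x + e ends the sum at n. *)
Lemma dyadic_bound (p x e : R) (n : nat) : 0 <= p -> 0 <= x -> 0 < e ->
  (4^-1) ^+ n.+1 <= x + e ->
  ng p (x + e) <= 1 + \sum_(i < n.+1) ng p 4^-1 ^+ i.+1 * (x <= (2^-1 ^+ i) ^+ 2)%R%:R.
Proof.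
move=> p0 x0 e0.
have h0 (m : nat) : 0 <= \sum_(i < m) ng p 4^-1 ^+ i.+1 * (x <= (2^-1 ^+ i) ^+ 2)%R%:R.
  by apply: sumr_ge0 => i _; rewrite mulr_ge0 ?ler0n // exprn_ge0 // ng_ge0.
have [x1|x1 hx] := ltP 1 x.
  move=> _; apply: (@le_trans _ _ 1); last by rewrite lerDl.
  by apply: ng_le1 => //; lra.
apply: (@le_trans _ _ (\sum_(i < n.+1) ng p 4^-1 ^+ i.+1 * (x <= (2^-1 ^+ i) ^+ 2)%R%:R)); last by rewrite lerDr.
elim: n hx => [|n IH] hx.
  rewrite big_ord1 expr0 expr1n x1 mulr1 expr1; rewrite expr1 in hx.
  by apply: ng_le; rewrite // invr_gt0.
rewrite big_ord_recr /=; have [hn|hn] := leP x ((2^-1 ^+ n.+1) ^+ 2).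
  rewrite ng_exp ?invr_gt0 //.
  apply: (@le_trans _ _ (ng p (4^-1 ^+ n.+2))).
    by apply: ng_le => //; rewrite exprn_gt0 // invr_gt0.
  by rewrite mulr1 lerDr h0.
rewrite mulr0 addr0; apply: IH; apply: (@le_trans _ _ x); last by rewrite lerDl ltW.
apply: le_trans (ltW hn); rewrite -exprM mulnC exprM le_eqVlt; apply/orP; left; apply/eqP.
by congr (_ ^+ _); rewrite expr2 -invfM -natrM.
Qed.

(* The exponent [p] is taken on the squared distance, so [p < 1] is the integrability threshold in one
   complex variable. *)
Lemma EA_power_bound (p : R) : 0 <= p < 1 -> exists2 K : R, 0 <= K &
  forall L M zeta a e, nsq zeta = 1 -> (0 < M)%N -> 0 < e <= 1 ->
    1 <= M%:R ^+ 2 * e -> EA L M zeta (fun z => ng p (nsq (z - a) + e)) <= K.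
Proof.
case/andP=> p0 p1.
set g : R := ng p 4^-1.
have g0 : 0 < g by exact: ng_gt0.
(* [g] is 4^p. Layer i has pole at most g^(i+1) and area about 4^-i, so p < 1 makes the geometric
   series in g/4 converge. *)
have g4 : g < 4.
  rewrite /g /ng lnV ?posrE // mulrN opprK -[X in _ < X]lnK ?posrE // ltr_expR.
  by rewrite gtr_pMl // ln_gt0 // ltr1n.
have K0 : 0 <= 1 + 4 * g / (1 - g / 4).
  rewrite addr_ge0 // divr_ge0 ?mulr_ge0 // ?ltW //.
  by rewrite subr_gt0 ltr_pdivrMr // mul1r.
exists (1 + 4 * g / (1 - g / 4)) => // L M zeta a e z1 M0 /andP[e0 e1] Me.
have M0' : 0 < M%:R :> R by rewrite ltr0n.
case: (posnP L) => [L0|L0].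
  by rewrite /EA /mean !card_prod L0 card_ord mul0n invr0 mulr0.
(* The layers stop at the scale of the regularization. *)
have [n n1 n2] : exists2 n : nat, (4^-1) ^+ n.+1 <= e & e <= (4^-1) ^+ n.
  have ex : exists n, (4^-1) ^+ n <= e.
    have [m hm] : exists m : nat, e^-1 <= m%:R.
      by exists (Num.truncn e^-1).+1; rewrite ltW // truncnS_gt.
    exists m; rewrite exprVn -[X in _ <= X]invrK lef_pV2 ?posrE ?exprn_gt0 ?invr_gt0 //.
    by apply: le_trans hm _; rewrite -natrX ler_nat ltnW // ltn_expl.
  case: (ex_minnP ex) => m hm mmin; case: m hm mmin => [|m] hm mmin.
    exists 0%N; last by rewrite expr0.
    by apply: le_trans hm; rewrite expr1 expr0 invf_le1 // ler1n.
  exists m => //; rewrite leNgt; apply/negP => lt_e.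
  by have := mmin m (ltW lt_e); rewrite ltnn.
apply: (@le_trans _ _ (EA L M zeta (fun z => 1 + \sum_(i < n.+1) g ^+ i.+1 * (nsq (z - a) <= (2^-1 ^+ i) ^+ 2)%R%:R))).
  apply: le_mean => i; apply: dyadic_bound => //; first exact: nsq_ge0.
  by apply: le_trans n1 _; rewrite lerDr nsq_ge0.
rewrite /EA meanD lerD //; first exact: mean_cst_le.
rewrite mean_sum.
apply: (@le_trans _ _ (\sum_(i < n.+1) 4 * g * (g / 4) ^+ i)).
  apply: ler_sum => i _; rewrite meanZ.
  apply: (@le_trans _ _ (g ^+ i.+1 * (2^-1 ^+ i + M%:R^-1) ^+ 2)).
    apply: ler_wpM2l; first by rewrite exprn_ge0 // ltW.
    by apply: (EA_disc L z1 M0 a); rewrite exprn_ge0 // invr_ge0.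
  have -> : 4 * g * (g / 4) ^+ i = g ^+ i.+1 * (4 * (2^-1 ^+ i) ^+ 2).
    rewrite -exprM mulnC exprM expr2 -invfM -natrM exprMn exprS; ring.
  rewrite ler_pM2l ?exprn_gt0 //.
  (* Since M^-2 <= e <= 4^-n, the grid error 1/M never exceeds the radius 2^-i of the layer; this
     costs the factor 4. *)
  have h2 : M%:R^-1 <= 2^-1 ^+ i :> R.
    rewrite -ler_sqr ?nnegrE ?invr_ge0 ?exprn_ge0 ?invr_ge0 ?ler0n //.
    apply: (@le_trans _ _ e).
      by rewrite exprVn -[X in X <= _]mul1r ler_pdivrMr ?exprn_gt0 // mulrC.
    apply: le_trans n2 _; rewrite -exprM mulnC exprM [2^-1 ^+ 2]expr2 -invfM -natrM.
    apply: ler_wiXn2l; [by rewrite invr_ge0 ler0n | by rewrite invf_le1 ?ler1n ?ltr0n | by rewrite -ltnS ltn_ord].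
  have h3 : 0 < M%:R^-1 :> R by rewrite invr_gt0.
  by nra.
have g41 : 0 < 1 - g / 4 by rewrite subr_gt0 ltr_pdivrMr // mul1r.
rewrite -mulr_sumr ler_pM2l ?mulr_gt0 // -[X in _ <= X]mul1r ler_pdivlMr //.
have := subrX1 (g / 4) n.+1; set S := \sum_(i < _) _ => e4.
have : 0 <= (g / 4) ^+ n.+1 by rewrite exprn_ge0 // divr_ge0 // ltW.
by nra.
Qed.

End Grid.

(** * Products of two poles on a line, and poles of linear forms *)

Section Slices.
Variable R : realType.
Local Notation C := R[i].

Lemma ngM_le (p c x y : R) : 0 <= p -> 0 < c -> 0 < x -> c * x <= y ->
  ng p y <= ng p c * ng p x.
Proof. by move=> p0 c0 x0 h; rewrite -ngM // ng_le // mulr_gt0. Qed.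

(** If z is closer to a than to b, then |z - b| is at least half of |a - b|. So a part r of the
    exponent at b can be paid by |a - b|, and the remaining p - r is moved to the stronger pole at
    a, whose exponent becomes 2p - r. *)
Lemma slice_pointwise (p r e : R) (a b z : C) : 0 <= r <= p -> 0 < e ->
  ng p (nsq (z - a) + e) * ng p (nsq (z - b) + e) <=
  ng r 4^-1 * ng r (nsq (a - b) + e) *
    (ng (2 * p - r) (nsq (z - a) + e) + ng (2 * p - r) (nsq (z - b) + e)).
Proof.
move=> /andP[r0 rp] e0.
wlog le_ab : a b / nsq (z - a) <= nsq (z - b).
  move=> H; case/orP: (le_total (nsq (z - a)) (nsq (z - b))) => h; first exact: H.
  rewrite mulrC [X in _ <= _ * X]addrC nsqB [nsq (z - a)]nsqB.
  by rewrite ![nsq (_ - z)]nsqB [nsq (a - b)]nsqB; apply: H.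
have X0 : 0 < nsq (z - a) + e by rewrite ltr_wpDl // nsq_ge0.
have Y0 : 0 < nsq (z - b) + e by rewrite ltr_wpDl // nsq_ge0.
have W0 : 0 < nsq (a - b) + e by rewrite ltr_wpDl // nsq_ge0.
have h1 : nsq (a - b) <= 2 * (nsq (z - a) + nsq (z - b)).
  have -> : a - b = (a - z) + (z - b) by ring.
  by rewrite [nsq (z - a)]nsqB nsqD_le.
have h2 : ng r (nsq (z - b) + e) <= ng r 4^-1 * ng r (nsq (a - b) + e).
  by apply: ngM_le; rewrite ?invr_gt0 //; have := nsq_ge0 (z - b); lra.
have h3 : ng (p - r) (nsq (z - b) + e) <= ng (p - r) (nsq (z - a) + e).
  by apply: ng_le; rewrite ?subr_ge0 ?lerD2r.
have eY : ng p (nsq (z - b) + e) = ng r (nsq (z - b) + e) * ng (p - r) (nsq (z - b) + e).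
  by rewrite -ngD [r + _]addrC subrK.
have eX : ng (2 * p - r) (nsq (z - a) + e) = ng p (nsq (z - a) + e) * ng (p - r) (nsq (z - a) + e).
  by rewrite -ngD; have -> : p + (p - r) = 2 * p - r by ring.
rewrite eY mulrCA [X in _ <= X]mulrDr.
apply: (@le_trans _ _ (ng r 4^-1 * ng r (nsq (a - b) + e) * ng (2 * p - r) (nsq (z - a) + e))).
  apply: ler_pM; rewrite ?mulr_ge0 ?ng_ge0 // eX.
  by rewrite ler_pM2l // ng_gt0.
by rewrite lerDl !mulr_ge0 ?ng_ge0.
Qed.

(** The last condition says that the grid width is at most of order sqrt(e): the grid resolves the
    scale at which the poles are cut off. *)
Definition good_mesh (L M : nat) (zeta : C) (e : R) : Prop :=
  [/\ nsq zeta = 1, (0 < L)%N, (0 < M)%N, 0 < e <= 1 & 1 <= M%:R ^+ 2 * e].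

Lemma EA_le (L M : nat) (zeta : C) (h1 h2 : C -> R) :
  nsq zeta = 1 -> (0 < M)%N ->
  (forall z, nsq z <= 2 -> h1 z <= h2 z) -> EA L M zeta h1 <= EA L M zeta h2.
Proof. by move=> z1 M0 h; apply: le_mean => i; apply: h; apply: nsq_ptA. Qed.

Lemma EB_le (L M : nat) (zeta : C) (h1 h2 : C -> R) :
  nsq zeta = 1 -> (0 < M)%N ->
  (forall z, 1 <= nsq z <= 2 -> h1 z <= h2 z) -> EB L M zeta h1 <= EB L M zeta h2.
Proof. by move=> z1 M0 h; apply: le_mean => i; apply: h; apply: nsq_ptB. Qed.

Lemma EA_cst_le (L M : nat) (zeta : C) (c : R) : 0 <= c -> EA L M zeta (fun=> c) <= c.
Proof. exact: mean_cst_le. Qed.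

Lemma EB_cst_le (L M : nat) (zeta : C) (c : R) : 0 <= c -> EB L M zeta (fun=> c) <= c.
Proof. exact: mean_cst_le. Qed.

Lemma slice_bound (p r : R) : 0 <= r <= p -> 2 * p - r < 1 -> exists2 K : R, 0 <= K &
  forall L M zeta a b e, good_mesh L M zeta e ->
    EA L M zeta (fun z => ng p (nsq (z - a) + e) * ng p (nsq (z - b) + e))
      <= K * ng r (nsq (a - b) + e).
Proof.
move=> rp hp; have [K K0 HK] := @EA_power_bound R (2 * p - r) ltac:(lra).
exists (ng r 4^-1 * (K + K)); first by rewrite mulr_ge0 ?addr_ge0 ?ng_ge0.
move=> L M zeta a b e [z1 L0 M0 e01 Me].
apply: (@le_trans _ _ (EA L M zeta (fun z => ng r 4^-1 * ng r (nsq (a - b) + e) *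
    (ng (2 * p - r) (nsq (z - a) + e) + ng (2 * p - r) (nsq (z - b) + e))))).
  by apply: EA_le => // z _; apply: slice_pointwise => //; case/andP: e01.
rewrite /EA meanZ meanD mulrAC ler_wpM2r ?ng_ge0 // ler_wpM2l ?ng_ge0 //.
by rewrite lerD // HK.
Qed.

(** If y occurs in the form, this is a translated and rescaled pole in y. Otherwise the form is u x,
    which stays away from 0 because x lies on the boundary. *)
Lemma linear_form_bound (p : R) (u v : C) : 0 <= p < 1 -> (u, v) != (0, 0) ->
  exists2 K : R, 0 <= K & forall L M zeta e x, good_mesh L M zeta e -> 1 <= nsq x ->
    EA L M zeta (fun y => ng p (nsq (u * x + v * y) + e)) <= K.
Proof.
move=> p01 uv0; have [K K0 HK] := EA_power_bound p01; case/andP: p01 => p0 p1.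
have [v0|v0] := eqVneq v 0.
  have u0 : u != 0 by apply: contraNneq uv0 => ->; rewrite v0.
  exists (ng p (nsq u)); first exact: ng_ge0.
  move=> L M zeta e x [z1 L0 M0 /andP[e0 e1] Me] x1.
  apply: le_trans (EA_cst_le _ _ _ (ng_ge0 _ _)); apply: EA_le => // y _.
  apply: ng_le => //; first by rewrite nsq_gt0.
  rewrite v0 mul0r addr0 nsqM; have := nsq_ge0 u; nra.
have c0 : 0 < Num.min 1 (nsq v) by rewrite lt_min ltr01 nsq_gt0.
exists (ng p (Num.min 1 (nsq v)) * K); first by rewrite mulr_ge0 ?ng_ge0.
move=> L M zeta e x [z1 L0 M0 /andP[e0 e1] Me] x1.
apply: (@le_trans _ _ (EA L M zeta (fun y => ng p (Num.min 1 (nsq v)) *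
   ng p (nsq (y - - (u * x / v)) + e)))).
  apply: EA_le => // y _; apply: ngM_le => //.
    by rewrite ltr_wpDl // nsq_ge0.
  have -> : u * x + v * y = v * (y - - (u * x / v)) by field.
  rewrite nsqM mulrDr lerD //.
    by rewrite ler_wpM2r ?nsq_ge0 // ge_min lexx orbT.
  by rewrite -[X in _ <= X]mul1r ler_wpM2r ?(ltW e0) // ge_min lexx.
by rewrite /EA meanZ ler_wpM2l ?ng_ge0 // HK ?e0.
Qed.

(** Moves the regularization from a product of bounded factors to the factors, so that the pole of a
    product can be split into poles of the factors. *)
Lemma prod_eps (A B K e : R) : 0 <= A <= K -> 0 <= B <= K -> 0 < e <= 1 ->
  (A + e) * (B + e) <= (2 * K + 1) * (A * B + e).
Proof.
move=> /andP[A0 AK] /andP[B0 BK] /andP[e0 e1].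
have AB : 0 <= A * B by rewrite mulr_ge0.
have h1 : e * (A + B + e) <= e * (2 * K + 1) by rewrite ler_pM2l //; lra.
have h2 : A * B <= (2 * K + 1) * (A * B) by rewrite -[X in X <= _]mul1r ler_wpM2r //; lra.
by rewrite mulrDr; move: h1 h2; lra.
Qed.

Lemma prod_eps_big (I : eqType) (r : seq I) (K : R) : 1 <= K ->
  exists2 K', 1 <= K' & forall e, 0 < e <= 1 -> forall A : I -> R,
    (forall i, i \in r -> 0 <= A i <= K) ->
    \prod_(i <- r) (A i + e) <= K' * (\prod_(i <- r) A i + e).
Proof.
move=> K1; elim: r => [|i r [K' K1' IH]].
  exists 1 => // e /andP[e0 e1] B _; rewrite !big_nil; lra.
have KP1 : 1 <= K ^+ size (i :: r) by rewrite exprn_ege1.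
have KK1 : 1 <= K * K ^+ size (i :: r) by rewrite mulr_ege1.
exists (K' * (2 * (K * K ^+ size (i :: r)) + 1)).
  by rewrite mulr_ege1 //; lra.
move=> e e01 B HB; rewrite !big_cons.
have /andP[Bi0 BiK] := HB i (mem_head _ _); case/andP: (e01) => e0 e1.
have HBr j : j \in r -> 0 <= B j <= K by move=> jr; rewrite HB // in_cons jr orbT.
apply: (@le_trans _ _ ((B i + e) * (K' * (\prod_(j <- r) B j + e)))).
  by rewrite ler_wpM2l ?IH // addr_ge0 // ltW.
rewrite mulrCA -mulrA ler_wpM2l //; first lra.
have HP : 0 <= \prod_(j <- r) B j <= K * K ^+ size (i :: r).
  apply/andP; split.
    by rewrite big_seq; apply: prodr_ge0 => j jr; case/andP: (HBr j jr).
  have : \prod_(j <- r) B j <= K ^+ size r.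
    elim: (r) HBr => [|j s IHs] Hs; first by rewrite big_nil.
    rewrite big_cons exprS; case/andP: (Hs j (mem_head _ _)) => ? ?; apply: ler_pM => //.
      rewrite big_seq; apply: prodr_ge0 => l ls.
      have lin : l \in j :: s by rewrite in_cons ls orbT.
      by case/andP: (Hs l lin).
    by apply: IHs => l ls; rewrite Hs // in_cons ls orbT.
  move/le_trans; apply; rewrite /= exprS.
  have K1r : 1 <= K ^+ size r by rewrite exprn_ege1.
  have KK : 1 <= K * K by rewrite mulr_ege1.
  by rewrite mulrA -[X in X <= _]mul1r ler_wpM2r //; lra.
apply: prod_eps => //; rewrite Bi0 /=; apply: le_trans BiK _.
by nra.
Qed.

End Slices.

(** * Conics, their resultants and their discriminants with respect to z *)

Section Conics.
Variable K : numClosedFieldType.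

(* [Conic a b c d e f] stands for [a x^2 + b y^2 + c z^2 + 2 (d xy + e xz + f yz)]. *)
Record conic := Conic { ca : K; cb : K; cc : K; cd : K; ce : K; cf : K }.

Definition qf Q x y z :=
  ca Q * x ^+ 2 + cb Q * y ^+ 2 + cc Q * z ^+ 2
  + 2 * (cd Q * x * y + ce Q * x * z + cf Q * y * z).

Definition gx Q x y z := ca Q * x + cd Q * y + ce Q * z.
Definition gy Q x y z := cd Q * x + cb Q * y + cf Q * z.
Definition gz Q x y z := ce Q * x + cf Q * y + cc Q * z.

Definition smooth Q := forall x y z,
  gx Q x y z = 0 -> gy Q x y z = 0 -> gz Q x y z = 0 -> [/\ x = 0, y = 0 & z = 0].

Definition proportional Q1 Q2 := exists k, forall x y z, qf Q2 x y z = k * qf Q1 x y z.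

Definition cl Q x y := 2 * (ce Q * x + cf Q * y).
Definition cm Q x y := ca Q * x ^+ 2 + cb Q * y ^+ 2 + 2 * (cd Q * x * y).

Lemma qf_z Q x y z : qf Q x y z = cc Q * z ^+ 2 + cl Q x y * z + cm Q x y.
Proof. by rewrite /qf /cl /cm; ring. Qed.

(** The 2x2 minors of the coefficients of P and Q as polynomials in z; the resultant of two
    quadratic polynomials is A^2 - BD in these minors. *)
Definition resA P Q x y := cc P * cm Q x y - cc Q * cm P x y.
Definition resB P Q x y := cc P * cl Q x y - cc Q * cl P x y.
Definition resD P Q x y := cl P x y * cm Q x y - cl Q x y * cm P x y.

(* The resultant of two conics with respect to [z]. *)
Definition res P Q x y := resA P Q x y ^+ 2 - resB P Q x y * resD P Q x y.

Definition disc Q x y := cl Q x y ^+ 2 - 4 * cc Q * cm Q x y.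

Lemma conic_roots Q x y : cc Q != 0 ->
  exists z1 z2, cl Q x y = - (cc Q * (z1 + z2)) /\ cm Q x y = cc Q * z1 * z2.
Proof.
move=> c0; set s := sqrtC (disc Q x y).
have s2 : s ^+ 2 = disc Q x y by rewrite sqrtCK.
exists ((- cl Q x y + s) / (2 * cc Q)), ((- cl Q x y - s) / (2 * cc Q)).
have n2 : 2 != 0 :> K by rewrite pnatr_eq0.
split; first by field.
have -> : cm Q x y = (cl Q x y ^+ 2 - s ^+ 2) / (4 * cc Q).
  by rewrite s2 /disc; field.
by field.
Qed.

Lemma qf_factor Q x y z z1 z2 : cl Q x y = - (cc Q * (z1 + z2)) ->
  cm Q x y = cc Q * z1 * z2 -> qf Q x y z = cc Q * (z - z1) * (z - z2).
Proof. by rewrite qf_z => -> ->; ring. Qed.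

Lemma res_factor P Q x y z1 z2 w1 w2 :
  cl P x y = - (cc P * (z1 + z2)) -> cm P x y = cc P * z1 * z2 ->
  cl Q x y = - (cc Q * (w1 + w2)) -> cm Q x y = cc Q * w1 * w2 ->
  res P Q x y = cc P ^+ 2 * cc Q ^+ 2 * ((z1 - w1) * (z1 - w2) * (z2 - w1) * (z2 - w2)).
Proof. by rewrite /res /resA /resB /resD => -> -> -> ->; ring. Qed.

Lemma disc_factor Q x y z1 z2 : cl Q x y = - (cc Q * (z1 + z2)) ->
  cm Q x y = cc Q * z1 * z2 -> disc Q x y = cc Q ^+ 2 * (z1 - z2) ^+ 2.
Proof. by rewrite /disc => -> ->; ring. Qed.

Lemma res_common P Q x y z : qf P x y z = 0 -> qf Q x y z = 0 -> res P Q x y = 0.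
Proof.
rewrite !qf_z => hP hQ.
have eP : cm P x y = - (cc P * z ^+ 2 + cl P x y * z) by apply/eqP; rewrite -addr_eq0 addrC hP.
have eQ : cm Q x y = - (cc Q * z ^+ 2 + cl Q x y * z) by apply/eqP; rewrite -addr_eq0 addrC hQ.
by rewrite /res /resA /resB /resD eP eQ; ring.
Qed.

Lemma common_of_res P Q x y : cc P != 0 -> cc Q != 0 -> res P Q x y = 0 ->
  exists z, qf P x y z = 0 /\ qf Q x y z = 0.
Proof.
move=> cP cQ; have [z1 [z2 [l1 m1]]] := conic_roots x y cP.
have [w1 [w2 [l2 m2]]] := conic_roots x y cQ.
have nz : cc P ^+ 2 * cc Q ^+ 2 != 0 by rewrite mulf_neq0 ?expf_neq0.
rewrite (res_factor l1 m1 l2 m2) => /eqP.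
rewrite mulf_eq0 (negPf nz) /= !mulf_eq0 !subr_eq0 -!orbA => /or4P [] /eqP e; [exists z1|exists z1|exists z2|exists z2];
  by rewrite (qf_factor _ l1 m1) (qf_factor _ l2 m2) e ?subrr ?mulr0 ?mul0r.
Qed.

(** The binary form of degree n that dehomogenizes to h. The degree of h may be smaller than n. *)
Definition form (n : nat) (h : {poly K}) x y := \sum_(j < n.+1) h`_j * x ^+ (n - j) * y ^+ j.

(** Each root of h gives a linear factor, and each missing degree of h gives a factor x, the root at
    infinity. *)
Lemma form_factor n (h : {poly K}) : h != 0 -> (size h <= n.+1)%N ->
  exists (c : K) (s : seq (K * K)), [/\ c != 0, size s = n,
    all (fun u => u != (0, 0)) s &
    forall x y, form n h x y = c * \prod_(u <- s) (u.1 * x + u.2 * y)].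
Proof.
move=> h0 hn; have [r hr] := closed_field_poly_normal h.
have lc0 : lead_coef h != 0 by rewrite lead_coef_eq0.
have sz : size h = (size r).+1.
  by rewrite hr size_scale // size_prod_XsubC.
have rn : (size r <= n)%N by rewrite sz ltnS in hn.
exists (lead_coef h), ([seq (- z, 1) | z <- r] ++ nseq (n - size r) (1, 0)); split=> //.
- by rewrite size_cat size_map size_nseq subnKC.
- apply/allP => u; rewrite mem_cat => /orP [/mapP [z _ ->]|/nseqP [-> _]].
    by apply/eqP => -[_ /eqP]; rewrite oner_eq0.
  by apply/eqP => -[/eqP]; rewrite oner_eq0.
move=> x y; rewrite big_cat /= big_map.
have -> : forall m, \prod_(u <- nseq m (1, 0)) (u.1 * x + u.2 * y) = x ^+ m :> K.
  elim=> [|m IH]; first by rewrite big_nil.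
  by rewrite big_cons IH /= mul1r mul0r addr0 exprS.
have [x0|x0] := eqVneq x 0.
  rewrite /form big_ord_recr /= subnn expr0 mulr1 x0.
  rewrite big1 ?add0r; last first.
    by move=> i _; rewrite expr0n subn_eq0 leqNgt ltn_ord mulr0 mul0r.
  have [e|lt] := eqVneq (n - size r)%N 0%N.
    have -> : n = size r by apply/eqP; rewrite eqn_leq rn andbT -subn_eq0 e.
    rewrite subnn expr0 mulr1 lead_coefE sz /=; congr (_ * _).
    under eq_bigr => i _ do rewrite mulr0 add0r mul1r.
    by rewrite big_const_seq count_predT; elim: (size r) => //= m <-; rewrite exprS.
  rewrite expr0n (negPf lt) !mulr0 nth_default ?mul0r // sz.
  by rewrite ltn_neqAle rn andbT; apply: contraNneq lt => ->; rewrite subnn.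
have -> : form n h x y = x ^+ n * h.[y / x].
  rewrite (horner_coef_wide _ hn) mulr_sumr; apply: eq_bigr => i _.
  move: (nat_of_ord i) (leq_ord i) => m mn.
  rewrite exprMn exprVn -[in RHS](subnK mn) exprD.
  by field; rewrite expf_neq0.
rewrite {1}hr hornerZ horner_prod mulrCA; congr (_ * _).
have -> : x ^+ n = x ^+ (n - size r) * x ^+ size r by rewrite -exprD subnK.
rewrite -mulrA mulrC; congr (_ * _).
elim: (r) => [|z s IH]; first by rewrite !big_nil mulr1.
rewrite !big_cons -IH /= exprS hornerXsubC; by field.
Qed.

(** The [a], [b] and [d] are the coefficients of the forms [resA], [resB] and [resD] of degrees 2, 1
    and 3, so that the resultant is a binary quartic. *)
Definition res_poly P Q : {poly K} :=
  let a0 := cc P * ca Q - cc Q * ca P in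
  let a1 := 2 * (cc P * cd Q - cc Q * cd P) in
  let a2 := cc P * cb Q - cc Q * cb P in
  let b0 := 2 * (cc P * ce Q - cc Q * ce P) in
  let b1 := 2 * (cc P * cf Q - cc Q * cf P) in
  let d0 := 2 * (ce P * ca Q - ce Q * ca P) in
  let d1 := 2 * (2 * (ce P * cd Q - ce Q * cd P) + (cf P * ca Q - cf Q * ca P)) in
  let d2 := 2 * ((ce P * cb Q - ce Q * cb P) + 2 * (cf P * cd Q - cf Q * cd P)) in
  let d3 := 2 * (cf P * cb Q - cf Q * cb P) in
  Poly [:: a0 ^+ 2 - b0 * d0; 2 * a0 * a1 - b0 * d1 - b1 * d0;
    a1 ^+ 2 + 2 * a0 * a2 - b0 * d2 - b1 * d1;
    2 * a1 * a2 - b0 * d3 - b1 * d2; a2 ^+ 2 - b1 * d3].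

Lemma res_form P Q x y : res P Q x y = form 4 (res_poly P Q) x y.
Proof.
rewrite /form !big_ord_recr big_ord0 /= !coef_Poly /=.
by rewrite /res /resA /resB /resD /cl /cm; ring.
Qed.

Definition disc_poly Q : {poly K} :=
  Poly [:: 4 * (ce Q ^+ 2 - cc Q * ca Q); 8 * (ce Q * cf Q - cc Q * cd Q);
    4 * (cf Q ^+ 2 - cc Q * cb Q)].

Lemma disc_form Q x y : disc Q x y = form 2 (disc_poly Q) x y.
Proof.
rewrite /form !big_ord_recr big_ord0 /= !coef_Poly /=.
by rewrite /disc /cl /cm; ring.
Qed.

Lemma factor_of_form (n : nat) (h : {poly K}) (G : K -> K -> K) :
  (forall x y, G x y = form n h x y) -> (size h <= n.+1)%N ->
  (exists x y, G x y != 0) ->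
  exists (c : K) (s : seq (K * K)), [/\ c != 0, size s = n,
    all (fun u => u != (0, 0)) s &
    forall x y, G x y = c * \prod_(u <- s) (u.1 * x + u.2 * y)].
Proof.
move=> hG hn [x [y Gxy]].
have h0 : h != 0.
  apply: contraNneq Gxy => h0; rewrite hG h0 /form big1 // => i _.
  by rewrite coef0 !mul0r.
have [c [s [c0 ss sn hs]]] := form_factor h0 hn.
by exists c, s; split=> // u v; rewrite hG.
Qed.

(** A vector orthogonal to two independent vectors is a multiple of their cross product. *)
Lemma cross_proportional (u1 u2 u3 w1 w2 w3 v1 v2 v3 : K) :
  u1 * v1 + u2 * v2 + u3 * v3 = 0 -> w1 * v1 + w2 * v2 + w3 * v3 = 0 ->
  let n1 := u2 * w3 - u3 * w2 in let n2 := u3 * w1 - u1 * w3 in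
  let n3 := u1 * w2 - u2 * w1 in
  ~~ [&& n1 == 0, n2 == 0 & n3 == 0] ->
  exists k, [/\ v1 = k * n1, v2 = k * n2 & v3 = k * n3].
Proof.
move=> hu hw n1 n2 n3.
have e12 : v1 * n2 = v2 * n1.
  apply/eqP; rewrite -subr_eq0; apply/eqP.
  transitivity (u3 * (w1 * v1 + w2 * v2 + w3 * v3) - w3 * (u1 * v1 + u2 * v2 + u3 * v3)).
    by rewrite /n1 /n2; ring.
  by rewrite hu hw !mulr0 subrr.
have e13 : v1 * n3 = v3 * n1.
  apply/eqP; rewrite -subr_eq0; apply/eqP.
  transitivity (- u2 * (w1 * v1 + w2 * v2 + w3 * v3) + w2 * (u1 * v1 + u2 * v2 + u3 * v3)).
    by rewrite /n1 /n3; ring.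
  by rewrite hu hw !mulr0 addr0.
have e23 : v2 * n3 = v3 * n2.
  apply/eqP; rewrite -subr_eq0; apply/eqP.
  transitivity (u1 * (w1 * v1 + w2 * v2 + w3 * v3) - w1 * (u1 * v1 + u2 * v2 + u3 * v3)).
    by rewrite /n2 /n3; ring.
  by rewrite hu hw !mulr0 subrr.
rewrite !negb_and => /or3P [] nz.
- exists (v1 / n1); split; first by rewrite divfK.
    by rewrite mulrAC e12 mulfK.
  by rewrite mulrAC e13 mulfK.
- exists (v2 / n2); split; last by rewrite mulrAC e23 mulfK.
    by rewrite mulrAC -e12 mulfK.
  by rewrite divfK.
- exists (v3 / n3); split; last by rewrite divfK.
    by rewrite mulrAC -e13 mulfK.
  by rewrite mulrAC -e23 mulfK.
Qed.

(* Otherwise the gradients at two points of the line would be proportional. *)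
Lemma smooth_no_line Q (u1 u2 u3 w1 w2 w3 : K) : smooth Q ->
  (forall s t, t != 0 ->
     qf Q (s * u1 + t * w1) (s * u2 + t * w2) (s * u3 + t * w3) = 0) ->
  [&& u2 * w3 - u3 * w2 == 0, u3 * w1 - u1 * w3 == 0 & u1 * w2 - u2 * w1 == 0].
Proof.
move=> sQ hq; apply/negPn/negP => nz.
have q_exp s t : qf Q (s * u1 + t * w1) (s * u2 + t * w2) (s * u3 + t * w3) =
  s ^+ 2 * qf Q u1 u2 u3 + t ^+ 2 * qf Q w1 w2 w3 +
  2 * s * t * (w1 * gx Q u1 u2 u3 + w2 * gy Q u1 u2 u3 + w3 * gz Q u1 u2 u3).
  by rewrite /qf /gx /gy /gz; ring.
have n2 : 2 != 0 :> K by rewrite pnatr_eq0.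
have h0 := hq 0 1 (oner_neq0 _); have h1 := hq 1 1 (oner_neq0 _).
have h2 := hq (-1) 1 (oner_neq0 _).
rewrite !q_exp in h0 h1 h2.
have qw : qf Q w1 w2 w3 = 0 by rewrite -[RHS]h0; ring.
have qu : qf Q u1 u2 u3 = 0.
  apply: (mulfI n2); rewrite mulr0 -[RHS]addr0 -{1}h1 -{1}h2 qw; ring.
have b : w1 * gx Q u1 u2 u3 + w2 * gy Q u1 u2 u3 + w3 * gz Q u1 u2 u3 = 0.
  apply: (mulfI n2); rewrite mulr0 -[RHS]h1 qw qu; ring.
have b' : u1 * gx Q w1 w2 w3 + u2 * gy Q w1 w2 w3 + u3 * gz Q w1 w2 w3 = 0.
  by rewrite -[RHS]b /gx /gy /gz; ring.
have qu' : u1 * gx Q u1 u2 u3 + u2 * gy Q u1 u2 u3 + u3 * gz Q u1 u2 u3 = 0.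
  by rewrite -[RHS]qu /qf /gx /gy /gz; ring.
have qw' : w1 * gx Q w1 w2 w3 + w2 * gy Q w1 w2 w3 + w3 * gz Q w1 w2 w3 = 0.
  by rewrite -[RHS]qw /qf /gx /gy /gz; ring.
have [k [k1 k2 k3]] := cross_proportional qu' b nz.
have [l [l1 l2 l3]] := cross_proportional b' qw' nz.
have [ke|k0] := eqVneq k 0.
  have [e1 e2 e3] : [/\ u1 = 0, u2 = 0 & u3 = 0].
    by apply: sQ; rewrite ?k1 ?k2 ?k3 ke mul0r.
  by move: nz; rewrite e1 e2 e3 !mul0r subrr eqxx.
(* The gradients at u and w are k and l times the same normal vector, so the gradient at l u - k w
   vanishes and smoothness makes u and w dependent. *)
have [e1 e2 e3] : [/\ l * u1 - k * w1 = 0, l * u2 - k * w2 = 0 & l * u3 - k * w3 = 0].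
  apply: sQ.
  - transitivity (l * gx Q u1 u2 u3 - k * gx Q w1 w2 w3); first by rewrite /gx; ring.
    by rewrite k1 l1; ring.
  - transitivity (l * gy Q u1 u2 u3 - k * gy Q w1 w2 w3); first by rewrite /gy; ring.
    by rewrite k2 l2; ring.
  - transitivity (l * gz Q u1 u2 u3 - k * gz Q w1 w2 w3); first by rewrite /gz; ring.
    by rewrite k3 l3; ring.
have f1 : w1 = l / k * u1 by rewrite mulrAC (subr0_eq e1) mulrAC divff // mul1r.
have f2 : w2 = l / k * u2 by rewrite mulrAC (subr0_eq e2) mulrAC divff // mul1r.
have f3 : w3 = l / k * u3 by rewrite mulrAC (subr0_eq e3) mulrAC divff // mul1r.
move/negP: nz; apply; rewrite f1 f2 f3.
by apply/and3P; split; apply/eqP; ring.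
Qed.

(** A discriminant vanishing identically makes Q a multiple of the square of a linear form, and then
    Q contains the line z = - cl / (2 cc). *)
Lemma disc_neq0 Q : cc Q != 0 -> smooth Q -> exists x y, disc Q x y != 0.
Proof.
move=> c0 sQ; apply: contrapT => H.
have H0 x y : disc Q x y = 0.
  by apply/eqP; apply: contrapT => h; apply: H; exists x, y; apply/negP.
have := @smooth_no_line Q 1 0 (- (ce Q / cc Q)) 0 1 (- (cf Q / cc Q)) sQ.
rewrite !mulr1 !mulr0 !mul0r !subr0 oner_eq0 !andbF => h; apply: notF; apply: h.
move=> s t _; have n2 : 2 != 0 :> K by rewrite pnatr_eq0.
have n4 : 4 != 0 :> K by rewrite pnatr_eq0.
transitivity (- disc Q s t / (4 * cc Q)); last by rewrite H0 oppr0 mul0r.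
by rewrite /disc /cl /cm /qf; field.
Qed.

Lemma res_eliminate P Q x y z : resB P Q x y * z = - resA P Q x y ->
  resB P Q x y ^+ 2 * qf P x y z = cc P * res P Q x y.
Proof.
move=> h; rewrite qf_z.
transitivity (cc P * (resB P Q x y * z) ^+ 2 + cl P x y * resB P Q x y * (resB P Q x y * z)
   + cm P x y * resB P Q x y ^+ 2); first by ring.
by rewrite h /res /resA /resB /resD; ring.
Qed.

Lemma resB_lin P Q x y : resB P Q x y =
  2 * (cc P * ce Q - cc Q * ce P) * x + 2 * (cc P * cf Q - cc Q * cf P) * y.
Proof. by rewrite /resB /cl; ring. Qed.

Lemma resA_quad P Q s t x0 y0 x1 y1 : resA P Q (s * x0 + t * x1) (s * y0 + t * y1) =
  s ^+ 2 * resA P Q x0 y0 + t ^+ 2 * resA P Q x1 y1 +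
  s * t * (resA P Q (x0 + x1) (y0 + y1) - resA P Q x0 y0 - resA P Q x1 y1).
Proof. by rewrite /resA /cm; ring. Qed.

(** Suppose the resultant vanishes identically, so that A^2 = BD. If B = 0, then A = 0 and the
    conics are proportional. Otherwise the linear form B divides A, the common root z = - A / B is
    linear in (x, y), and P contains a line. *)
Lemma res_neq0 P Q : cc P != 0 -> cc Q != 0 -> smooth P -> ~ proportional P Q ->
  exists x y, res P Q x y != 0.
Proof.
move=> cP cQ sP nprop; apply: contrapT => H.
have H0 x y : res P Q x y = 0.
  by apply/eqP; apply: contrapT => h; apply: H; exists x, y; apply/negP.
set b0 := 2 * (cc P * ce Q - cc Q * ce P); set b1 := 2 * (cc P * cf Q - cc Q * cf P).
have hB x y : resB P Q x y = b0 * x + b1 * y by exact: resB_lin.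
have A0 x y : resB P Q x y = 0 -> resA P Q x y = 0.
  move=> h; have := H0 x y; rewrite /res h mul0r subr0 => /eqP.
  by rewrite expf_eq0 /= => /eqP.
have [bb|bb] := boolP ((b0 == 0) && (b1 == 0)).
  case/andP: bb => /eqP e0 /eqP e1; apply: nprop; exists (cc Q / cc P) => x y z.
  have hb : resB P Q x y = 0 by rewrite hB e0 e1 !mul0r addr0.
  have ha := A0 _ _ hb.
  have e : cc P * qf Q x y z - cc Q * qf P x y z = resB P Q x y * z + resA P Q x y.
    by rewrite !qf_z /resA /resB; ring.
  move: e; rewrite hb ha mul0r addr0 => /subr0_eq e.
  by rewrite mulrAC -e mulrC mulKf.
(* The vectors (b1, - b0) and (x1, y1) form a basis in which B is the second coordinate t; below,
   [A01] and [A11] are the coefficients of the linear form A / t. *)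
have [x1 [y1 hb1]] : exists x1 y1, b0 * x1 + b1 * y1 = 1.
  move: bb; rewrite negb_and; have [e0|e0] := eqVneq b0 0 => /= e1.
    by exists 0, b1^-1; rewrite mulr0 add0r divff.
  by exists b0^-1, 0; rewrite mulr0 addr0 divff.
pose A11 := resA P Q x1 y1.
pose A01 := resA P Q (b1 + x1) (- b0 + y1) - resA P Q b1 (- b0) - resA P Q x1 y1.
have := @smooth_no_line P b1 (- b0) (- A01) x1 y1 (- A11) sP.
have -> : b1 * y1 - - b0 * x1 = 1 by rewrite -hb1; ring.
rewrite oner_eq0 !andbF => h; apply: notF; apply: h => s t t0.
set x := s * b1 + t * x1; set y := s * - b0 + t * y1.
have hb : resB P Q x y = t.
  rewrite hB /x /y -[RHS]mulr1 -hb1; ring.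
have ha : resA P Q x y = t * (s * A01 + t * A11).
  rewrite /x /y resA_quad (A0 b1 (- b0)); last by rewrite hB; ring.
  by rewrite /A01 /A11 (A0 b1 (- b0)); [ring | rewrite hB; ring].
have := @res_eliminate P Q x y (s * - A01 + t * - A11); rewrite hb ha H0 mulr0 => e.
have /eqP := e ltac:(ring).
by rewrite mulf_eq0 expf_eq0 (negPf t0) /= => /eqP.
Qed.

End Conics.

#[global] Arguments qf : simpl never.
#[global] Arguments gz : simpl never.

(** * Lower bounds by compactness in C^3, viewed as R^6 *)

Section Compactness.
Variable R : realType.
Local Notation C := R[i].

Let px (u : 'rV[R]_6) : C := (u ord0 (inord 0) +i* u ord0 (inord 1))%C.
Let py (u : 'rV[R]_6) : C := (u ord0 (inord 2) +i* u ord0 (inord 3))%C.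
Let pz (u : 'rV[R]_6) : C := (u ord0 (inord 4) +i* u ord0 (inord 5))%C.

Let re3 (f : C -> C -> C -> C) (u : 'rV[R]_6) : R := complex.Re (f (px u) (py u) (pz u)).
Let im3 (f : C -> C -> C -> C) (u : 'rV[R]_6) : R := complex.Im (f (px u) (py u) (pz u)).
Let nsq3 (f : C -> C -> C -> C) (u : 'rV[R]_6) : R := nsq (f (px u) (py u) (pz u)).

Definition cont3 (f : C -> C -> C -> C) : Prop := continuous (re3 f) /\ continuous (im3 f).

Lemma cont3_x : cont3 (fun x y z => x).
Proof. by split=> u; apply: coord_continuous. Qed.
Lemma cont3_y : cont3 (fun x y z => y).
Proof. by split=> u; apply: coord_continuous. Qed.
Lemma cont3_z : cont3 (fun x y z => z).
Proof. by split=> u; apply: coord_continuous. Qed.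
Lemma cont3_c c : cont3 (fun x y z => c).
Proof. by split; apply: cst_continuous. Qed.

Lemma cont3D f g : cont3 f -> cont3 g -> cont3 (fun x y z => f x y z + g x y z).
Proof.
move=> [f1 f2] [g1 g2]; split=> u.
  have -> : re3 (fun x y z => f x y z + g x y z) = (fun u => re3 f u + re3 g u).
    by apply: boolp.funext => v; rewrite /re3 raddfD.
  exact: continuousD (f1 u) (g1 u).
have -> : im3 (fun x y z => f x y z + g x y z) = (fun u => im3 f u + im3 g u).
  by apply: boolp.funext => v; rewrite /im3 raddfD.
exact: continuousD (f2 u) (g2 u).
Qed.

Lemma ReM (z w : C) : complex.Re (z * w) =
  complex.Re z * complex.Re w - complex.Im z * complex.Im w.
Proof. by case: z w => ? ? [? ?]. Qed.

Lemma ImM (z w : C) : complex.Im (z * w) =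
  complex.Re z * complex.Im w + complex.Im z * complex.Re w.
Proof. by case: z w => ? ? [? ?]. Qed.

Lemma cont3M f g : cont3 f -> cont3 g -> cont3 (fun x y z => f x y z * g x y z).
Proof.
move=> [f1 f2] [g1 g2]; split=> u.
  have -> : re3 (fun x y z => f x y z * g x y z) =
      (fun u => re3 f u * re3 g u - im3 f u * im3 g u).
    by apply: boolp.funext => v; rewrite /re3 ReM.
  exact: continuousB (continuousM (f1 u) (g1 u)) (continuousM (f2 u) (g2 u)).
have -> : im3 (fun x y z => f x y z * g x y z) =
    (fun u => re3 f u * im3 g u + im3 f u * re3 g u).
  by apply: boolp.funext => v; rewrite /im3 ImM.
exact: continuousD (continuousM (f1 u) (g2 u)) (continuousM (f2 u) (g1 u)).
Qed.

Lemma eq_cont3 f g : (forall x y z, f x y z = g x y z) -> cont3 f -> cont3 g.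
Proof.
move=> e; have -> // : f = g.
by apply: boolp.funext => x; apply: boolp.funext => y; apply: boolp.funext => z.
Qed.

Lemma cont3_prod (I : Type) (r : seq I) (f : I -> C -> C -> C -> C) :
  (forall i, cont3 (f i)) -> cont3 (fun x y z => \prod_(i <- r) f i x y z).
Proof.
move=> cf; elim: r => [|i r IH].
  by apply: eq_cont3 (cont3_c 1) => x y z; rewrite big_nil.
by apply: eq_cont3 (cont3M (cf i) IH) => x y z; rewrite big_cons.
Qed.

Lemma cont3_nsq f : cont3 f -> continuous (nsq3 f).
Proof.
move=> [f1 f2] u; have -> : nsq3 f = (fun u => re3 f u * re3 f u + im3 f u * im3 f u).
  by apply: boolp.funext => v; rewrite /nsq3 /nsq !expr2.
exact: continuousD (continuousM (f1 u) (f1 u)) (continuousM (f2 u) (f2 u)).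
Qed.

(** A bounded region away from the origin that contains all sample points of the three families of
    faces; the bound 4 leaves room around the values nsq <= 2 of the samples. *)
Definition shell (x y z : C) : Prop :=
  [/\ nsq x <= 4, nsq y <= 4, nsq z <= 4 &
    [\/ 1 <= nsq x, 1 <= nsq y | 1 <= nsq z]].

(** The sum of the squares vanishes at most at the origin. The penalty [N + |N|] is positive there
    and zero on the shell, so the minimum of [G] over a whole box is positive and bounds the sum
    from below on the shell. *)
Lemma shell_lower_bound n (f : 'I_n -> C -> C -> C -> C) :
  (forall i, cont3 (f i)) ->
  (forall x y z, (forall i, f i x y z = 0) -> [/\ x = 0, y = 0 & z = 0]) ->
  exists2 c : R, 0 < c & forall x y z, shell x y z -> exists i, c <= nsq (f i x y z).
Proof.
move=> cf f0.
pose N (u : 'rV[R]_6) : R := 1 - (nsq (px u) + nsq (py u) + nsq (pz u)).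
pose G (u : 'rV[R]_6) := \sum_i nsq (f i (px u) (py u) (pz u)) + (N u + `|N u|).
have cN : continuous N.
  move=> u; have c1 : continuous (fun _ : 'rV[R]_6 => 1 : R) by apply: cst_continuous.
  have cx : continuous (nsq3 _) := cont3_nsq cont3_x.
  have cy : continuous (nsq3 _) := cont3_nsq cont3_y.
  have cz : continuous (nsq3 _) := cont3_nsq cont3_z.
  exact: (continuousB (c1 u) (continuousD (continuousD (cx u) (cy u)) (cz u))).
have cS : continuous (fun u : 'rV[R]_6 => \sum_i nsq3 (f i) u).
  elim: (index_enum _) => [|i r IH].
    have -> : (fun u : 'rV[R]_6 => \sum_(i <- [::]) nsq3 (f i) u) = fun=> 0.
      by apply: boolp.funext => u; rewrite big_nil.
    exact: cst_continuous.
  have -> : (fun u : 'rV[R]_6 => \sum_(i <- i :: r) nsq3 (f i) u) =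
      (fun u => nsq3 (f i) u + \sum_(i <- r) nsq3 (f i) u).
    by apply: boolp.funext => u; rewrite big_cons.
  have ci : continuous (nsq3 _) := cont3_nsq (cf i).
  by move=> u; apply: continuousD (ci u) (IH u).
have cG : continuous G.
  move=> u; apply: (continuousD (cS u)); apply: (continuousD (cN u)).
  exact: (continuous_comp (cN u) (@norm_continuous _ _ _)).
pose box := [set u : 'rV[R]_6 | forall i, `[-2, 2]%classic (u ord0 i)]%classic.
have box_c : compact box.
  exact: (@rV_compact R 6 (fun=> `[-2, 2]%classic) (fun i => @segment_compact R (-2) 2)).
have box_0 : (box !=set0)%classic.
  by exists 0 => i /=; rewrite mxE in_itv /= oppr_le0 ler0n.
have [c0 _ hc0] := compact_EVT_min box_0 box_c (continuous_subspaceT cG).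
have N0 (u : 'rV[R]_6) : 0 <= N u + `|N u|.
  by have := ler_norm (- N u); rewrite normrN; lra.
have S0 (u : 'rV[R]_6) : 0 <= \sum_i nsq (f i (px u) (py u) (pz u)).
  by apply: sumr_ge0 => i _; apply: nsq_ge0.
have Gc0 : 0 < G c0.
  rewrite lt0r addr_ge0 // andbT; apply/eqP => G0.
  have s0 : \sum_i nsq (f i (px c0) (py c0) (pz c0)) = 0.
    by apply/eqP; rewrite eq_le S0 andbT; move: (N0 c0) G0; rewrite /G; lra.
  have n0 : N c0 + `|N c0| = 0 by move: G0; rewrite /G s0 add0r.
  have [x0 y0 z0] : [/\ px c0 = 0, py c0 = 0 & pz c0 = 0].
    apply: f0 => i; apply/eqP; rewrite -nsq_eq0.
    have := psumr_eq0P (fun i _ => nsq_ge0 (f i (px c0) (py c0) (pz c0))) s0.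
    by move=> ->.
  by move: n0; rewrite /N x0 y0 z0 nsq0 !addr0 subr0 normr1; lra.
case: (posnP n) => [n0|n0].
  exists 1 => // x y z [_ _ _ h]; exfalso.
  have [x0 y0 z0] : [/\ (1 : C) = 0, (0 : C) = 0 & (0 : C) = 0].
    by apply: f0 => i; exfalso; have := ltn_ord i; lia.
  by move/eqP: x0; rewrite oner_eq0.
exists (G c0 / n%:R); first by rewrite divr_gt0 // ltr0n.
move=> x y z [hx hy hz h].
pose u : 'rV[R]_6 := \row_j nth 0 [:: complex.Re x; complex.Im x; complex.Re y;
   complex.Im y; complex.Re z; complex.Im z] j.
have ex : px u = x by rewrite /px !mxE !inordK //=; case: (x).
have ey : py u = y by rewrite /py !mxE !inordK //=; case: (y).
have ez : pz u = z by rewrite /pz !mxE !inordK //=; case: (z).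
have bnd (a b : R) : a ^+ 2 + b ^+ 2 <= 4 -> -2 <= a <= 2.
  by have := sqr_ge0 b; move=> ? ?; apply/andP; split; nra.
have ubox : u \in box.
  rewrite inE => i /=; rewrite mxE in_itv /=.
  have swap (w : C) : nsq w <= 4 -> -2 <= complex.Re w <= 2 /\ -2 <= complex.Im w <= 2.
    by move=> hw; split; apply: bnd; [exact: hw | rewrite addrC; exact: hw].
  case: i => [[|[|[|[|[|[|//]]]]]] /= _].
  - by case: (swap _ hx).
  - by case: (swap _ hx).
  - by case: (swap _ hy).
  - by case: (swap _ hy).
  - by case: (swap _ hz).
  - by case: (swap _ hz).
have := hc0 u ubox; rewrite [G u]/G ex ey ez.
have -> : N u + `|N u| = 0.
  have Nu : N u <= 0.
    rewrite /N ex ey ez; have := (nsq_ge0 x, nsq_ge0 y, nsq_ge0 z).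
    by case=> [[? ?] ?]; case: h => ?; lra.
  by rewrite ler0_norm // subrr.
rewrite addr0 => hsum; apply: contrapT => no.
have lt i : nsq (f i x y z) < G c0 / n%:R.
  by rewrite ltNge; apply/negP => le; apply: no; exists i.
have : \sum_i nsq (f i x y z) < \sum_(i < n) G c0 / n%:R.
  rewrite (bigD1 (Ordinal n0)) //= [X in _ < X](bigD1 (Ordinal n0)) //=.
  by apply: ltr_leD => //; apply: ler_sum => i _; apply: ltW.
rewrite sumr_const card_ord -[_ *+ n]mulr_natr divfK ?pnatr_eq0 -?lt0n //.
by rewrite ltNge hsum.
Qed.

End Compactness.

(** * Fibre estimates along z for one conic and for a pair of conics *)

Section RootEstimates.
Variable R : realType.
Local Notation C := R[i].
Local Notation conic := (conic C).

Definition bnd3 (f : C -> C -> C -> C) : Prop :=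
  exists2 B : R, 1 <= B & forall x y z, nsq x <= 4 -> nsq y <= 4 -> nsq z <= 4 ->
    nsq (f x y z) <= B.

Lemma bnd3_x : bnd3 (fun x y z => x). Proof. by exists 4; first lra. Qed.
Lemma bnd3_y : bnd3 (fun x y z => y). Proof. by exists 4; first lra. Qed.
Lemma bnd3_z : bnd3 (fun x y z => z). Proof. by exists 4; first lra. Qed.
Lemma bnd3_c c : bnd3 (fun x y z => c).
Proof. by exists (1 + nsq c) => [|? ? ? _ _ _]; have := nsq_ge0 c; lra. Qed.

Lemma bnd3D f g : bnd3 f -> bnd3 g -> bnd3 (fun x y z => f x y z + g x y z).
Proof.
move=> [A A1 HA] [B B1 HB]; exists (2 * (A + B)); first lra.
move=> x y z hx hy hz; apply: le_trans (nsqD_le _ _) _.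
by rewrite ler_pM2l // lerD ?HA ?HB.
Qed.

Lemma bnd3M f g : bnd3 f -> bnd3 g -> bnd3 (fun x y z => f x y z * g x y z).
Proof.
move=> [A A1 HA] [B B1 HB]; exists (A * B); first by rewrite mulr_ege1.
by move=> x y z hx hy hz; rewrite nsqM ler_pM ?nsq_ge0 ?HA ?HB.
Qed.

Lemma eq_bnd3 f g : (forall x y z, f x y z = g x y z) -> bnd3 f -> bnd3 g.
Proof. by move=> e [B B1 HB]; exists B => // x y z *; rewrite -e HB. Qed.

Lemma bnd3_lin (a b c : C) : bnd3 (fun x y z => a * x + b * y + c * z).
Proof.
apply: bnd3D; first apply: bnd3D; apply: bnd3M; try exact: bnd3_c.
- exact: bnd3_x.
- exact: bnd3_y.
- exact: bnd3_z.
Qed.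

Lemma bnd3_cl Q : bnd3 (fun x y z => cl Q x y).
Proof.
by apply: eq_bnd3 (bnd3_lin (2 * ce Q) (2 * cf Q) 0) => x y z; rewrite /cl; ring.
Qed.

Lemma bnd3_cm Q : bnd3 (fun x y z => cm Q x y).
Proof.
apply: eq_bnd3 (bnd3D (bnd3M bnd3_x (bnd3_lin (ca Q) (2 * cd Q) 0))
  (bnd3M bnd3_y (bnd3_lin 0 (cb Q) 0))) => x y z.
by rewrite /cm; ring.
Qed.

Lemma bnd3_qf Q : bnd3 (qf Q).
Proof.
apply: eq_bnd3 (bnd3D (bnd3M bnd3_z (bnd3_lin (2 * ce Q) (2 * cf Q) (cc Q))) (bnd3_cm Q)) => x y z.
by rewrite qf_z /cl; ring.
Qed.

(** A root of modulus above 1 satisfies z = - l/c - (m/c)/z, whose last term is at most |m/c|. *)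
Lemma root_bound (c l m z1 z2 : C) : c != 0 -> l = - (c * (z1 + z2)) ->
  m = c * z1 * z2 -> nsq z1 <= 1 + 2 * (nsq (l / c) + nsq (m / c)).
Proof.
move=> c0 el em; have h1 := nsq_ge0 (l / c); have h2 := nsq_ge0 (m / c).
have [le1|gt1] := leP (nsq z1) 1; first lra.
have z0 : z1 != 0 by apply: contraTneq gt1 => ->; rewrite nsq0 -leNgt ler01.
have -> : nsq z1 = nsq (l / c + m / c / z1).
  by rewrite -nsqN; congr nsq; rewrite el em; field; rewrite c0 z0.
apply: le_trans (nsqD_le _ _) _.
have : nsq (m / c / z1) <= nsq (m / c).
  by rewrite nsqM nsqV ler_pdivrMr ?nsq_gt0 //; nra.
by lra.
Qed.

Lemma roots_bounded Q : cc Q != 0 -> exists2 B : R, 1 <= B &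
  forall x y z1 z2, nsq x <= 4 -> nsq y <= 4 ->
  cl Q x y = - (cc Q * (z1 + z2)) -> cm Q x y = cc Q * z1 * z2 ->
  nsq z1 <= B /\ nsq z2 <= B.
Proof.
move=> c0; have [B1 B11 H1] := bnd3M (bnd3_cl Q) (bnd3_c (cc Q)^-1).
have [B2 B21 H2] := bnd3M (bnd3_cm Q) (bnd3_c (cc Q)^-1).
exists (1 + 2 * (B1 + B2)); first lra.
move=> x y z1 z2 hx hy el em.
have h1 : nsq (cl Q x y / cc Q) <= B1 by apply: (H1 x y 0); rewrite // nsq0.
have h2 : nsq (cm Q x y / cc Q) <= B2 by apply: (H2 x y 0); rewrite // nsq0.
have e1 := root_bound c0 el em.
have e2 : nsq z2 <= 1 + 2 * (nsq (cl Q x y / cc Q) + nsq (cm Q x y / cc Q)).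
  by apply: (@root_bound _ _ _ z2 z1 c0); rewrite ?el ?em; ring.
by split; lra.
Qed.

Lemma nsqB_le (z w : C) (A B : R) : nsq z <= A -> nsq w <= B -> nsq (z - w) <= 2 * (A + B).
Proof.
move=> hz hw; apply: le_trans (nsqD_le _ _) _; rewrite nsqN ler_pM2l // lerD //.
Qed.

Lemma ng_le_inv (p c x y : R) : 0 <= p -> 0 < c -> 0 < x -> 0 < y -> x <= c * y ->
  ng p y <= ng p c^-1 * ng p x.
Proof.
move=> p0 c0 x0 y0 h; apply: ngM_le => //; first by rewrite invr_gt0.
by rewrite mulrC ler_pdivrMr // mulrC.
Qed.

Lemma addr_pos (x e : R) : 0 <= x -> 0 < e -> 0 < x + e.
Proof. by move=> *; rewrite ltr_wpDl. Qed.

(** On a vertical line the conic is cc (z - z1)(z - z2), a product of two poles, and the squared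
    distance of the two roots is the discriminant up to a constant. As the roots are bounded, |z1 -
    z2|^4 is at most a multiple of |z1 - z2|^2. *)
Lemma single_slice (P : conic) (p r : R) : cc P != 0 -> 0 <= r <= p -> 2 * p - r < 1 ->
  exists2 K : R, 0 <= K & forall L M zeta e x y, good_mesh L M zeta e ->
    nsq x <= 4 -> nsq y <= 4 ->
    EA L M zeta (fun z => ng p (nsq (qf P x y z) + e)) <= K * ng r (nsq (disc P x y) + e).
Proof.
move=> c0 rp hp; case/andP: (rp) => r0 rp'; have p0 : 0 <= p by lra.
have [B B1 HB] := roots_bounded c0; have [K K0 HK] := slice_bound rp hp.
set D := 2 * (4 + B); set c := nsq (cc P); have c_gt0 : 0 < c by rewrite nsq_gt0.
set m := Num.min c 1; have m0 : 0 < m by rewrite lt_min c_gt0 ltr01.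
set k1 := ng p (m / (2 * D + 1)); set E := c ^+ 2 * (4 * B) + 1.
have D0 : 0 < 2 * D + 1 by rewrite /D; lra.
have E0 : 0 < E by rewrite /E ltr_wpDl // mulr_ge0 ?exprn_ge0 ?ltW //; lra.
exists (k1 * K * ng r E^-1); first by rewrite !mulr_ge0 ?ng_ge0.
move=> L M zeta e x y mesh hx hy; case: (mesh) => zeta1 L0 M0 /andP[e0 e1] Me.
have [z1 [z2 [el em]]] := conic_roots x y c0.
have [b1 b2] := HB _ _ _ _ hx hy el em.
apply: (@le_trans _ _ (EA L M zeta (fun z => k1 * (ng p (nsq (z - z1) + e) * ng p (nsq (z - z2) + e))))).
  apply: EA_le => // z hz.
  have X1 := addr_pos (nsq_ge0 (z - z1)) e0; have X2 := addr_pos (nsq_ge0 (z - z2)) e0.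
  rewrite -ngM //; apply: ngM_le => //; rewrite ?divr_gt0 ?mulr_gt0 //.
  rewrite (qf_factor _ el em) !nsqM -/c mulrAC ler_pdivrMr //.
  have hz4 : nsq z <= 4 by lra.
  have a1 : nsq (z - z1) <= D by apply: nsqB_le.
  have a2 : nsq (z - z2) <= D by apply: nsqB_le.
  have := @prod_eps R (nsq (z - z1)) (nsq (z - z2)) D e.
  rewrite !nsq_ge0 a1 a2 e0 e1 => /(_ isT isT isT) h.
  have mc : m <= c by rewrite ge_min lexx.
  have m1 : m <= 1 by rewrite ge_min lexx orbT.
  have AB : 0 <= nsq (z - z1) * nsq (z - z2) by rewrite mulr_ge0 ?nsq_ge0.
  apply: (@le_trans _ _ (m * ((2 * D + 1) * (nsq (z - z1) * nsq (z - z2) + e)))).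
    by rewrite ler_pM2l.
  rewrite mulrCA mulrC ler_pM2r // mulrDr -mulrA lerD //.
    by rewrite ler_wpM2r.
  by rewrite -[X in _ <= X]mul1r ler_pM2r.
rewrite /EA meanZ -!mulrA ler_wpM2l ?ng_ge0 //.
apply: le_trans (HK _ _ _ z1 z2 _ mesh) _; rewrite ler_wpM2l //.
apply: ng_le_inv => //; try by apply: addr_pos => //; apply: nsq_ge0.
rewrite (disc_factor el em) nsqM !nsqX -/c /E; set t := nsq (z1 - z2).
have t0 : 0 <= t := nsq_ge0 _.
have t4 : t <= 4 * B by have := nsqB_le b1 b2; rewrite /t; lra.
set q := c ^+ 2 * (4 * B).
have q0 : 0 <= q by rewrite /q mulr_ge0 ?exprn_ge0 ?(ltW c_gt0) //; lra.
have h1 : c ^+ 2 * t ^+ 2 <= q * t.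
  by rewrite /q -mulrA ler_wpM2l ?exprn_ge0 ?(ltW c_gt0) // expr2 ler_wpM2r.
have h2 : 0 <= q * e by rewrite mulr_ge0 // ltW.
have -> : (q + 1) * (t + e) = q * t + q * e + t + e by ring.
by lra.
Qed.

(** 2 [gz] is the z-derivative cc ((z - z1) + (z - z2)). Where it is bounded below, only one of the
    two roots can be near z, and the product of two poles becomes a sum of single ones. *)
Lemma near_root (P : conic) (p c0 : R) : 0 <= p -> cc P != 0 -> 0 < c0 ->
  exists2 K : R, 0 <= K & forall x y z z1 z2 e, 0 < e ->
    cl P x y = - (cc P * (z1 + z2)) -> cm P x y = cc P * z1 * z2 ->
    c0 <= nsq (gz P x y z) ->
    ng p (nsq (qf P x y z) + e) <= K * (ng p (nsq (z - z1) + e) + ng p (nsq (z - z2) + e)).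
Proof.
move=> p0 cP c00; set c := nsq (cc P); have c_gt0 : 0 < c by rewrite nsq_gt0.
set m := Num.min c0 1; have m0 : 0 < m by rewrite lt_min c00 ltr01.
exists (ng p m); first exact: ng_ge0.
move=> x y z z1 z2 e e0 el em hg.
have hg2 : c0 <= c * nsq (z - z1) \/ c0 <= c * nsq (z - z2).
  have e4 : 4 * nsq (gz P x y z) = c * nsq ((z - z1) + (z - z2)).
    have -> : 4 * nsq (gz P x y z) = nsq (2 * gz P x y z).
      by rewrite nsqM -[2 : C](rmorph_nat (real_complex R) 2) nsq_real; ring.
    rewrite /c -nsqM; congr nsq.
    have -> : 2 * gz P x y z = cl P x y + 2 * cc P * z by rewrite /gz /cl; ring.
    by rewrite el; ring.
  have h : c * nsq ((z - z1) + (z - z2)) <= c * (2 * (nsq (z - z1) + nsq (z - z2))).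
    by rewrite ler_pM2l // nsqD_le.
  case: (lerP c0 (c * nsq (z - z1))) => h1; [by left|right].
  by rewrite leNgt; apply/negP => h2; lra.
have h0 (w w' : C) : c0 <= c * nsq (z - w) ->
    ng p (c * nsq (z - w) * nsq (z - w') + e) <= ng p m * ng p (nsq (z - w') + e).
  move=> hw; apply: ngM_le => //; first by apply: addr_pos => //; apply: nsq_ge0.
  rewrite mulrDr lerD //.
    by rewrite ler_wpM2r ?nsq_ge0 //; apply: le_trans hw; rewrite ge_min lexx.
  by rewrite -[X in _ <= X]mul1r ler_pM2r // ge_min lexx orbT.
rewrite (qf_factor _ el em) !nsqM -/c.
case: hg2 => hw.
  apply: le_trans (h0 _ _ hw) _; rewrite ler_wpM2l ?ng_ge0 //.
  by rewrite lerDr ng_ge0.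
rewrite -mulrA [nsq (z - z1) * _]mulrC mulrA.
apply: le_trans (h0 _ _ hw) _; rewrite ler_wpM2l ?ng_ge0 //.
by rewrite lerDl ng_ge0.
Qed.

(** Away from vertical tangents each conic contributes a sum of two simple poles, so the product
    consists of four terms, one for each pair of roots z_i, w_j. The resultant is the product of the
    four differences, and three of them are bounded, so it can replace any single difference. *)
Lemma pair_slice (P Q : conic) (p r c0 : R) : cc P != 0 -> cc Q != 0 -> 0 < c0 ->
  0 <= r <= p -> 2 * p - r < 1 ->
  exists2 K : R, 0 <= K & forall L M zeta e x y, good_mesh L M zeta e ->
    nsq x <= 4 -> nsq y <= 4 ->
    EA L M zeta (fun z => ((c0 <= nsq (gz P x y z)) && (c0 <= nsq (gz Q x y z)))%R%:R *
       (ng p (nsq (qf P x y z) + e) * ng p (nsq (qf Q x y z) + e)))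
    <= K * ng r (nsq (res P Q x y) + e).
Proof.
move=> cP cQ c00 rp hp; case/andP: (rp) => r0 rp'; have p0 : 0 <= p by lra.
have [BP BP1 HBP] := roots_bounded cP; have [BQ BQ1 HBQ] := roots_bounded cQ.
have [KP KP0 HKP] := near_root p0 cP c00; have [KQ KQ0 HKQ] := near_root p0 cQ c00.
have [K K0 HK] := slice_bound rp hp.
set D := 2 * (BP + BQ); have D1 : 1 <= D by rewrite /D; lra.
set E := nsq (cc P) ^+ 2 * nsq (cc Q) ^+ 2 * D ^+ 3 + 1.
have cPQ0 : 0 <= nsq (cc P) ^+ 2 * nsq (cc Q) ^+ 2 by rewrite mulr_ge0 ?sqr_ge0.
have E1 : 1 <= E by rewrite /E lerDr mulr_ge0 // exprn_ge0 //; lra.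
have E0 : 0 < E by lra.
exists (KP * KQ * (4 * (K * ng r E^-1))).
  by rewrite !mulr_ge0 ?ng_ge0.
move=> L M zeta e x y mesh hx hy; case: (mesh) => zeta1 L0 M0 /andP[e0 e1] Me.
have [z1 [z2 [el em]]] := conic_roots x y cP.
have [w1 [w2 [fl fm]]] := conic_roots x y cQ.
have [b1 b2] := HBP _ _ _ _ hx hy el em; have [d1 d2] := HBQ _ _ _ _ hx hy fl fm.
pose g a b z := ng p (nsq (z - a) + e) * ng p (nsq (z - b) + e).
apply: (@le_trans _ _ (EA L M zeta (fun z => KP * KQ *
    (g z1 w1 z + g z1 w2 z + g z2 w1 z + g z2 w2 z)))).
  apply: EA_le => // z hz.
  case: (boolP (_ && _)) => [/andP[gP gQ]|_]; last first.
    by rewrite mul0r !mulr_ge0 // !addr_ge0 // mulr_ge0 ?ng_ge0.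
  rewrite mul1r.
  have hP := HKP _ _ _ _ _ _ e0 el em gP; have hQ := HKQ _ _ _ _ _ _ e0 fl fm gQ.
  have h := ler_pM (ng_ge0 _ _) (ng_ge0 _ _) hP hQ.
  apply: le_trans h _; rewrite le_eqVlt; apply/orP; left; apply/eqP; rewrite /g; ring.
rewrite /EA meanZ -mulrA ler_wpM2l //; first by rewrite mulr_ge0.
rewrite !meanD.
have sl a b : nsq (a - b) * (nsq (cc P) ^+ 2 * nsq (cc Q) ^+ 2 * D ^+ 3) >= nsq (res P Q x y) ->
    EA L M zeta (g a b) <= K * ng r E^-1 * ng r (nsq (res P Q x y) + e).
  move=> hab; apply: le_trans (HK L M zeta a b e mesh) _.
  rewrite -mulrA ler_wpM2l //; apply: ng_le_inv => //;
    try by apply: addr_pos => //; apply: nsq_ge0.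
  rewrite /E mulrDl mul1r mulrDr; have a0 := nsq_ge0 (a - b).
  have : 0 <= nsq (cc P) ^+ 2 * nsq (cc Q) ^+ 2 * D ^+ 3 * e.
    by rewrite mulr_ge0 ?(ltW e0) // mulr_ge0 // exprn_ge0 //; lra.
  by rewrite [nsq (a - b) * _]mulrC in hab; lra.
have bb a b : nsq a <= BP -> nsq b <= BQ -> 0 <= nsq (a - b) <= D.
  by move=> ha hb; rewrite nsq_ge0 nsqB_le.
have r4 (a b c d : R) : 0 <= a <= D -> 0 <= b <= D -> 0 <= c <= D -> 0 <= d ->
    nsq (cc P) ^+ 2 * nsq (cc Q) ^+ 2 * (a * b * c * d) <=
    d * (nsq (cc P) ^+ 2 * nsq (cc Q) ^+ 2 * D ^+ 3).
  move=> /andP[a0 aD] /andP[bb0 bD] /andP[cc0 cD] d0.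
  set w := nsq (cc P) ^+ 2 * nsq (cc Q) ^+ 2.
  have -> : w * (a * b * c * d) = d * (w * (a * b * c)) by ring.
  rewrite ler_wpM2l // ler_wpM2l //.
  have -> : D ^+ 3 = D * D * D by ring.
  by rewrite !ler_pM // mulr_ge0.
have eres : nsq (res P Q x y) = nsq (cc P) ^+ 2 * nsq (cc Q) ^+ 2 *
    (nsq (z1 - w1) * nsq (z1 - w2) * nsq (z2 - w1) * nsq (z2 - w2)).
  rewrite (res_factor el em fl fm) nsqM [nsq (cc P ^+ 2 * _)]nsqM !nsqX.
  by congr (_ * _); rewrite !nsqM.
have -> : 4 * (K * ng r E^-1) * ng r (nsq (res P Q x y) + e) =
  K * ng r E^-1 * ng r (nsq (res P Q x y) + e) + K * ng r E^-1 * ng r (nsq (res P Q x y) + e)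
  + K * ng r E^-1 * ng r (nsq (res P Q x y) + e) + K * ng r E^-1 * ng r (nsq (res P Q x y) + e).
  by ring.
have n0 := nsq_ge0.
rewrite !lerD //; apply: (sl _ _); rewrite eres.
- have -> : nsq (z1 - w1) * nsq (z1 - w2) * nsq (z2 - w1) * nsq (z2 - w2) =
     nsq (z2 - w2) * nsq (z1 - w2) * nsq (z2 - w1) * nsq (z1 - w1) by ring.
  by apply: r4 => //; apply: bb.
- have -> : nsq (z1 - w1) * nsq (z1 - w2) * nsq (z2 - w1) * nsq (z2 - w2) =
     nsq (z2 - w2) * nsq (z1 - w1) * nsq (z2 - w1) * nsq (z1 - w2) by ring.
  by apply: r4 => //; apply: bb.
- have -> : nsq (z1 - w1) * nsq (z1 - w2) * nsq (z2 - w1) * nsq (z2 - w2) =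
     nsq (z2 - w2) * nsq (z1 - w2) * nsq (z1 - w1) * nsq (z2 - w1) by ring.
  by apply: r4 => //; apply: bb.
by apply: r4 => //; apply: bb.
Qed.

End RootEstimates.

(** * Uniform constants over finite index sets *)

Section UniformConstants.
Variable R : realType.

Lemma uniform_pos (T : finType) (P : T -> R -> Prop) :
  (forall t, exists2 c, 0 < c & P t c) ->
  (forall t c c', 0 < c' <= c -> P t c -> P t c') ->
  exists2 c, 0 < c & forall t, P t c.
Proof.
move=> ex mono.
suff [c c0 hc] : exists2 c, 0 < c & forall t, t \in enum T -> P t c.
  by exists c => // t; apply: hc; rewrite mem_enum.
elim: (enum T) => [|t s [c c0 hc]]; first by exists 1.
have [c' c'0 hc'] := ex t.
exists (Num.min c c'); first by rewrite lt_min c0 c'0.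
move=> u; rewrite in_cons => /predU1P[->|us].
  by apply: mono hc'; rewrite lt_min c0 c'0 ge_min lexx orbT.
by apply: mono (hc u us); rewrite lt_min c0 c'0 ge_min lexx.
Qed.

Lemma uniform_bound (T : finType) (P : T -> R -> Prop) :
  (forall t, exists2 c, 0 <= c & P t c) ->
  (forall t c c', c <= c' -> P t c -> P t c') ->
  exists2 c, 0 <= c & forall t, P t c.
Proof.
move=> ex mono.
suff [c c0 hc] : exists2 c, 0 <= c & forall t, t \in enum T -> P t c.
  by exists c => // t; apply: hc; rewrite mem_enum.
elim: (enum T) => [|t s [c c0 hc]]; first by exists 0.
have [c' c'0 hc'] := ex t.
exists (c + c'); first by rewrite addr_ge0.
move=> u; rewrite in_cons => /predU1P[->|us].
  by apply: mono hc'; lra.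
by apply: mono (hc u us); lra.
Qed.

(** Bound every factor by the largest one. *)
Lemma prod_le_sum (T : eqType) (s : seq T) (a : T -> R) : (0 < size s)%N ->
  (forall u, 0 <= a u) -> \prod_(u <- s) a u <= \sum_(u <- s) a u ^+ size s.
Proof.
move=> s0 a0.
have [m ms hm] : exists2 m, m \in s & forall u, u \in s -> a u <= a m.
  elim: s s0 => // u [|v s] IH _.
    by exists u; rewrite ?inE // => w; rewrite inE => /eqP ->.
  have [m ms hm] := IH isT; case: (leP (a m) (a u)) => h.
    exists u; rewrite ?mem_head // => w; rewrite in_cons => /predU1P[-> //|/hm ws].
    exact: le_trans ws h.
  exists m; first by rewrite in_cons ms orbT.
  by move=> w; rewrite in_cons => /predU1P[->|/hm //]; apply: ltW.
apply: (@le_trans _ _ (a m ^+ size s)).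
  elim: (s) hm => [|u t IH] ht; first by rewrite big_nil.
  rewrite big_cons exprS ler_pM ?ht ?mem_head //; first exact: prodr_ge0.
  by apply: IH => w wt; rewrite ht // in_cons wt orbT.
rewrite (perm_big _ (perm_to_rem ms)) big_cons lerDl.
by apply: sumr_ge0 => u _; apply: exprn_ge0.
Qed.

Lemma le_sum2 (T : finType) (f : T -> T -> R) i j : i != j ->
  (forall i j, 0 <= f i j) -> f i j <= \sum_i \sum_(j | i != j) f i j.
Proof.
move=> ij f0; rewrite (bigD1 i) //= (bigD1 j) //= -addrA lerDl addr_ge0 //.
  by apply: sumr_ge0.
by apply: sumr_ge0 => l _; apply: sumr_ge0.
Qed.

End UniformConstants.

(** * Functions of (x, y) whose averages are bounded uniformly in the grid *)

Section AverageBounded.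
Variable R : realType.
Local Notation C := R[i].

(** Either variable may be the one on the boundary, because the faces of x and those of y are
    treated by the same estimate. *)
Definition avg_bounded (h : R -> C -> C -> R) : Prop :=
  exists2 K : R, 0 <= K & forall L M zeta e, good_mesh L M zeta e ->
    (forall x, 1 <= nsq x <= 2 -> EA L M zeta (fun y => h e x y) <= K) /\
    (forall y, 1 <= nsq y <= 2 -> EA L M zeta (fun x => h e x y) <= K).

Lemma avg_bounded_cst c : 0 <= c -> avg_bounded (fun _ _ _ => c).
Proof. by move=> c0; exists c => // *; split=> *; apply: EA_cst_le. Qed.

Lemma avg_boundedD g h : avg_bounded g -> avg_bounded h ->
  avg_bounded (fun e x y => g e x y + h e x y).
Proof.
move=> [A A0 HA] [B B0 HB]; exists (A + B); first by rewrite addr_ge0.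
move=> L M zeta e mesh; have [a1 a2] := HA _ _ _ _ mesh; have [b1 b2] := HB _ _ _ _ mesh.
by split=> t ht; rewrite /EA meanD lerD //; [apply: a1|apply: b1|apply: a2|apply: b2].
Qed.

Lemma avg_boundedZ c h : 0 <= c -> avg_bounded h ->
  avg_bounded (fun e x y => c * h e x y).
Proof.
move=> c0 [B B0 HB]; exists (c * B); first by rewrite mulr_ge0.
move=> L M zeta e mesh; have [b1 b2] := HB _ _ _ _ mesh.
by split=> t ht; rewrite /EA meanZ ler_wpM2l //; [apply: b1|apply: b2].
Qed.

Lemma avg_bounded_le g h : avg_bounded h ->
  (forall e x y, 0 < e <= 1 -> nsq x <= 4 -> nsq y <= 4 -> g e x y <= h e x y) ->
  avg_bounded g.
Proof.
move=> [B B0 HB] gh; exists B => // L M zeta e mesh; have [b1 b2] := HB _ _ _ _ mesh.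
case: mesh => z1 _ M0 e01 _.
split=> t ht.
  apply: le_trans (b1 t ht); apply: EA_le => // y hy; apply: gh => //; lra.
apply: le_trans (b2 t ht); apply: EA_le => // x hx; apply: gh => //; lra.
Qed.

Lemma avg_bounded_sum (T : eqType) (s : seq T) (P : pred T) (h : T -> R -> C -> C -> R) :
  (forall t, t \in s -> P t -> avg_bounded (h t)) ->
  avg_bounded (fun e x y => \sum_(t <- s | P t) h t e x y).
Proof.
move=> hs; have e0 : forall e x y, \sum_(t <- s | P t) h t e x y =
    \sum_(t <- s) (if P t then h t e x y else 0) by move=> *; rewrite big_mkcond.
suff [K K0 HK] : avg_bounded (fun e x y => \sum_(t <- s) (if P t then h t e x y else 0)).
  exists K => // L M zeta e mesh; have [h1 h2] := HK _ _ _ _ mesh.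
  split=> t ht; rewrite /EA; under eq_mean => i do rewrite e0; [exact: h1|exact: h2].
elim: s hs {e0} => [|t s IH] hs.
  have [K K0 HK] := avg_bounded_cst (lexx 0); exists K => // L M zeta e mesh.
  have [h1 h2] := HK _ _ _ _ mesh.
  split=> u hu; rewrite /EA; under eq_mean => i do rewrite big_nil; [exact: h1 u hu|exact: h2 u hu].
have IHs : avg_bounded (fun e x y => \sum_(t <- s) (if P t then h t e x y else 0)).
  by apply: IH => u us; apply: hs; rewrite in_cons us orbT.
have ht : avg_bounded (fun e x y => if P t then h t e x y else 0).
  by case Pt: (P t); [apply: hs; rewrite ?mem_head | apply: avg_bounded_cst].
have [K K0 HK] := avg_boundedD ht IHs; exists K => // L M zeta e mesh.
have [h1 h2] := HK _ _ _ _ mesh.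
split=> u hu; rewrite /EA; under eq_mean => i do rewrite big_cons; [exact: h1 u hu|exact: h2 u hu].
Qed.

Lemma avg_bounded_lin (p : R) (u : C * C) : 0 <= p < 1 -> u != (0, 0) ->
  avg_bounded (fun e x y => ng p (nsq (u.1 * x + u.2 * y) + e)).
Proof.
case: u => a b p01 ab0 /=.
have ba0 : (b, a) != (0, 0) by apply: contraNneq ab0 => -[-> ->].
have [K K0 HK] := linear_form_bound p01 ab0; have [K' K'0 HK'] := linear_form_bound p01 ba0.
exists (K + K'); first by rewrite addr_ge0.
move=> L M zeta e mesh; split=> t /andP[t1 t2].
  by apply: le_trans (HK _ _ _ _ _ mesh t1) _; rewrite lerDl.
apply: le_trans (_ : _ <= K') _; last by rewrite lerDr.
apply: le_trans (HK' _ _ _ _ _ mesh t1); apply: le_mean => i.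
by rewrite [a * _ + _]addrC.
Qed.

Lemma linear_forms_bounded (s : seq (C * C)) : exists2 B : R, 1 <= B &
  forall u x y, u \in s -> nsq x <= 4 -> nsq y <= 4 -> nsq (u.1 * x + u.2 * y) <= B.
Proof.
elim: s => [|u s [B B1 HB]]; first by exists 1.
have [B' B'1 HB'] := bnd3_lin u.1 u.2 0.
exists (B + B'); first lra.
move=> w x y; rewrite in_cons => /predU1P[->|ws] hx hy.
  have := HB' x y 0 hx hy; rewrite nsq0 mul0r addr0 => /(_ ltac:(lra)) h.
  by apply: le_trans h _; rewrite lerDr; lra.
by apply: le_trans (HB w x y ws hx hy) _; rewrite lerDl; lra.
Qed.

(** The worst case is that all forms coincide, hence the threshold 1 / size for the exponent;
    [prod_le_sum] reduces the general case to that one. *)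
Lemma avg_bounded_prod (c : C) (s : seq (C * C)) (p : R) :
  c != 0 -> (0 < size s)%N -> all (fun u => u != (0, 0)) s ->
  0 <= p -> (size s)%:R * p < 1 ->
  avg_bounded (fun e x y => ng p (nsq (c * \prod_(u <- s) (u.1 * x + u.2 * y)) + e)).
Proof.
move=> c0 s0 sn p0 hp.
have [B B1 HB] := linear_forms_bounded s.
have [K K1 HK] := @prod_eps_big R _ s B B1.
set m := Num.min (nsq c) 1; have m0 : 0 < m by rewrite lt_min nsq_gt0 c0 ltr01.
have hsum : avg_bounded (fun e x y => \sum_(u <- s)
    ng ((size s)%:R * p) (nsq (u.1 * x + u.2 * y) + e)).
  apply: avg_bounded_sum => u us _; apply: avg_bounded_lin; last exact: (allP sn).
  by rewrite hp mulr_ge0.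
have mK : 0 < m / K by rewrite divr_gt0 //; lra.
apply: (avg_bounded_le (avg_boundedZ (ng_ge0 p (m / K)) hsum)) => e x y e01 hx hy.
case/andP: (e01) => e0 e1.
have X0 u : 0 < nsq (u.1 * x + u.2 * y : C) + e by apply: addr_pos => //; apply: nsq_ge0.
apply: (@le_trans _ _ (ng p (m / K) * \prod_(u <- s) ng p (nsq (u.1 * x + u.2 * y) + e))).
  rewrite -ng_prod //; apply: ngM_le => //; first by apply: prodr_gt0.
  have h := HK e e01 (fun u => nsq (u.1 * x + u.2 * y)).
  rewrite nsqM nsq_prod.
  rewrite mulrAC ler_pdivrMr; last lra.
  apply: (@le_trans _ _ (m * (K * (\prod_(i <- s) nsq (i.1 * x + i.2 * y) + e)))).
    by rewrite ler_pM2l //; apply: h => u us; rewrite nsq_ge0 HB.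
  rewrite mulrCA mulrC ler_pM2r; last lra.
  rewrite mulrDr lerD //.
    rewrite ler_wpM2r ?ge_min ?lexx //.
    by apply: prodr_ge0 => u _; apply: nsq_ge0.
  by rewrite -[X in _ <= X]mul1r ler_pM2r // ge_min lexx orbT.
rewrite ler_wpM2l ?ng_ge0 //.
apply: le_trans (prod_le_sum s0 _) _; first by move=> u; apply: ng_ge0.
by apply: ler_sum => u _; rewrite ngX.
Qed.

End AverageBounded.

(** * Simple zeros of the resultant *)

Section ResultantDerivative.
Variable K : numClosedFieldType.
Local Notation conic := (conic K).

(** The derivative of [cm] at (x, y) in the direction (u, v). *)
Definition pm (Q : conic) x y u v :=
  2 * (ca Q * x * u + cb Q * y * v + cd Q * (x * v + y * u)).

(* The derivative of [res P Q] at [(x, y)] in the direction [(u, v)]. *)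
Definition dres P Q x y u v :=
  2 * resA P Q x y * (cc P * pm Q x y u v - cc Q * pm P x y u v)
  - resB P Q u v * resD P Q x y
  - resB P Q x y * (cl P u v * cm Q x y + cl P x y * pm Q x y u v
      - cl Q u v * cm P x y - cl Q x y * pm P x y u v).

Lemma res_expand P Q x y u v : exists a2 a3 a4, forall t,
  res P Q (x + t * u) (y + t * v) =
  res P Q x y + t * dres P Q x y u v + t ^+ 2 * a2 + t ^+ 3 * a3 + t ^+ 4 * a4.
Proof.
pose A0 := resA P Q x y; pose A1 := cc P * pm Q x y u v - cc Q * pm P x y u v.
pose A2 := resA P Q u v; pose B0 := resB P Q x y; pose B1 := resB P Q u v.
pose D0 := resD P Q x y.
pose D1 := cl P u v * cm Q x y + cl P x y * pm Q x y u v
      - cl Q u v * cm P x y - cl Q x y * pm P x y u v.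
pose D2 := cl P x y * cm Q u v + cl P u v * pm Q x y u v
      - cl Q x y * cm P u v - cl Q u v * pm P x y u v.
pose D3 := resD P Q u v.
exists (A1 ^+ 2 + 2 * A0 * A2 - B0 * D2 - B1 * D1), (2 * A1 * A2 - B0 * D3 - B1 * D2),
  (A2 ^+ 2 - B1 * D3) => t.
have hA : resA P Q (x + t * u) (y + t * v) = A0 + t * A1 + t ^+ 2 * A2.
  by rewrite /A0 /A1 /A2 /resA /pm /cm; ring.
have hB : resB P Q (x + t * u) (y + t * v) = B0 + t * B1.
  by rewrite /B0 /B1 /resB /cl; ring.
have hD : resD P Q (x + t * u) (y + t * v) = D0 + t * D1 + t ^+ 2 * D2 + t ^+ 3 * D3.
  by rewrite /D0 /D1 /D2 /D3 /resD /pm /cm /cl; ring.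
by rewrite [LHS]/res hA hB hD /res /dres -/A0 -/A1 -/B0 -/B1 -/D0 -/D1; ring.
Qed.

(* At a common point of [P] and [Q] whose vertical line meets [P] and [Q] in no further common point,
   the derivative of the resultant is the Jacobian of [P] and [Q] up to a unit. *)
Lemma dres_jacobian P Q x y z u v : qf P x y z = 0 -> qf Q x y z = 0 ->
  dres P Q x y u v = 4 * resB P Q x y *
    ((gx P x y z * u + gy P x y z * v) * gz Q x y z
     - (gx Q x y z * u + gy Q x y z * v) * gz P x y z).
Proof.
rewrite !qf_z => hP hQ.
have eP : cm P x y = - (cc P * z ^+ 2 + cl P x y * z) by apply/eqP; rewrite -addr_eq0 addrC hP.
have eQ : cm Q x y = - (cc Q * z ^+ 2 + cl Q x y * z) by apply/eqP; rewrite -addr_eq0 addrC hQ.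
rewrite /dres /resA /resD eP eQ /pm /resB /cl /gx /gy /gz; ring.
Qed.

Lemma odd_coef (c1 c2 c3 c4 g0 g1 g2 : K) :
  (forall t, t * c1 + t ^+ 2 * c2 + t ^+ 3 * c3 + t ^+ 4 * c4 =
     t ^+ 2 * (g0 + t * g1 + t ^+ 2 * g2)) -> c1 = 0.
Proof.
move=> h; have h1 := h 1; have h2 := h (-1); have h3 := h 2; have h4 := h (- 2).
have n12 : 12 != 0 :> K by rewrite pnatr_eq0.
apply: (mulfI n12); rewrite mulr0.
(* The combination 8 (h(1) - h(-1)) - (h(2) - h(-2)) kills the even powers and t^3, and leaves 12
   times the coefficient of t. *)
transitivity (8 * ((1 * c1 + 1 ^+ 2 * c2 + 1 ^+ 3 * c3 + 1 ^+ 4 * c4)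
   - (-1 * c1 + (-1) ^+ 2 * c2 + (-1) ^+ 3 * c3 + (-1) ^+ 4 * c4))
   - ((2 * c1 + 2 ^+ 2 * c2 + 2 ^+ 3 * c3 + 2 ^+ 4 * c4)
   - (- 2 * c1 + (- 2) ^+ 2 * c2 + (- 2) ^+ 3 * c3 + (- 2) ^+ 4 * c4))); first by ring.
by rewrite h1 h2 h3 h4; ring.
Qed.

Definition lam (u : K * K) (x y : K) := u.1 * x + u.2 * y.

(** Two factors vanishing at the same point give a zero of order at least two along every
    direction. *)
Lemma double_factor_dres P Q c (u1 u2 u3 u4 : K * K) x y v w :
  (forall x y, res P Q x y = c * (lam u1 x y * lam u2 x y * lam u3 x y * lam u4 x y)) ->
  lam u1 x y = 0 -> lam u2 x y = 0 -> dres P Q x y v w = 0.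
Proof.
move=> hR h1 h2; have [a2 [a3 [a4 he]]] := res_expand P Q x y v w.
pose g0 := c * lam u1 v w * lam u2 v w * (lam u3 x y * lam u4 x y).
pose g1 := c * lam u1 v w * lam u2 v w * (lam u3 x y * lam u4 v w + lam u3 v w * lam u4 x y).
pose g2 := c * lam u1 v w * lam u2 v w * (lam u3 v w * lam u4 v w).
apply: (@odd_coef _ a2 a3 a4 g0 g1 g2) => t.
have := he t; rewrite [res P Q x y]hR h1 !mul0r mulr0 add0r => <-.
rewrite hR; have e u : lam u (x + t * v) (y + t * w) = lam u x y + t * lam u v w.
  by rewrite /lam; ring.
by rewrite !e h1 h2 /g0 /g1 /g2; ring.
Qed.

Definition omit (s : seq (K * K)) (a : nat) x y :=
  \prod_(u <- take a s ++ drop a.+1 s) lam u x y.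

Lemma omit_prod s a x y : (a < size s)%N ->
  \prod_(u <- s) lam u x y = lam (nth (0, 0) s a) x y * omit s a x y.
Proof.
move=> ha; rewrite -{1}(cat_take_drop a s) big_cat /= (drop_nth (0, 0) ha) big_cons.
by rewrite /omit big_cat /= mulrCA.
Qed.

(** If every product of three factors vanished, two different factors would vanish at the point, and
    the derivative there would be zero. *)
Lemma simple_root_omit P Q c (s : seq (K * K)) x y : size s = 4%N ->
  (forall x y, res P Q x y = c * \prod_(u <- s) lam u x y) ->
  res P Q x y = 0 -> c != 0 -> (exists v w, dres P Q x y v w != 0) ->
  exists2 a, (a < 4)%N & omit s a x y != 0.
Proof.
case: s => [|u1 [|u2 [|u3 [|u4 [|]]]]] // _ hR r0 c0 [v [w dn]].
apply: contrapT => H.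
have H0 a : (a < 4)%N -> omit [:: u1; u2; u3; u4] a x y = 0.
  by move=> a4; apply/eqP; apply: contrapT => h; apply: H; exists a => //; apply/negP.
have hR' x' y' : res P Q x' y' = c * (lam u1 x' y' * lam u2 x' y' * lam u3 x' y' * lam u4 x' y').
  by rewrite hR !big_cons big_nil mulr1 !mulrA.
have := H0 0%N isT; have := H0 1%N isT; have := H0 2%N isT; have := H0 3%N isT.
rewrite /omit /= !big_cons !big_nil !mulr1 => e4 e3 e2 e1.
move/eqP: dn; apply.
move/eqP: r0; rewrite hR' mulf_eq0 (negPf c0) /= !mulf_eq0 -!orbA => /or4P [] /eqP h.
- move/eqP: e1; rewrite !mulf_eq0 => /or3P [] /eqP h'.
  + by apply: (double_factor_dres v w hR' h h').
  + apply: (@double_factor_dres P Q c u1 u3 u2 u4 x y v w _ h h') => *; rewrite hR'; ring.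
  + apply: (@double_factor_dres P Q c u1 u4 u2 u3 x y v w _ h h') => *; rewrite hR'; ring.
- move/eqP: e2; rewrite !mulf_eq0 => /or3P [] /eqP h'.
  + apply: (@double_factor_dres P Q c u2 u1 u3 u4 x y v w _ h h') => *; rewrite hR'; ring.
  + apply: (@double_factor_dres P Q c u2 u3 u1 u4 x y v w _ h h') => *; rewrite hR'; ring.
  + apply: (@double_factor_dres P Q c u2 u4 u1 u3 x y v w _ h h') => *; rewrite hR'; ring.
- move/eqP: e3; rewrite !mulf_eq0 => /or3P [] /eqP h'.
  + apply: (@double_factor_dres P Q c u3 u1 u2 u4 x y v w _ h h') => *; rewrite hR'; ring.
  + apply: (@double_factor_dres P Q c u3 u2 u1 u4 x y v w _ h h') => *; rewrite hR'; ring.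
  + apply: (@double_factor_dres P Q c u3 u4 u1 u2 x y v w _ h h') => *; rewrite hR'; ring.
move/eqP: e4; rewrite !mulf_eq0 => /or3P [] /eqP h'.
+ apply: (@double_factor_dres P Q c u4 u1 u2 u3 x y v w _ h h') => *; rewrite hR'; ring.
+ apply: (@double_factor_dres P Q c u4 u2 u1 u3 x y v w _ h h') => *; rewrite hR'; ring.
apply: (@double_factor_dres P Q c u4 u3 u1 u2 x y v w _ h h') => *; rewrite hR'; ring.
Qed.

End ResultantDerivative.

#[global] Arguments omit : simpl never.

Section SmallInequalities.
Variable R : realDomainType.

Lemma eq_le (a b : R) : a = b -> a <= b.
Proof. by move=> ->. Qed.

Lemma one_le (s1 s2 : R) : 0 <= s1 -> 0 <= s2 -> 1 <= 1 + s1 + s2.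
Proof. by move=> h1 h2; rewrite -addrA lerDl addr_ge0. Qed.

Lemma first_le (a s1 s2 : R) : a <= s1 -> 0 <= s2 -> a <= 1 + s1 + s2.
Proof. by move=> h1 h2; apply: le_trans h1 _; rewrite addrAC lerDr addr_ge0. Qed.

Lemma second_le (a s1 s2 : R) : a <= s2 -> 0 <= s1 -> a <= 1 + s1 + s2.
Proof. by move=> h1 h2; apply: le_trans h1 _; rewrite lerDr addr_ge0. Qed.

Lemma three_terms_le (a b c s1 s2 s3 : R) : 0 <= s1 -> 0 <= s2 -> 0 <= s3 ->
  a + b + c <= a + (c + s1) + (b + s2 + s3).
Proof.
move=> h1 h2 h3; rewrite -subr_ge0.
have -> : a + (c + s1) + (b + s2 + s3) - (a + b + c) = s1 + s2 + s3 by ring.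
by rewrite !addr_ge0.
Qed.

Lemma sum2_three_le (T : finType) (f : T -> T -> R) i j l : i != j -> i != l -> j != l ->
  (forall i j, 0 <= f i j) ->
  f i j + f j l + f i l <= \sum_i \sum_(j | i != j) f i j.
Proof.
move=> ij il jl f0.
rewrite (bigD1 i) //= (bigD1 j) //= (bigD1 l) /=; last by rewrite il eq_sym jl.
rewrite [X in _ <= _ + X](bigD1 j) /=; last by rewrite eq_sym.
rewrite [X in _ <= _ + (X + _)](bigD1 l) //=.
by apply: three_terms_le; apply: sumr_ge0 => // ? _; apply: sumr_ge0.
Qed.

End SmallInequalities.

Lemma uniq2 (T : eqType) (i j : T) : uniq [:: i; j] = (i != j).
Proof. by rewrite /= inE andbT. Qed.

Lemma uniq3 (T : eqType) (i j l : T) : uniq [:: i; j; l] = [&& i != j, i != l & j != l].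
Proof. by rewrite /= !inE negb_or andbT andbA. Qed.

Lemma prod_seq2 (S : comPzRingType) (T : Type) (F : T -> S) i j :
  \prod_(a <- [:: i; j]) F a = F i * F j.
Proof. by rewrite !big_cons big_nil mulr1. Qed.

Lemma prod_seq3 (S : comPzRingType) (T : Type) (F : T -> S) i j l :
  \prod_(a <- [:: i; j; l]) F a = F i * F j * F l.
Proof. by rewrite !big_cons big_nil mulr1 mulrA. Qed.

(** * Means over the faces of the polysquare *)

Section ShellMeans.
Variable R : realType.
Local Notation C := R[i].

(** In [Z1] and [Z2] the innermost mean is over z, the variable of the fibre estimates; in [Z3] the
    variable z is on the boundary and no fibre estimate is needed. *)
Definition Z1 (F : numFieldType) L M (zeta : C) (h : C -> C -> C -> F) : F :=
  EB L M zeta (fun x => EA L M zeta (fun y => EA L M zeta (fun z => h x y z))).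
Definition Z2 (F : numFieldType) L M (zeta : C) (h : C -> C -> C -> F) : F :=
  EB L M zeta (fun y => EA L M zeta (fun x => EA L M zeta (fun z => h x y z))).
Definition Z3 (F : numFieldType) L M (zeta : C) (h : C -> C -> C -> F) : F :=
  EB L M zeta (fun z => EA L M zeta (fun x => EA L M zeta (fun y => h x y z))).

Lemma shell_lower_bound_seq (f0 : C -> C -> C -> C) (s : seq (C -> C -> C -> C)) :
  (forall i, (i < size s)%N -> cont3 (nth f0 s i)) ->
  (forall x y z, (forall i, (i < size s)%N -> nth f0 s i x y z = 0) ->
     [/\ x = 0, y = 0 & z = 0]) ->
  exists2 c : R, 0 < c & forall x y z, shell x y z ->
    exists2 i, (i < size s)%N & c <= nsq (nth f0 s i x y z).
Proof.
move=> cs s0; have [c c0 hc] := @shell_lower_bound R (size s) (fun i => nth f0 s i)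
  (fun i => cs i (ltn_ord i)) (fun x y z h => s0 x y z (fun i hi => h (Ordinal hi))).
by exists c => // x y z /hc [i hi]; exists i.
Qed.

Lemma cont3_lin (a b c : C) : cont3 (fun x y z => a * x + b * y + c * z).
Proof.
exact: cont3D (cont3D (cont3M (cont3_c a) (cont3_x R)) (cont3M (cont3_c b) (cont3_y R)))
  (cont3M (cont3_c c) (cont3_z R)).
Qed.

Lemma cont3_qf (Q : conic C) : cont3 (qf Q).
Proof.
apply: (@eq_cont3 _ (fun x y z => x * (ca Q * x + 2 * cd Q * y + 2 * ce Q * z) +
   (y * (0 * x + cb Q * y + 2 * cf Q * z) + z * (0 * x + 0 * y + cc Q * z)))).
  by move=> x y z; rewrite /qf; ring.
apply: cont3D; first exact: cont3M (cont3_x R) (cont3_lin _ _ _).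
exact: cont3D (cont3M (cont3_y R) (cont3_lin _ _ _)) (cont3M (cont3_z R) (cont3_lin _ _ _)).
Qed.

Lemma cont3_gz (Q : conic C) : cont3 (gz Q).
Proof. exact: cont3_lin. Qed.

Lemma cont3_omit (s : seq (C * C)) a : cont3 (fun x y z => omit s a x y).
Proof.
apply: cont3_prod => u; apply: (@eq_cont3 _ (fun x y z => u.1 * x + u.2 * y + 0 * z)).
  by move=> x y z; rewrite /lam mul0r addr0.
exact: cont3_lin.
Qed.

End ShellMeans.

(** * Pointwise splitting of the pole of the arrangement *)

Section Estimate.
Variables (R : realType) (k : nat).
Local Notation C := R[i].
Variable Q : 'I_k -> conic C.

Definition no_four_concurrent := forall i j l m x y z, uniq [:: i; j; l; m] ->
  qf (Q i) x y z = 0 -> qf (Q j) x y z = 0 -> qf (Q l) x y z = 0 ->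
  qf (Q m) x y z = 0 -> [/\ x = 0, y = 0 & z = 0].

Definition no_vertical_tangent := forall i j x y z, i != j ->
  qf (Q i) x y z = 0 -> qf (Q j) x y z = 0 -> gz (Q i) x y z = 0 ->
  [/\ x = 0, y = 0 & z = 0].

Definition simple_triple_points := forall i j l x y z, uniq [:: i; j; l] ->
  qf (Q i) x y z = 0 -> qf (Q j) x y z = 0 -> qf (Q l) x y z = 0 ->
  (forall u v, dres (Q i) (Q j) x y u v = 0) -> [/\ x = 0, y = 0 & z = 0].

(* If [k >= 5] and [m + 3 <= k + 1] then [(m + 3) / 2k <= 3/5 < pair_exp]. At a point of multiplicity 2
   (resp. 3), with [p = pair_exp] (resp. [triple_exp = 3/2 pair_exp]), the splitting needs [2 p - r < 1]
   for the fibre integral and [n r < 1] for the base integral, where [n = 4] (resp. [n = 1]) bounds the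
   number of vanishing linear factors of the resultant. *)
Definition pair_exp : R := 61%:R / 100%:R.
Definition pair_rexp : R := 6%:R / 25%:R.
Definition triple_exp : R := 183%:R / 200%:R.
Definition triple_rexp : R := 9%:R / 10%:R.

Definition pole (e : R) (x y z : C) : R := ng pair_exp (nsq (\prod_i qf (Q i) x y z) + e).

Variables (cR : 'I_k -> 'I_k -> C) (sR : 'I_k -> 'I_k -> seq (C * C)).
Definition res_factored :=  forall i j, i != j -> [/\ cR i j != 0, size (sR i j) = 4%N,
  all (fun u => u != (0, 0)) (sR i j) &
  forall x y, res (Q i) (Q j) x y = cR i j * \prod_(u <- sR i j) lam u x y].

(** The quantitative form on the shell of the three genericity conditions, with one constant for all
    tuples of indices. *)
Definition separated (c : R) : Prop := forall x y z, shell x y z ->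
  [/\ forall i j l m, uniq [:: i; j; l; m] ->
       [|| c <= nsq (qf (Q i) x y z), c <= nsq (qf (Q j) x y z),
           c <= nsq (qf (Q l) x y z) | c <= nsq (qf (Q m) x y z)],
      forall i j, i != j -> [|| c <= nsq (qf (Q i) x y z), c <= nsq (qf (Q j) x y z) |
           c <= nsq (gz (Q i) x y z)] &
      forall i j l, uniq [:: i; j; l] -> [|| c <= nsq (qf (Q i) x y z),
           c <= nsq (qf (Q j) x y z), c <= nsq (qf (Q l) x y z) |
           [exists a : 'I_4, c <= nsq (omit (sR i j) a x y)]]].

Lemma separation_constant : no_four_concurrent -> no_vertical_tangent ->
  simple_triple_points -> res_factored -> exists2 c : R, 0 < c & separated c.
Proof.
move=> Q_four Q_vertical Q_triple res_data.
have mono (c c' t : R) : 0 < c' <= c -> c <= t -> c' <= t.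
  by case/andP=> _; apply: le_trans.
have [c1 c10 h1] : exists2 c : R, 0 < c & forall t : 'I_k * 'I_k * ('I_k * 'I_k),
    uniq [:: t.1.1; t.1.2; t.2.1; t.2.2] -> forall x y z, shell x y z ->
    [|| c <= nsq (qf (Q t.1.1) x y z), c <= nsq (qf (Q t.1.2) x y z),
        c <= nsq (qf (Q t.2.1) x y z) | c <= nsq (qf (Q t.2.2) x y z)].
  apply: uniform_pos => [[[i j] [l m]]|t c c' cc' h ut x y z /(h ut) /or4P[] hc]; last 4 first.
  - by rewrite (mono _ _ _ cc' hc).
  - by rewrite (mono _ _ _ cc' hc) ?orbT.
  - by rewrite (mono _ _ _ cc' hc) ?orbT.
  - by rewrite (mono _ _ _ cc' hc) ?orbT.
  case: (boolP (uniq [:: i; j; l; m])) => u; last by exists 1 => // /(negP u).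
  have [||c c0 hc] := @shell_lower_bound_seq R (fun _ _ _ => 0)
    [:: qf (Q i); qf (Q j); qf (Q l); qf (Q m)].
  - by case=> [|[|[|[|]]]] //= _; apply: cont3_qf.
  - move=> x y z h; move: (h 0%N isT) (h 1%N isT) (h 2%N isT) (h 3%N isT) => /= e0 e1 e2 e3.
    exact: Q_four u e0 e1 e2 e3.
  exists c => [//|_ x y z /hc [a a4 ha]].
  case: a a4 ha => [|[|[|[|//]]]] _ /= ->; by rewrite ?orbT.
have [c2 c20 h2] : exists2 c : R, 0 < c & forall t : 'I_k * 'I_k,
    t.1 != t.2 -> forall x y z, shell x y z ->
    [|| c <= nsq (qf (Q t.1) x y z), c <= nsq (qf (Q t.2) x y z) |
        c <= nsq (gz (Q t.1) x y z)].
  apply: uniform_pos => [[i j]|t c c' cc' h ut x y z /(h ut) /or3P[] hc]; last 3 first.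
  - by rewrite (mono _ _ _ cc' hc).
  - by rewrite (mono _ _ _ cc' hc) ?orbT.
  - by rewrite (mono _ _ _ cc' hc) ?orbT.
  case: (boolP (i != j)) => u; last by exists 1 => // /(negP u).
  have [||c c0 hc] := @shell_lower_bound_seq R (fun _ _ _ => 0)
    [:: qf (Q i); qf (Q j); gz (Q i)].
  - by case=> [|[|[|]]] //= _; [exact: cont3_qf|exact: cont3_qf|exact: cont3_gz].
  - move=> x y z h; move: (h 0%N isT) (h 1%N isT) (h 2%N isT) => /= e0 e1 e2.
    exact: Q_vertical u e0 e1 e2.
  exists c => [//|_ x y z /hc [a a3 ha]].
  case: a a3 ha => [|[|[|//]]] _ /= ->; by rewrite ?orbT.
have [c3 c30 h3] : exists2 c : R, 0 < c & forall t : 'I_k * 'I_k * 'I_k,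
    uniq [:: t.1.1; t.1.2; t.2] -> forall x y z, shell x y z ->
    [|| c <= nsq (qf (Q t.1.1) x y z), c <= nsq (qf (Q t.1.2) x y z),
        c <= nsq (qf (Q t.2) x y z) |
        [exists a : 'I_4, c <= nsq (omit (sR t.1.1 t.1.2) a x y)]].
  apply: uniform_pos => [[[i j] l]|t c c' cc' h ut x y z /(h ut) /or4P[] hc]; last 4 first.
  - by rewrite (mono _ _ _ cc' hc).
  - by rewrite (mono _ _ _ cc' hc) ?orbT.
  - by rewrite (mono _ _ _ cc' hc) ?orbT.
  - case/existsP: hc => a ha; apply/or4P; apply: Or44; apply/existsP; exists a.
    exact: mono cc' ha.
  case: (boolP (uniq [:: i; j; l])) => u; last by exists 1 => // /(negP u).
  have ij : i != j by move: (u); rewrite uniq3 => /and3P[].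
  have [cR0 sz sn hR] := res_data i j ij.
  pose om a : C -> C -> C -> C := fun x y z => omit (sR i j) a x y.
  have [||c c0 hc] := @shell_lower_bound_seq R (fun _ _ _ => 0)
    [:: qf (Q i); qf (Q j); qf (Q l); om 0%N; om 1%N; om 2%N; om 3%N].
  - by case=> [|[|[|[|[|[|[|]]]]]]] //= _; [exact: cont3_qf|exact: cont3_qf|exact: cont3_qf
      |exact: cont3_omit|exact: cont3_omit|exact: cont3_omit|exact: cont3_omit].
  - move=> x y z h; move: (h 0%N isT) (h 1%N isT) (h 2%N isT) => /= e0 e1 e2.
    move: (h 3%N isT) (h 4%N isT) (h 5%N isT) (h 6%N isT) => /= e3 e4 e5 e6.
    (* A nonzero derivative of the resultant would leave one of the four products [omit] nonzero. *)
    apply: (Q_triple i j l x y z u e0 e1 e2) => v w; apply: contrapT => dn.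
    have [|a a4 /eqP []] := simple_root_omit sz hR (res_common e0 e1) cR0.
      by exists v, w; apply/eqP.
    by case: a a4 => [|[|[|[|]]]].
  exists c => [//|_ x y z /hc [a a7 ha]].
  case: a a7 ha => [|[|[|[|[|[|[|//]]]]]]] _ /= hcc; rewrite ?hcc ?orbT //;
    apply/or4P; apply: Or44; apply/existsP.
  - by exists (@Ordinal 4 0 isT).
  - by exists (@Ordinal 4 1 isT).
  - by exists (@Ordinal 4 2 isT).
  - by exists (@Ordinal 4 3 isT).
set c := Num.min c1 (Num.min c2 c3).
have c0 : 0 < c by rewrite !lt_min c10 c20 c30.
have m1 : 0 < c <= c1 by rewrite c0 ge_min lexx.
have m2 : 0 < c <= c2 by rewrite c0 !ge_min lexx !orbT.
have m3 : 0 < c <= c3 by rewrite c0 !ge_min lexx !orbT.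
exists c => // x y z sh; split=> [i j l m u|i j ij|i j l u].
- by have /or4P[] := h1 (i, j, (l, m)) u x y z sh => /= h; rewrite (mono _ _ _ m1 h) ?orbT.
- by have /or3P[] := h2 (i, j) ij x y z sh => /= h; rewrite (mono _ _ _ m2 h) ?orbT.
have /or4P[] := h3 (i, j, l) u x y z sh => /= h; rewrite ?(mono _ _ _ m3 h) ?orbT //.
case/existsP: h => a ha; apply/or4P; apply: Or44; apply/existsP; exists a.
exact: mono m3 ha.
Qed.

Variable c0 : R.
Hypothesis c00 : 0 < c0.

Definition reg (e : R) i x y z : R := nsq (qf (Q i) x y z) + e.
(** Both conics cross the vertical line at a definite angle, so that each has only one root near the
    point. *)
Definition steep i j x y z : bool := (c0 <= nsq (gz (Q i) x y z)) && (c0 <= nsq (gz (Q j) x y z)).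
(** At most one linear factor of the resultant is small, so the exponent on the base may go up to 1
    instead of 1/4. *)
Definition simple_dir i j x y : bool := [exists a : 'I_4, c0 <= nsq (omit (sR i j) a x y)].

Definition term1 e i x y z : R := ng pair_exp (reg e i x y z).
Definition term2 e i j x y z : R := (steep i j x y z)%:R * (ng pair_exp (reg e i x y z) * ng pair_exp (reg e j x y z)).
Definition term3 e i j x y z : R := (simple_dir i j x y)%:R *
  ((steep i j x y z)%:R * (ng triple_exp (reg e i x y z) * ng triple_exp (reg e j x y z))).

Hypothesis hc0 : separated c0.

Lemma term2_E e i j x y z : steep i j x y z ->
  term2 e i j x y z = term1 e i x y z * term1 e j x y z.
Proof. by rewrite /term2 => ->; rewrite mul1r. Qed.

Lemma term3_E e i j x y z : simple_dir i j x y -> steep i j x y z ->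
  term3 e i j x y z = ng triple_exp (reg e i x y z) * ng triple_exp (reg e j x y z).
Proof. by rewrite /term3 => -> ->; rewrite !mul1r. Qed.

Lemma pair_cube (u v : R) : (ng (pair_exp / 2) u * ng (pair_exp / 2) v) ^+ 3 =
  ng triple_exp u * ng triple_exp v.
Proof.
by rewrite exprMn !ngX; have -> : 3 * (pair_exp / 2) = triple_exp by rewrite /pair_exp /triple_exp; field.
Qed.

Lemma triple_split (u v w : R) : ng pair_exp u * ng pair_exp v * ng pair_exp w =
  (ng (pair_exp / 2) u * ng (pair_exp / 2) v) * (ng (pair_exp / 2) v * ng (pair_exp / 2) w)
  * (ng (pair_exp / 2) u * ng (pair_exp / 2) w).
Proof.
have sq t : ng pair_exp t = ng (pair_exp / 2) t * ng (pair_exp / 2) t.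
  by rewrite -ngD; have -> : pair_exp / 2 + pair_exp / 2 = pair_exp by field.
by rewrite !sq; ring.
Qed.

(** Conics that are not small at the point contribute a bounded factor, and separation leaves at
    most three small ones. Two small conics are necessarily steep, and three small ones are moreover
    in a simple direction, so every case is covered by one kind of term. *)
Lemma pointwise_bound : exists2 K : R, 0 <= K & forall e x y z, 0 < e <= 1 ->
  shell x y z -> pole e x y z <= K * (1 + \sum_i term1 e i x y z
     + \sum_i \sum_(j | i != j) (term2 e i j x y z + term3 e i j x y z)).
Proof.
have [B B0 HB] : exists2 B : R, 0 <= B & forall i : 'I_k, forall x y z,
    nsq x <= 4 -> nsq y <= 4 -> nsq z <= 4 -> nsq (qf (Q i) x y z) <= B.
  apply: uniform_bound => [i|i c c' cc' h x y z hx hy hz].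
    by have [B B1 HB] := bnd3_qf (Q i); exists B => //; lra.
  exact: le_trans (h x y z hx hy hz) cc'.
have [K' K'1 HK'] := @prod_eps_big R _ (enum 'I_k) (B + 1) ltac:(lra).
set G := Num.max 1 (ng pair_exp c0); have G1 : 1 <= G by rewrite le_max lexx.
exists (ng pair_exp K'^-1 * G ^+ k); first by rewrite mulr_ge0 ?ng_ge0 // exprn_ge0 //; lra.
move=> e x y z e01 sh; case/andP: (e01) => e0 e1.
have [hx hy hz _] := sh.
have X0 i : 0 < reg e i x y z by apply: addr_pos => //; apply: nsq_ge0.
have hT : pole e x y z <= ng pair_exp K'^-1 * \prod_(i <- enum 'I_k) term1 e i x y z.
  rewrite -ng_prod //; apply: ng_le_inv.
  - by rewrite /pair_exp; lra.
  - lra.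
  - by apply: prodr_gt0.
  - by apply: addr_pos => //; apply: nsq_ge0.
  rewrite nsq_prod -big_enum; apply: HK' => // i _.
  by rewrite nsq_ge0 /=; apply: le_trans (HB i x y z hx hy hz) _; lra.
rewrite big_enum /= in hT.
pose S := [set i | nsq (qf (Q i) x y z) < c0].
apply: le_trans hT _; rewrite -mulrA ler_wpM2l ?ng_ge0 //.
have p00 : 0 <= pair_exp by rewrite /pair_exp; lra.
have t1_ge0 i : 0 <= term1 e i x y z by apply: ng_ge0.
have hS : \prod_i term1 e i x y z <= (\prod_(i in S) term1 e i x y z) * G ^+ k.
  rewrite (bigID (mem S)) /= ler_wpM2l //; first by apply: prodr_ge0.
  apply: (@le_trans _ _ (\prod_(i | i \notin S) G)).
    apply: ler_prod => i; rewrite inE -leNgt => hi; rewrite t1_ge0 /= le_max.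
    apply/orP; right; apply: ng_le => //.
    by apply: le_trans hi _; rewrite /reg lerDl ltW.
  rewrite prodr_const ler_weXn2l //.
  by apply: leq_trans (max_card _) _; rewrite card_ord.
apply: le_trans hS _; rewrite mulrC ler_wpM2l ?exprn_ge0 //; first lra.
have t2_ge0 i j : 0 <= term2 e i j x y z by rewrite !mulr_ge0 ?ler0n ?ng_ge0.
have t3_ge0 i j : 0 <= term3 e i j x y z by rewrite !mulr_ge0 ?ler0n ?ng_ge0.
have t23_ge0 i j : 0 <= term2 e i j x y z + term3 e i j x y z by rewrite addr_ge0.
have s1 : 0 <= \sum_i term1 e i x y z by apply: sumr_ge0.
have s2 : 0 <= \sum_i \sum_(j | i != j) (term2 e i j x y z + term3 e i j x y z).
  by apply: sumr_ge0 => i _; apply: sumr_ge0.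
have [H4 H2 H3] := hc0 sh.
have inS i : i \in enum S -> (c0 <= nsq (qf (Q i) x y z)) = false.
  by rewrite mem_enum inE ltNge => /negbTE.
have hb i j : i \in enum S -> j \in enum S -> i != j -> steep i j x y z.
  move=> /inS iS /inS jS ij; have := H2 i j ij; have := H2 j i; rewrite eq_sym ij iS jS /=.
  by rewrite /steep => /(_ isT) -> ->.
rewrite -big_enum /=; have := enum_uniq S.
case E : (enum S) inS hb => [|i [|j [|l [|m s]]]] inS hb uS.
- rewrite big_nil; exact: (one_le s1 s2).
- rewrite big_seq1.
  have : term1 e i x y z <= \sum_i term1 e i x y z.
    by rewrite (bigD1 i) //= lerDl sumr_ge0.
  by move=> h; exact: (first_le h s2).
- rewrite prod_seq2.
  have ij : i != j by rewrite uniq2 in uS.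
  have /= := @le_sum2 R _ (fun i j => term2 e i j x y z + term3 e i j x y z) i j ij t23_ge0.
  have -> : term2 e i j x y z = term1 e i x y z * term1 e j x y z.
    have iin : i \in [:: i; j] by rewrite !inE eqxx.
    have jin : j \in [:: i; j] by rewrite !inE eqxx orbT.
    exact: term2_E (hb _ _ iin jin ij).
  move=> h; have h1 : term1 e i x y z * term1 e j x y z <=
    term1 e i x y z * term1 e j x y z + term3 e i j x y z by rewrite lerDl t3_ge0.
  have h2 := le_trans h1 h.
  exact: (second_le h2 s1).
- rewrite prod_seq3.
  move: (uS); rewrite uniq3 => /and3P[ij il jl].
  have iin : i \in [:: i; j; l] by rewrite !inE eqxx.
  have jin : j \in [:: i; j; l] by rewrite !inE eqxx orbT.
  have lin : l \in [:: i; j; l] by rewrite !inE eqxx !orbT.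
  pose a := ng (pair_exp / 2) (reg e i x y z); pose b := ng (pair_exp / 2) (reg e j x y z).
  pose d := ng (pair_exp / 2) (reg e l x y z).
  have a0 : 0 <= a by apply: ng_ge0.
  have b0 : 0 <= b by apply: ng_ge0.
  have d0 : 0 <= d by apply: ng_ge0.
  (* Three poles of exponent p are three pairs of exponent p/2. The inequality between the product
     and the sum of cubes leaves single pairs of exponent 3p/2, which is [triple_exp]. *)
  have -> : term1 e i x y z * term1 e j x y z * term1 e l x y z = (a * b) * (b * d) * (a * d).
    exact: triple_split.
  have h3 := mul3_le (mulr_ge0 a0 b0) (mulr_ge0 b0 d0) (mulr_ge0 a0 d0).
  apply: le_trans h3 _.
  have term i' j' l' : uniq [:: i'; j'; l'] -> i' \in [:: i; j; l] -> j' \in [:: i; j; l] ->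
      l' \in [:: i; j; l] ->
      (ng (pair_exp / 2) (reg e i' x y z) * ng (pair_exp / 2) (reg e j' x y z)) ^+ 3 = term3 e i' j' x y z.
    move=> u' hi hj hl; have ij' : i' != j' by move: (u'); rewrite uniq3 => /and3P[].
    have sd : simple_dir i' j' x y.
      have := H3 i' j' l' u'.
      by rewrite (inS _ hi) (inS _ hj) (inS _ hl) orFb orFb orFb.
    by rewrite (term3_E e sd (hb _ _ hi hj ij')) pair_cube.
  have u2 : uniq [:: j; l; i] by rewrite uniq3 jl eq_sym ij eq_sym il.
  have u3 : uniq [:: i; l; j] by rewrite uniq3 il ij eq_sym jl.
  have e3 : (a * b) ^+ 3 + (b * d) ^+ 3 + (a * d) ^+ 3 =
      term3 e i j x y z + term3 e j l x y z + term3 e i l x y z.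
    congr (_ + _ + _); [exact: term uS iin jin lin | exact: term u2 jin lin iin |
      exact: term u3 iin lin jin].
  have sum3 : term3 e i j x y z + term3 e j l x y z + term3 e i l x y z <=
     \sum_i \sum_(j | i != j) term3 e i j x y z.
    exact: (@sum2_three_le R _ (fun i j => term3 e i j x y z) i j l ij il jl t3_ge0).
  have le3 : \sum_i \sum_(j | i != j) term3 e i j x y z <=
     \sum_i \sum_(j | i != j) (term2 e i j x y z + term3 e i j x y z).
    by apply: ler_sum => ? _; apply: ler_sum => ? _; rewrite lerDr.
  exact: (second_le (le_trans (le_trans (eq_le e3) sum3) le3) s1).
have u4 : uniq [:: i; j; l; m].
  by move: uS; rewrite -[[:: i, j, l, m & s]]/([:: i; j; l; m] ++ s) cat_uniq => /andP[].
have := H4 i j l m u4; rewrite !inS ?inE ?eqxx ?orbT //.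
Qed.

End Estimate.

(** * The uniform bound for the mean of the pole *)

Section VolumeEstimate.
Variables (R : realType) (k : nat).
Local Notation C := R[i].
Variable Q : 'I_k -> conic C.

Hypothesis Q_cc : forall i, cc (Q i) != 0.
Hypothesis Q_smooth : forall i, smooth (Q i).
Hypothesis Q_distinct : forall i j, i != j -> ~ proportional (Q i) (Q j).

Lemma res_factoring : exists cR sR, res_factored Q cR sR.
Proof.
have ex (t : 'I_k * 'I_k) : exists w : C * seq (C * C), t.1 != t.2 ->
   [/\ w.1 != 0, size w.2 = 4%N, all (fun u => u != (0, 0)) w.2 &
     forall x y, res (Q t.1) (Q t.2) x y = w.1 * \prod_(u <- w.2) lam u x y].
  case: t => i j /=; case: (boolP (i != j)) => ij; last by exists (0, [::]).
  have [c [s [c0 ss sn hs]]] := factor_of_form (res_form (Q i) (Q j)) (size_Poly _)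
    (res_neq0 (Q_cc i) (Q_cc j) (@Q_smooth i) (Q_distinct ij)).
  by exists (c, s).
have [f hf] := choice ex.
by exists (fun i j => (f (i, j)).1), (fun i j => (f (i, j)).2) => i j ij; apply: (hf (i, j)).
Qed.

Lemma disc_avg_bounded (p : R) i : 0 <= p -> 2 * p < 1 ->
  avg_bounded (fun e x y => ng p (nsq (disc (Q i) x y) + e)).
Proof.
move=> p0 hp.
have [c [s [c0 ss sn hs]]] := factor_of_form (disc_form (Q i)) (size_Poly _)
  (disc_neq0 (Q_cc i) (@Q_smooth i)).
have hsz : (size s)%:R * p < 1 by rewrite ss.
have s0 : (0 < size s)%N by rewrite ss.
have [K K0 HK] := avg_bounded_prod c0 s0 sn p0 hsz.
exists K => // L M zeta e mesh; have [h1 h2] := HK _ _ _ _ mesh.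
split=> t ht; [apply: le_trans (h1 t ht)|apply: le_trans (h2 t ht)];
  by apply: le_mean => l; rewrite hs.
Qed.

Variables (cR : 'I_k -> 'I_k -> C) (sR : 'I_k -> 'I_k -> seq (C * C)).
Hypothesis res_data : res_factored Q cR sR.

Lemma res_avg_bounded (p : R) i j : i != j -> 0 <= p -> 4 * p < 1 ->
  avg_bounded (fun e x y => ng p (nsq (res (Q i) (Q j) x y) + e)).
Proof.
move=> ij p0 hp; have [c0 ss sn hs] := res_data ij.
have hsz : (size (sR i j))%:R * p < 1 by rewrite ss.
have s0 : (0 < size (sR i j))%N by rewrite ss.
have [K K0 HK] := avg_bounded_prod c0 s0 sn p0 hsz.
exists K => // L M zeta e mesh; have [h1 h2] := HK _ _ _ _ mesh.
split=> t ht; [apply: le_trans (h1 t ht)|apply: le_trans (h2 t ht)];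
  by apply: le_mean => l; rewrite hs.
Qed.

Variable c0 : R.
Hypothesis c00 : 0 < c0.

(** With the other three factors bounded below, the resultant is at least a constant times one
    linear form, so its pole keeps the exponent p on that form instead of 4p. *)
Lemma simple_dir_bound (p : R) : 0 <= p -> exists2 K : R, 0 <= K &
  forall i j e x y, i != j -> 0 < e -> simple_dir sR c0 i j x y ->
    ng p (nsq (res (Q i) (Q j) x y) + e) <=
    K * \sum_(u <- sR i j) ng p (nsq (u.1 * x + u.2 * y) + e).
Proof.
move=> p0.
have [K K0 HK] : exists2 K : R, 0 <= K & forall t : 'I_k * 'I_k, forall e x y,
    t.1 != t.2 -> 0 < e -> simple_dir sR c0 t.1 t.2 x y ->
    ng p (nsq (res (Q t.1) (Q t.2) x y) + e) <=
    K * \sum_(u <- sR t.1 t.2) ng p (nsq (u.1 * x + u.2 * y) + e).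
  apply: uniform_bound => [[i j]|t K K' KK' h e x y ij e0 hd]; last first.
    apply: le_trans (h e x y ij e0 hd) _; apply: ler_wpM2r => //.
    by apply: sumr_ge0 => u _; apply: ng_ge0.
  case: (boolP (i != j)) => ij; last first.
    by exists 0 => // e x y /= ij'; rewrite ij' in ij.
  have [cR0 ss sn hs] := res_data ij.
  set m := Num.min (nsq (cR i j) * c0) 1.
  have m0 : 0 < m by rewrite lt_min ltr01 mulr_gt0 // nsq_gt0.
  exists (ng p m); first exact: ng_ge0.
  move=> e x y _ e0 /existsP [a ha].
  have asz : (a < size (sR i j))%N by rewrite ss.
  set u := nth (0, 0) (sR i j) a.
  have us : u \in sR i j by apply: mem_nth.
  apply: (@le_trans _ _ (ng p m * ng p (nsq (u.1 * x + u.2 * y) + e))).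
    apply: ngM_le => //; first by apply: addr_pos => //; apply: nsq_ge0.
    rewrite hs (omit_prod x y asz) -/u !nsqM mulrDr lerD //.
      rewrite mulrCA [X in X <= _]mulrC; apply: ler_wpM2l; first exact: nsq_ge0.
      apply: (@le_trans _ _ (nsq (cR i j) * c0)); first by rewrite ge_min lexx.
      by rewrite ler_wpM2l ?nsq_ge0.
    by rewrite -[X in _ <= X]mul1r ler_pM2r // ge_min lexx orbT.
  rewrite ler_wpM2l ?ng_ge0 // (perm_big _ (perm_to_rem us)) big_cons lerDl.
  by apply: sumr_ge0 => w _; apply: ng_ge0.
by exists K => // i j e x y; apply: (HK (i, j)).
Qed.

Local Notation pA := (pair_exp R).
Local Notation rA := (pair_rexp R).
Local Notation pT := (triple_exp R).
Local Notation rT := (triple_rexp R).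

(** Integration over z turns single poles into poles of the discriminant, a product of two linear
    forms, and pairs into poles of the resultant: four forms in general, one relevant form near a
    triple point. The exponents are chosen so that each of these is integrable on the base. *)
Lemma slice_estimate : separated Q sR c0 -> exists2 h : R -> C -> C -> R,
  avg_bounded h & forall L M zeta e x y, good_mesh L M zeta e ->
    nsq x <= 2 -> nsq y <= 2 -> (1 <= nsq x \/ 1 <= nsq y) ->
    EA L M zeta (fun z => pole Q e x y z) <= h e x y.
Proof.
move=> sep; have [K1 K10 H1] := pointwise_bound c00 sep.
have pA0 : 0 <= pA by rewrite /pair_exp; lra.
have rA0 : 0 <= rA by rewrite /pair_rexp; lra.
have pA2 : 0 <= rA <= pA by rewrite /pair_exp /pair_rexp; apply/andP; split; lra.
have pA3 : 2 * pA - rA < 1 by rewrite /pair_exp /pair_rexp; lra.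
have pT2 : 0 <= rT <= pT by rewrite /triple_exp /triple_rexp; apply/andP; split; lra.
have pT3 : 2 * pT - rT < 1 by rewrite /triple_exp /triple_rexp; lra.
have rT0 : 0 <= rT by case/andP: pT2.
have rT1 : rT < 1 by rewrite /triple_rexp; lra.
have rA4 : 4 * rA < 1 by rewrite /pair_rexp; lra.
have rA2 : 2 * rA < 1 by lra.
have [Ks Ks0 HKs] : exists2 K : R, 0 <= K & forall i : 'I_k, forall L M zeta e x y,
    good_mesh L M zeta e -> nsq x <= 4 -> nsq y <= 4 ->
    EA L M zeta (fun z => term1 Q e i x y z) <= K * ng rA (nsq (disc (Q i) x y) + e).
  apply: uniform_bound => [i|i K K' KK' h L M zeta e x y mesh hx hy].
    exact: single_slice (Q_cc i) pA2 pA3.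
  by apply: le_trans (h L M zeta e x y mesh hx hy) _; rewrite ler_wpM2r ?ng_ge0.
have pairs (p r : R) : 0 <= r <= p -> 2 * p - r < 1 ->
    exists2 K : R, 0 <= K & forall t : 'I_k * 'I_k, forall L M zeta e x y,
    good_mesh L M zeta e -> nsq x <= 4 -> nsq y <= 4 ->
    EA L M zeta (fun z => (steep Q c0 t.1 t.2 x y z)%:R *
      (ng p (reg Q e t.1 x y z) * ng p (reg Q e t.2 x y z)))
      <= K * ng r (nsq (res (Q t.1) (Q t.2) x y) + e).
  move=> rp hp; apply: uniform_bound => [t|t K K' KK' h L M zeta e x y mesh hx hy].
    exact: pair_slice (Q_cc t.1) (Q_cc t.2) c00 rp hp.
  by apply: le_trans (h L M zeta e x y mesh hx hy) _; rewrite ler_wpM2r ?ng_ge0.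
have [Kp Kp0 HKp] := pairs _ _ pA2 pA3; have [Kt Kt0 HKt] := pairs _ _ pT2 pT3.
have [Kd Kd0 HKd] := simple_dir_bound rT0.
exists (fun e x y => K1 * (1 + \sum_(i : 'I_k) Ks * ng rA (nsq (disc (Q i) x y) + e)
  + \sum_(i : 'I_k) \sum_(j | i != j) (Kp * ng rA (nsq (res (Q i) (Q j) x y) + e) +
     Kt * Kd * \sum_(u <- sR i j) ng rT (nsq (u.1 * x + u.2 * y) + e)))).
  apply: avg_boundedZ => //; apply: avg_boundedD.
    apply: avg_boundedD; first exact: avg_bounded_cst.
    apply: avg_bounded_sum => i _ _; apply: avg_boundedZ => //.
    exact: disc_avg_bounded.
  apply: avg_bounded_sum => i _ _; apply: avg_bounded_sum => j _ ij.
  apply: avg_boundedD; first by apply: avg_boundedZ => //; apply: res_avg_bounded.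
  apply: avg_boundedZ; first by rewrite mulr_ge0.
  apply: avg_bounded_sum => u us _; apply: avg_bounded_lin; first by rewrite rT0.
  by have [_ _ sn _] := res_data ij; apply: (allP sn).
move=> L M zeta e x y mesh hx hy hxy; case: (mesh) => zeta1 L0 M0 e01 Me.
case/andP: (e01) => e0 e1.
have hx4 : nsq x <= 4 by lra.
have hy4 : nsq y <= 4 by lra.
apply: (@le_trans _ _ (EA L M zeta (fun z => K1 * (1 + \sum_i term1 Q e i x y z
     + \sum_i \sum_(j | i != j) (term2 Q c0 e i j x y z + term3 Q sR c0 e i j x y z))))).
  apply: EA_le => // z hz; apply: (H1 e x y z e01).
  split=> //; first lra.
  by case: hxy => h; [apply: Or31 | apply: Or32].
rewrite /EA meanZ ler_wpM2l // meanD meanD; apply: lerD; first apply: lerD.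
- exact: mean_cst_le.
- rewrite mean_sum; apply: ler_sum => i _; exact: HKs.
rewrite mean_sum; apply: ler_sum => i _; rewrite mean_sum; apply: ler_sum => j ij.
rewrite meanD; apply: lerD; first exact: (HKp (i, j)).
rewrite /term3 meanZ; case hd : (simple_dir sR c0 i j x y); last first.
  rewrite mul0r !mulr_ge0 //; apply: sumr_ge0 => u _; exact: ng_ge0.
rewrite mul1r; apply: le_trans (HKt (i, j) L M zeta e x y mesh hx4 hy4) _.
by rewrite -mulrA ler_wpM2l //; apply: HKd.
Qed.

Hypothesis Q_top : forall i x y z, nsq x <= 4 -> nsq y <= 4 -> 1 <= nsq z ->
  1 <= nsq (qf (Q i) x y z).

Lemma volume_estimate_of_separated : separated Q sR c0 -> exists2 K : R, 0 <= K &
  forall L M zeta e, good_mesh L M zeta e ->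
    Z1 L M zeta (pole Q e) + Z2 L M zeta (pole Q e) + Z3 L M zeta (pole Q e) <= K.
Proof.
move=> sep; have [h [K K0 HK] Hh] := slice_estimate sep.
exists (K + K + 1); first by rewrite !addr_ge0.
move=> L M zeta e mesh; have [h1 h2] := HK _ _ _ _ mesh.
case: (mesh) => zeta1 L0 M0 /andP[e0 e1] Me.
apply: lerD; first apply: lerD.
- apply: le_trans (EB_cst_le L M zeta K0); apply: EB_le => // x /andP[x1 x2].
  apply: le_trans (h1 x _); last by rewrite x1.
  by apply: EA_le => // y hy; apply: Hh => //; left.
- apply: le_trans (EB_cst_le L M zeta K0); apply: EB_le => // y /andP[y1 y2].
  apply: le_trans (h2 y _); last by rewrite y1.
  by apply: EA_le => // x hx; apply: Hh => //; right.
(* On the faces where z is on the boundary [Q_top] bounds every conic below by 1, so the pole is at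
   most 1. *)
apply: le_trans (EB_cst_le L M zeta ler01); apply: EB_le => // z /andP[z1 z2].
apply: le_trans (EA_cst_le L M zeta ler01); apply: EA_le => // x hx.
apply: le_trans (EA_cst_le L M zeta ler01); apply: EA_le => // y hy.
apply: ng_le1; first by rewrite /pair_exp; lra.
have : 1 <= nsq (\prod_i qf (Q i) x y z); last by lra.
rewrite nsq_prod; elim/big_ind: _ => //; first exact: mulr_ege1.
by move=> i _; apply: Q_top => //; lra.
Qed.

End VolumeEstimate.

Lemma volume_estimate (R : realType) (k : nat) (Q : 'I_k -> conic R[i]) :
  (forall i, cc (Q i) != 0) -> (forall i, smooth (Q i)) ->
  (forall i j, i != j -> ~ proportional (Q i) (Q j)) ->
  no_four_concurrent Q -> no_vertical_tangent Q -> simple_triple_points Q ->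
  (forall i x y z, nsq x <= 4 -> nsq y <= 4 -> 1 <= nsq z -> 1 <= nsq (qf (Q i) x y z)) ->
  exists2 K : R, 0 <= K & forall L M zeta e, good_mesh L M zeta e ->
    Z1 L M zeta (pole Q e) + Z2 L M zeta (pole Q e) + Z3 L M zeta (pole Q e) <= K.
Proof.
move=> hc hs hd h4 hv ht htop.
have [cR [sR hres]] := res_factoring hc hs hd.
have [c c0 sep] := separation_constant h4 hv ht hres.
by apply: (volume_estimate_of_separated hc hs hres c0); [exact: htop | exact: sep].
Qed.

(** * Exact moments of the rotated grids *)

Lemma exists_prim_root (K : numClosedFieldType) n : (0 < n)%N ->
  exists z : K, n.-primitive_root z.
Proof.
pose p : {poly K} := 'X^n - 1; have [r Dp] := closed_field_poly_normal p.
move=> n_gt0; rewrite (monicP _) ?monicXnsubC // scale1r in Dp.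
have rn1: all n.-unity_root r by apply/allP=> z; rewrite -root_prod_XsubC -Dp.
have sz_r: (n < (size r).+1)%N by rewrite -(size_prod_XsubC r id) -Dp size_XnsubC.
have [|z] := hasP (has_prim_root n_gt0 rn1 _ sz_r); last by exists z.
by rewrite -separable_prod_XsubC -Dp separable_Xn_sub_1 // pnatr_eq0 -lt0n.
Qed.

Section RootMeans.
Variables (R : realType) (L : nat) (zeta : R[i]).
Hypothesis zetaP : L.-primitive_root zeta.
Local Notation C := R[i].

Lemma prim_root_nsq : nsq zeta = 1.
Proof.
have L0 := prim_order_gt0 zetaP.
apply/eqP; rewrite -(@pexpr_eq1 _ _ L) ?nsq_ge0 //.
by rewrite -nsqX (prim_expr_order zetaP) nsq1.
Qed.

Lemma prim_root_neq0 : zeta != 0.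
Proof. by rewrite -nsq_eq0 prim_root_nsq oner_eq0. Qed.

Lemma prim_root_conj : (zeta^*)%C = zeta^-1.
Proof.
apply: (mulfI prim_root_neq0).
by rewrite -nsqE prim_root_nsq divff ?prim_root_neq0.
Qed.

Lemma mean_unity (a b : nat) : (a < L)%N -> (b < L)%N ->
  mean (fun l : 'I_L => (zeta ^+ a / zeta ^+ b) ^+ l) = (a == b)%:R.
Proof.
move=> aL bL; have L0 := prim_order_gt0 zetaP.
have zX n : zeta ^+ n != 0 by rewrite expf_neq0 // prim_root_neq0.
have [->|ab] := eqVneq a b.
  by rewrite divff // (eq_mean (h2 := fun=> 1)) ?mean_cst ?card_ord // => l; rewrite expr1n.
have n1 : zeta ^+ a / zeta ^+ b != 1.
  rewrite -subr_eq0 -[1](divff (zX b)) -mulrBl mulf_eq0 invr_eq0 (negbTE (zX b)) orbF.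
  by rewrite subr_eq0 (eq_prim_root_expr zetaP) !modn_small.
have := subrX1 (zeta ^+ a / zeta ^+ b) L.
rewrite expr_div_n -!exprM ![(_ * L)%N]mulnC !exprM (prim_expr_order zetaP) !expr1n divr1.
move/esym/eqP; rewrite subrr mulf_eq0 subr_eq0 (negbTE n1) /= => /eqP h.
by rewrite /mean h mul0r.
Qed.

Variable M : nat.

Definition wA (a : nat) : R := mean (fun t : 'I_M * 'I_M => nsq (grid R t.1 +i* grid R t.2)%C ^+ a).
Definition wB (a : nat) : R := mean (fun t : 'I_M => nsq (1 +i* grid R t)%C ^+ a).

Lemma mean_real (I : finType) (h : I -> R) : mean (fun i => (h i)%:C%C) = (mean h)%:C%C.
Proof. by rewrite /mean rmorphM /= fmorphV rmorph_nat rmorph_sum. Qed.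

Lemma moment_rotate (a b l : nat) (t : C) :
  (zeta ^+ l * t) ^+ a * ((zeta ^+ l * t)^*)%C ^+ b =
  (zeta ^+ a / zeta ^+ b) ^+ l * (t ^+ a * (t^*)%C ^+ b).
Proof.
have -> : ((zeta ^+ l * t)^*)%C = zeta^-1 ^+ l * (t^*)%C.
  by rewrite -prim_root_conj -[(zeta^*)%C ^+ l]rmorphXn -rmorphM.
rewrite !exprMn !exprVn -!exprM ![(l * _)%N]mulnC; ring.
Qed.

Lemma nsqX_conj (t : C) a : t ^+ a * (t^*)%C ^+ a = (nsq t ^+ a)%:C%C.
Proof. by rewrite -exprMn -nsqE rmorphXn. Qed.

(** The rotation by zeta^l multiplies the monomial by (zeta^a / zeta^b)^l, whose mean over l is zero
    for distinct exponents below L. No limit is involved. *)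
Lemma EA_moment a b : (a < L)%N -> (b < L)%N ->
  EA L M zeta (fun x => x ^+ a * (x^*)%C ^+ b) = (a == b)%:R * (wA a)%:C%C.
Proof.
move=> aL bL; rewrite /EA /ptA.
pose g (t : 'I_M * 'I_M) : C := (grid R t.1 +i* grid R t.2)%C.
rewrite (eq_mean (h2 := fun k : 'I_L * ('I_M * 'I_M) =>
   (zeta ^+ a / zeta ^+ b) ^+ k.1 * (g k.2 ^+ a * ((g k.2)^*)%C ^+ b))); last first.
  by move=> k; apply: moment_rotate.
rewrite (mean_pair (fun (l : 'I_L) t => (zeta ^+ a / zeta ^+ b) ^+ l * (g t ^+ a * ((g t)^*)%C ^+ b))).
under eq_mean => l do rewrite meanZ.
rewrite meanZr mean_unity //; have [<-|ab] := eqVneq; last by rewrite !mul0r.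
rewrite /wA -mean_real !mul1r; apply: eq_mean => t; exact: nsqX_conj.
Qed.

Lemma EB_moment a b : (a < L)%N -> (b < L)%N ->
  EB L M zeta (fun x => x ^+ a * (x^*)%C ^+ b) = (a == b)%:R * (wB a)%:C%C.
Proof.
move=> aL bL; rewrite /EB /ptB.
pose g (t : 'I_M) : C := (1 +i* grid R t)%C.
rewrite (eq_mean (h2 := fun k : 'I_L * 'I_M =>
   (zeta ^+ a / zeta ^+ b) ^+ k.1 * (g k.2 ^+ a * ((g k.2)^*)%C ^+ b))); last first.
  by move=> k; apply: moment_rotate.
rewrite (mean_pair (fun (l : 'I_L) t => (zeta ^+ a / zeta ^+ b) ^+ l * (g t ^+ a * ((g t)^*)%C ^+ b))).
under eq_mean => l do rewrite meanZ.
rewrite meanZr mean_unity //; have [<-|ab] := eqVneq; last by rewrite !mul0r.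
rewrite /wB -mean_real !mul1r; apply: eq_mean => t; exact: nsqX_conj.
Qed.

(** On the boundary 1/x plays the role of the conormal: it lowers the holomorphic degree by one, and
    only x^(b+1) against the conjugate of x^b survives. *)
Lemma EB_moment_div a b : (a < L)%N -> (b.+1 < L)%N ->
  EB L M zeta (fun x => x^-1 * x ^+ a * (x^*)%C ^+ b) = (a == b.+1)%:R * (wB b)%:C%C.
Proof.
move=> aL bL; rewrite /EB /ptB.
pose g (t : 'I_M) : C := (1 +i* grid R t)%C.
have g0 t : g t != 0 by rewrite eq_complex /= oner_eq0.
rewrite (eq_mean (h2 := fun k : 'I_L * 'I_M =>
   (zeta ^+ a / zeta ^+ b.+1) ^+ k.1 * ((g k.2)^-1 * g k.2 ^+ a * ((g k.2)^*)%C ^+ b))); last first.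
  move=> k; rewrite -mulrA -/(g k.2) moment_rotate exprSr !invfM.
  rewrite !mulrA [in RHS]exprMn exprVn; ring.
rewrite (mean_pair (fun (l : 'I_L) t => (zeta ^+ a / zeta ^+ b.+1) ^+ l * ((g t)^-1 * g t ^+ a * ((g t)^*)%C ^+ b))).
under eq_mean => l do rewrite meanZ.
rewrite meanZr mean_unity //; have [->|ab] := eqVneq; last by rewrite !mul0r.
rewrite /wB -mean_real !mul1r; apply: eq_mean => t.
by rewrite exprS mulKf // nsqX_conj.
Qed.

End RootMeans.

(** * Convergence of the grid moments *)

Section GridMoments.
Variable R : realType.

Lemma power_expand (n : nat) (t u : R) : `|t| <= 1 -> `|u| <= 1 -> exists2 r : R,
  `|r| <= 4 ^+ n & (t + u) ^+ n = t ^+ n + n%:R * u * t ^+ n.-1 + u ^+ 2 * r.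
Proof.
move=> t1 u1; elim: n => [|n [r hr IH]].
  by exists 0; rewrite ?normr0 //= !expr0 !mul0r mulr0 !addr0.
exists ((t + u) * r + n%:R * t ^+ n.-1).
  apply: le_trans (ler_normD _ _) _; rewrite !normrM normr_nat.
  have h1 : `|t + u| <= 2 by apply: le_trans (ler_normD _ _) _; lra.
  have h2 : `|t ^+ n.-1| <= 1 by rewrite normrX exprn_ile1.
  have h3 : `|t + u| * `|r| <= 2 * 4 ^+ n by apply: ler_pM.
  have h4 : n%:R * `|t ^+ n.-1| <= n%:R by rewrite ler_piMr // ler0n.
  have h5 : n%:R <= 4 ^+ n :> R by rewrite -natrX ler_nat ltnW // ltn_expl.
  by rewrite [4 ^+ n.+1]exprS; have := ler0n R n; lra.
rewrite exprS IH [t ^+ n.+1]exprS -natr1 /=; case: n {IH hr} => [|n] /=; last by rewrite [t ^+ n.+1]exprS; ring.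
by rewrite !expr0; ring.
Qed.

Definition gm M n : R := mean (fun j : 'I_M => grid R j ^+ n).

Lemma grid_telescope M (f : R -> R) : (0 < M)%N ->
  \sum_(j < M) (f (grid R j + M%:R^-1) - f (grid R j - M%:R^-1)) = f 1 - f (-1).
Proof.
move=> M0; have M1 : M%:R != 0 :> R by rewrite pnatr_eq0 -lt0n.
pose g (j : nat) := f ((2 * j)%:R / M%:R - 1).
have -> : f 1 - f (-1) = g M - g 0%N.
  by rewrite /g muln0 mul0r sub0r natrM mulfK //; have -> : (2 - 1 : R) = 1 by ring.
rewrite -(telescope_sumr g (leq0n M)) big_mkord; apply: eq_bigr => j _.
rewrite /g /grid natrD !natrM -natr1; congr (f _ - f _); by field.
Qed.

(** The central difference of t^(n+1) with step 1/M is (2(n+1)/M) t^n up to order M^-2, and over the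
    grid these differences telescope. The limit is half the integral of t^n over [-1, 1]. *)
Lemma gm_error n : exists2 c : R, 0 <= c & forall M, (0 < M)%N ->
  `|gm M n - (1 - (-1) ^+ n.+1) / (2 * n.+1%:R)| <= c / M%:R.
Proof.
exists (4 ^+ n.+1); first by rewrite exprn_ge0.
move=> M M0; have M1 : 0 < M%:R :> R by rewrite ltr0n.
have M2 : M%:R != 0 :> R by rewrite gt_eqF.
have n0 : n.+1%:R != 0 :> R by rewrite pnatr_eq0.
have u1 : `|M%:R^-1| <= 1 :> R by rewrite ger0_norm ?invr_ge0 ?ler0n // invf_le1 // ler1n.
have ex (j : 'I_M) : exists r : R, `|r| <= 2 * 4 ^+ n.+1 /\
   (grid R j + M%:R^-1) ^+ n.+1 - (grid R j - M%:R^-1) ^+ n.+1 =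
     2 * n.+1%:R / M%:R * grid R j ^+ n + M%:R^-1 ^+ 2 * r.
  have g1 : `|grid R j| <= 1.
    by rewrite -[X in _ <= X]normr1 -ler_sqr ?nnegrE // !real_normK ?num_real // expr1n grid_le1.
  have [r hr ->] := power_expand n.+1 g1 u1.
  have u1' : `|- M%:R^-1 : R| <= 1 by rewrite normrN.
  have [s hs ->] := power_expand n.+1 g1 u1'.
  exists (r - s); split; first by apply: le_trans (ler_normB _ _) _; lra.
  by rewrite sqrrN /=; ring.
have [r hr] := choice ex.
have := grid_telescope (fun x => x ^+ n.+1) M0; rewrite expr1n.
under eq_bigr => j _ do rewrite (hr j).2.
rewrite big_split /= -!mulr_sumr => tel.
have -> : gm M n - (1 - (-1) ^+ n.+1) / (2 * n.+1%:R) =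
    - (M%:R^-1 ^+ 2 * \sum_j r j) / (2 * n.+1%:R).
  rewrite -tel /gm /mean card_ord; set S := \sum_j grid R j ^+ n; set T := \sum_j r j.
  by move: n0; move: (n.+1%:R : R) => n1 n0; field; rewrite M2 n0.
have hS : `|\sum_j r j| <= M%:R * (2 * 4 ^+ n.+1).
  apply: le_trans (ler_norm_sum _ _ _) _.
  apply: (@le_trans _ _ (\sum_(j < M) 2 * 4 ^+ n.+1)).
    by apply: ler_sum => j _; case: (hr j).
  by rewrite sumr_const card_ord -[_ *+ M]mulr_natl.
have d0 : 0 < 2 * n.+1%:R :> R by rewrite mulr_gt0 ?ltr0n.
rewrite mulNr normrN normrM normfV [`|2 * _|]gtr0_norm //.
rewrite ler_pdivrMr // normrM normrX normfV [`|M%:R|]gtr0_norm //.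
have : M%:R^-1 ^+ 2 * `|\sum_j r j| <= M%:R^-1 ^+ 2 * (M%:R * (2 * 4 ^+ n.+1)).
  by rewrite ler_wpM2l // exprn_ge0 // invr_ge0 ler0n.
have -> : M%:R^-1 ^+ 2 * (M%:R * (2 * 4 ^+ n.+1)) = 4 ^+ n.+1 / M%:R * 2 :> R by field.
move/le_trans; apply; apply: ler_wpM2l; first by rewrite divr_ge0 ?exprn_ge0 ?ler0n.
by rewrite ler_pMr // ler1n.
Qed.

End GridMoments.

(** * Limit moments and Stokes' formula for the square *)

Section MomentLimits.
Variable R : realType.
Local Open Scope classical_set_scope.
Local Open Scope ring_scope.

Lemma cvg_of_inverse_bound (u : nat -> R) (l c : R) : 0 <= c ->
  (forall M, (0 < M)%N -> `|u M - l| <= c / M%:R) -> u @ \oo --> l.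
Proof.
move=> c0 h; apply/cvgrPdist_le => /= e e0; near=> M.
have M0 : (0 < M)%N by near: M; exists 1%N.
have M0' : 0 < M%:R :> R by rewrite ltr0n.
rewrite distrC; apply: le_trans (h M M0) _.
rewrite ler_pdivrMr // mulrC -ler_pdivrMr //.
apply: (@le_trans _ _ (Num.truncn (c / e)).+1%:R); first by rewrite ltW // truncnS_gt.
rewrite ler_nat; near: M; exists (Num.truncn (c / e)).+1 => //.
Unshelve. all: by end_near.
Qed.

Lemma sum_cvg (I : Type) (r : seq I) (P : pred I) (f : I -> nat -> R) (l : I -> R) :
  (forall i, P i -> f i @ \oo --> l i) ->
  (fun M => \sum_(i <- r | P i) f i M) @ \oo --> \sum_(i <- r | P i) l i.
Proof.
move=> h; elim: r => [|i r IH].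
  rewrite big_nil (_ : (fun M => _) = fun=> 0); first exact: cvg_cst.
  by apply/funext => M; rewrite big_nil.
rewrite big_cons (_ : (fun M => _) = fun M => if P i then f i M + \sum_(j <- r | P j) f j M
   else \sum_(j <- r | P j) f j M); last by apply/funext => M; rewrite big_cons.
by case Pi : (P i) => //; apply: cvgD => //; apply: h.
Qed.

Lemma gm_cvg n : (fun M => gm R M n) @ \oo --> ((1 - (-1) ^+ n.+1) / (2 * n.+1%:R) : R).
Proof. by have [c c0 h] := gm_error R n; apply: cvg_of_inverse_bound c0 h. Qed.

Lemma gm_cvg_even n : (fun M => gm R M (2 * n)) @ \oo --> ((2 * n).+1%:R^-1 : R).
Proof.
suff -> : (2 * n).+1%:R^-1 = (1 - (-1) ^+ (2 * n).+1) / (2 * (2 * n).+1%:R) :> R by apply: gm_cvg.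
rewrite exprS exprM sqrrN !expr1n mulr1 opprK.
by rewrite -[1 + 1]/(2 : R) invfM mulrA divff ?mul1r // pnatr_eq0.
Qed.

(** [omA] and [omB] are the mean values of |z|^(2a) over the square and over one of its edges, the
    limits of [wA] and [wB]. *)
Definition omA (a : nat) : R :=
  \sum_(k < a.+1) ((2 * (a - k)).+1%:R^-1 * (2 * k).+1%:R^-1) * 'C(a, k)%:R.
Definition omB (a : nat) : R := \sum_(k < a.+1) (2 * k).+1%:R^-1 * 'C(a, k)%:R.

Lemma wA_expand M a : wA R M a =
  \sum_(k < a.+1) (gm R M (2 * (a - k)) * gm R M (2 * k)) * 'C(a, k)%:R.
Proof.
rewrite /wA (eq_mean (h2 := fun t : 'I_M * 'I_M => \sum_(k < a.+1)
   (grid R t.1 ^+ (2 * (a - k)) * grid R t.2 ^+ (2 * k)) * 'C(a, k)%:R)); last first.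
  by move=> t; rewrite /nsq /= exprDn; apply: eq_bigr => k _; rewrite !exprM mulr_natr.
rewrite mean_sum; apply: eq_bigr => k _; rewrite meanZr; congr (_ * _).
rewrite (mean_pair (fun s t : 'I_M => grid R s ^+ (2 * (a - k)) * grid R t ^+ (2 * k))).
under eq_mean => s do rewrite meanZ.
by rewrite meanZr.
Qed.

Lemma wB_expand M a : wB R M a = \sum_(k < a.+1) gm R M (2 * k) * 'C(a, k)%:R.
Proof.
rewrite /wB (eq_mean (h2 := fun t : 'I_M => \sum_(k < a.+1)
   grid R t ^+ (2 * k) * 'C(a, k)%:R)); last first.
  by move=> t; rewrite /nsq /= expr1n exprDn; apply: eq_bigr => k _; rewrite !exprM expr1n mul1r mulr_natr.
by rewrite mean_sum; apply: eq_bigr => k _; rewrite meanZr.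
Qed.

Lemma wA_cvg a : (fun M => wA R M a) @ \oo --> omA a.
Proof.
rewrite (_ : (fun M => wA R M a) = fun M => \sum_(k < a.+1) (gm R M (2 * (a - k)) * gm R M (2 * k)) * 'C(a, k)%:R).
  by apply: sum_cvg => k _; apply: cvgMr_tmp; apply: cvgM; apply: gm_cvg_even.
by apply/funext => M; apply: wA_expand.
Qed.

Lemma wB_cvg a : (fun M => wB R M a) @ \oo --> omB a.
Proof.
rewrite (_ : (fun M => wB R M a) = fun M => \sum_(k < a.+1) gm R M (2 * k) * 'C(a, k)%:R).
  by apply: sum_cvg => k _; apply: cvgMr_tmp; apply: gm_cvg_even.
by apply/funext => M; apply: wB_expand.
Qed.

(** The divergence theorem on the square, reduced to moments. After symmetrizing k and a - k it is
    the identity 1/(2k+1) + 1/(2(a-k)+1) = 2(a+1) / ((2k+1)(2(a-k)+1)). *)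
Lemma omB_omA a : omB a = a.+1%:R * omA a.
Proof.
have rev : omB a = \sum_(k < a.+1) (2 * (a - k)).+1%:R^-1 * 'C(a, k)%:R.
  rewrite /omB (reindex_inj rev_ord_inj); apply: eq_bigr => k _ /=.
  by rewrite subSS bin_sub // -ltnS.
have h : omB a + omB a = (2 * a.+1%:R) * omA a.
  rewrite {2}rev /omB /omA -big_split mulr_sumr; apply: eq_bigr => k _ /=.
  have ka : (k <= a)%N by rewrite -ltnS.
  have e : 2 * a.+1%:R = (2 * (a - k)).+1%:R + (2 * k).+1%:R :> R.
    by rewrite -natrM -natrD; congr _%:R; lia.
  rewrite e; have : (2 * (a - k)).+1%:R != 0 :> R by rewrite pnatr_eq0.
  have : (2 * k).+1%:R != 0 :> R by rewrite pnatr_eq0.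
  move: ((2 * (a - k)).+1%:R : R) ((2 * k).+1%:R : R) => x y y0 x0; field; by rewrite x0 y0.
by apply: (@mulfI _ (2 : R)); rewrite ?pnatr_eq0 // mulrA -h; ring.
Qed.

Lemma omA_gt0 a : 0 < omA a.
Proof.
rewrite /omA big_ord_recl ltr_pwDl //.
  by rewrite !mulr_gt0 ?invr_gt0 ?ltr0n // bin0.
by apply: sumr_ge0 => k _; rewrite !mulr_ge0 ?invr_ge0 ?ler0n.
Qed.

End MomentLimits.

Notation o0 := (@ord0 2).
Notation o1 := (@lift 3 ord0 (@ord0 1)).
Notation o2 := (@lift 3 ord0 (@lift 2 ord0 (@ord0 0))).

Lemma big_ord3 (T : Type) (idx : T) (op : Monoid.law idx) (F : 'I_3 -> T) :
  \big[op/idx]_(i < 3) F i = op (F o0) (op (F o1) (F o2)).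
Proof. by rewrite !big_ord_recl big_ord0 Monoid.mulm1. Qed.

Lemma ord3P (P : 'I_3 -> Prop) : P o0 -> P o1 -> P o2 -> forall i, P i.
Proof.
move=> P0 P1 P2 [[|[|[|//]]] hi].
- by have -> : Ordinal hi = o0 by apply: val_inj.
- by have -> : Ordinal hi = o1 by apply: val_inj.
- by have -> : Ordinal hi = o2 by apply: val_inj.
Qed.

(** * Means of polynomials as Hermitian forms in their coefficients *)

Section Hermitian.
Variable R : realType.
Local Notation C := R[i].

Definition pt (K : nzRingType) (x y z : K) : 'I_3 -> K := fun i => nth 0 [:: x; y; z] i.

Definition mon (A : 'X_{1..3}) (x y z : C) : C := x ^+ A o0 * (y ^+ A o1 * z ^+ A o2).

Lemma meval_mon n (P : {mpoly C[3]}) x y z : (msize P <= n)%N ->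
  P.@[pt x y z] = \sum_(A : 'X_{1..3 < n}) P@_A * mon A x y z.
Proof.
move=> /mpolywE e; rewrite [in LHS]e raddf_sum; apply: eq_bigr => A _ /=.
by rewrite mevalZ mevalX big_ord3.
Qed.

Section LinearFunctional.
Variable E : (C -> C -> C -> C) -> C.
Hypothesis E_lin : forall (I : finType) (c : I -> C) (h : I -> C -> C -> C -> C),
  E (fun x y z => \sum_i c i * h i x y z) = \sum_i c i * E (h i).

(** Monomials are orthogonal up to the shift [phi], so the double sum over exponents collapses to a
    diagonal one. [phi] is the identity for norms and adds [U_(k)] for fluxes. *)
Lemma herm_expand n (phi : 'X_{1..3} -> 'X_{1..3}) (wt : C -> C -> C -> C)
    (v : 'X_{1..3} -> C) (P Q : {mpoly C[3]}) :
  (msize P <= n.+1)%N -> (msize Q <= n)%N ->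
  (forall B, (mdeg B < n)%N -> (mdeg (phi B) < n.+1)%N) ->
  (forall A B, (mdeg A < n.+1)%N -> (mdeg B < n)%N ->
     E (fun x y z => wt x y z * (mon A x y z * conjc (mon B x y z))) = (A == phi B)%:R * v B) ->
  E (fun x y z => wt x y z * (P.@[pt x y z] * conjc Q.@[pt x y z])) =
    \sum_(B : 'X_{1..3 < n}) P@_(phi B) * conjc Q@_B * v B.
Proof.
move=> sP sQ hphi hE.
pose h (t : 'X_{1..3 < n.+1} * 'X_{1..3 < n}) x y z :=
  wt x y z * (mon t.1 x y z * conjc (mon t.2 x y z)).
have -> : (fun x y z => wt x y z * (P.@[pt x y z] * conjc Q.@[pt x y z])) =
    fun x y z => \sum_(t : 'X_{1..3 < n.+1} * 'X_{1..3 < n}) P@_t.1 * conjc Q@_t.2 * h t x y z.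
  apply/funext => x; apply/funext => y; apply/funext => z.
  rewrite (meval_mon x y z sP) (meval_mon x y z sQ) rmorph_sum.
  rewrite -(pair_bigA _ (fun (A : 'X_{1..3 < n.+1}) (B : 'X_{1..3 < n}) => P@_A * conjc Q@_B * h (A, B) x y z)) /=.
  rewrite mulr_suml mulr_sumr; apply: eq_bigr => A _.
  rewrite mulr_sumr mulr_sumr; apply: eq_bigr => B _.
  rewrite rmorphM /h /=; ring.
rewrite E_lin -(pair_bigA _ (fun (A : 'X_{1..3 < n.+1}) (B : 'X_{1..3 < n}) => P@_A * conjc Q@_B * E (h (A, B)))) exchange_big /=.
apply: eq_bigr => B _.
have hB : (mdeg (phi B) < n.+1)%N by apply: hphi; apply: bmdeg.
rewrite (bigD1 (BMultinom hB)) //= [X in _ + X]big1 => [|A /eqP nA].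
  by rewrite addr0 /h hE ?bmdeg //= eqxx mul1r.
rewrite /h hE ?bmdeg //=; case: eqP => [e|_]; last by rewrite mul0r mulr0.
by case: nA; apply: val_inj.
Qed.

End LinearFunctional.

(* Models the integral over the faces of the polysquare on which coordinate [k] is on the boundary. *)
Definition Zk (F : numFieldType) (k : 'I_3) L M (zeta : C) (h : C -> C -> C -> F) : F :=
  match val k with
  | 0 => Z1 L M zeta h
  | 1 => Z2 L M zeta h
  | _ => Z3 L M zeta h
  end.

Lemma mean_lin (F : numFieldType) (J I : finType) (p : J -> C) (c : I -> F) (h : I -> C -> F) :
  mean (fun j => \sum_i c i * h i (p j)) = \sum_i c i * mean (fun j => h i (p j)).
Proof. by rewrite mean_sum; apply: eq_bigr => i _; rewrite meanZ. Qed.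

Lemma Zk_lin (F : numFieldType) k L M zeta (I : finType) (c : I -> F) (h : I -> C -> C -> C -> F) :
  Zk k L M zeta (fun x y z => \sum_i c i * h i x y z) = \sum_i c i * Zk k L M zeta (h i).
Proof.
have lin3 (J1 J2 J3 : finType) (p : J1 -> C) (q : J2 -> C) (r : J3 -> C)
    (g : I -> C -> C -> C -> F) :
    mean (fun a => mean (fun b => mean (fun d => \sum_i c i * g i (p a) (q b) (r d)))) =
    \sum_i c i * mean (fun a => mean (fun b => mean (fun d => g i (p a) (q b) (r d)))).
  under eq_mean => a do under eq_mean => b do rewrite (mean_lin r c (fun i => g i (p a) (q b))).
  under eq_mean => a do rewrite (mean_lin q c (fun i y => mean (fun d => g i (p a) y (r d)))).
  by rewrite (mean_lin p c (fun i x => mean (fun b => mean (fun d => g i x (q b) (r d))))).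
elim/ord3P: k; rewrite /Zk /=.
- exact: (lin3 _ _ _ (@ptB R L M zeta) (@ptA R L M zeta) (@ptA R L M zeta) h).
- exact: (lin3 _ _ _ (@ptB R L M zeta) (@ptA R L M zeta) (@ptA R L M zeta) (fun i y x z => h i x y z)).
- exact: (lin3 _ _ _ (@ptB R L M zeta) (@ptA R L M zeta) (@ptA R L M zeta) (fun i z x y => h i x y z)).
Qed.

Lemma Zk_scale (F : numFieldType) k L M zeta (c : F) (h : C -> C -> C -> F) :
  Zk k L M zeta (fun x y z => c * h x y z) = c * Zk k L M zeta h.
Proof.
have lin3 (J1 J2 J3 : finType) (g : J1 -> J2 -> J3 -> F) :
    mean (fun a => mean (fun b => mean (fun d => c * g a b d))) =
    c * mean (fun a => mean (fun b => mean (fun d => g a b d))).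
  under eq_mean => a do under eq_mean => b do rewrite meanZ.
  by under eq_mean => a do rewrite meanZ; rewrite meanZ.
rewrite /Zk; case: (val k) => [|[|_]]; exact: lin3.
Qed.

Lemma Re_Zk k L M zeta (h : C -> C -> C -> C) :
  complex.Re (Zk k L M zeta h) = Zk k L M zeta (fun x y z => complex.Re (h x y z)).
Proof.
rewrite /Zk; case: (val k) => [|[|_]]; rewrite /Z1 /Z2 /Z3 /EA /EB Re_mean;
  apply: eq_mean => a; rewrite Re_mean; apply: eq_mean => b; exact: Re_mean.
Qed.

Lemma Zk_le k L M zeta (h1 h2 : C -> C -> C -> R) : nsq zeta = 1 -> (0 < M)%N ->
  (forall x y z, nsq x <= 2 -> nsq y <= 2 -> nsq z <= 2 -> 1 <= nsq (pt x y z k) ->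
     h1 x y z <= h2 x y z) ->
  Zk k L M zeta h1 <= Zk k L M zeta h2.
Proof.
move=> z1 M0; elim/ord3P: k => h; rewrite /Zk /= /Z1 /Z2 /Z3;
  apply: EB_le => // a /andP[a1 a2]; apply: EA_le => // b hb; apply: EA_le => // c hc; exact: h.
Qed.

Lemma mean_prod3 (J1 J2 J3 : finType) (f : J1 -> C) (g : J2 -> C) (h : J3 -> C) :
  mean (fun a => mean (fun b => mean (fun d => f a * (g b * h d)))) = mean f * (mean g * mean h).
Proof.
under eq_mean => a do under eq_mean => b do rewrite 2!meanZ.
under eq_mean => a do rewrite meanZ meanZr.
by rewrite meanZr.
Qed.

Definition wk (k : 'I_3) M (A : 'X_{1..3}) : R :=
  \prod_(i < 3) if i == k then wB R M (A i) else wA R M (A i).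

Lemma Zk_sep k L M zeta (g : 'I_3 -> C -> C) :
  Zk k L M zeta (fun x y z => g o0 x * (g o1 y * g o2 z)) =
  \prod_(i < 3) if i == k then EB L M zeta (g i) else EA L M zeta (g i).
Proof.
rewrite big_ord3 /=; elim/ord3P: k; rewrite /Zk /= /Z1 /Z2 /Z3.
- exact: mean_prod3.
- rewrite mulrCA -mean_prod3.
  by apply: eq_mean => a; apply: eq_mean => b; apply: eq_mean => d; rewrite mulrCA.
- rewrite [X in _ = _ * X]mulrC mulrCA -mean_prod3.
  by apply: eq_mean => a; apply: eq_mean => b; apply: eq_mean => d; rewrite mulrA mulrC.
Qed.

Section Moments.
Variables (L M : nat) (zeta : C).
Hypothesis zetaP : L.-primitive_root zeta.

Lemma prod_indicator (A B : 'X_{1..3}) (f : 'I_3 -> R) :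
  \prod_i ((A i == B i)%:R * (f i)%:C%C) = (A == B)%:R * (\prod_i f i)%:C%C.
Proof.
rewrite big_split /= rmorph_prod /=; congr (_ * _).
have [->|nAB] := eqVneq A B; first by rewrite big1 // => i _; rewrite eqxx.
have /existsP [i ni] : [exists i, A i != B i].
  rewrite -negb_forall; apply: contra nAB => /forallP h; apply/eqP/mnmP => i.
  by apply/eqP; apply: h.
by rewrite (bigD1 i) //= (negbTE ni) mul0r.
Qed.

Lemma Zk_moment k (A B : 'X_{1..3}) : (forall i, A i < L)%N -> (forall i, B i < L)%N ->
  Zk k L M zeta (fun x y z => 1 * (mon A x y z * conjc (mon B x y z))) =
  (A == B)%:R * (wk k M B)%:C%C.
Proof.
move=> hA hB.
pose g i x := x ^+ A i * (x^*)%C ^+ B i : C.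
have -> : (fun x y z => 1 * (mon A x y z * conjc (mon B x y z))) =
    fun x y z => g o0 x * (g o1 y * g o2 z).
  apply/funext => x; apply/funext => y; apply/funext => z.
  by rewrite /mon /g !rmorphM !rmorphXn /=; ring.
rewrite Zk_sep -prod_indicator; apply: eq_bigr => i _.
case: ifP => _; [rewrite (EB_moment zetaP) //|rewrite (EA_moment zetaP) //].
- by case: eqP => [->|_]; rewrite ?mul0r.
- by case: eqP => [->|_]; rewrite ?mul0r.
Qed.

Lemma Zk_moment_div k (A B : 'X_{1..3}) :
  (forall i, A i < L)%N -> (forall i, (B i).+1 < L)%N ->
  Zk k L M zeta (fun x y z => (pt x y z k)^-1 * (mon A x y z * conjc (mon B x y z))) =
  (A == (B + U_(k))%MM)%:R * (wk k M B)%:C%C.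
Proof.
move=> hA hB.
have hB' i : (B i < L)%N by apply: ltnW.
pose g i x := (if i == k then x^-1 else 1) * x ^+ A i * (x^*)%C ^+ B i : C.
have -> : (fun x y z => (pt x y z k)^-1 * (mon A x y z * conjc (mon B x y z))) =
    fun x y z => g o0 x * (g o1 y * g o2 z).
  apply/funext => x; apply/funext => y; apply/funext => z.
  rewrite /mon !rmorphM !rmorphXn /= /g; clear; elim/ord3P: k; rewrite /pt /=; ring.
rewrite Zk_sep -prod_indicator; apply: eq_bigr => i _; rewrite mnmDE mnm1E [k == i]eq_sym /g.
case: eqP => [_|_].
  by rewrite (EB_moment_div zetaP) // addn1.
rewrite addn0; have -> : (fun x => 1 * x ^+ A i * (x^*)%C ^+ B i) = fun x : C => x ^+ A i * (x^*)%C ^+ B i.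
  by apply/funext => x; rewrite mul1r.
by rewrite (EA_moment zetaP) //; case: eqP => [->|_]; rewrite ?mul0r.
Qed.

Lemma mdeg_coord (A : 'X_{1..3}) i n : (mdeg A < n)%N -> (A i < n)%N.
Proof. by apply: leq_ltn_trans; rewrite mdegE (bigD1 i) //= leq_addr. Qed.

Lemma Zk_herm k n (P Q : {mpoly C[3]}) : (n < L)%N -> (msize P <= n.+1)%N -> (msize Q <= n)%N ->
  Zk k L M zeta (fun x y z => 1 * (P.@[pt x y z] * conjc Q.@[pt x y z])) =
    \sum_(B : 'X_{1..3 < n}) P@_B * conjc Q@_B * (wk k M B)%:C%C.
Proof.
move=> nL sP sQ; apply: (@herm_expand _ (@Zk_lin _ k L M zeta) n id (fun _ _ _ => 1)
  (fun B => (wk k M B)%:C%C)) => //.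
- by move=> B; apply: ltnW.
- move=> A B hA hB; apply: Zk_moment => i; apply: leq_trans nL; apply: mdeg_coord => //.
  exact: ltnW.
Qed.

Lemma Zk_herm_div k n (P Q : {mpoly C[3]}) : (n < L)%N -> (msize P <= n.+1)%N -> (msize Q <= n)%N ->
  Zk k L M zeta (fun x y z => (pt x y z k)^-1 * (P.@[pt x y z] * conjc Q.@[pt x y z])) =
    \sum_(B : 'X_{1..3 < n}) P@_(B + U_(k))%MM * conjc Q@_B * (wk k M B)%:C%C.
Proof.
move=> nL sP sQ; apply: (@herm_expand _ (@Zk_lin _ k L M zeta) n (fun B => (B + U_(k))%MM)
  (fun x y z => (pt x y z k)^-1)
  (fun B => (wk k M B)%:C%C)) => //.
- by move=> B; rewrite mdegD mdeg1 addn1 ltnS.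
- move=> A B hA hB; apply: Zk_moment_div => i.
    by apply: leq_trans nL; apply: mdeg_coord.
  by apply: leq_trans nL; rewrite ltnS; apply: mdeg_coord.
Qed.

Lemma Zk_nsq k n (P : {mpoly C[3]}) : (n < L)%N -> (msize P <= n)%N ->
  Zk k L M zeta (fun x y z => nsq P.@[pt x y z]) =
    \sum_(B : 'X_{1..3 < n}) nsq P@_B * wk k M B.
Proof.
move=> nL sP; have := congr1 (@complex.Re R) (Zk_herm k nL (leqW sP) sP).
rewrite Re_Zk Re_sum => e; transitivity (\sum_(B : 'X_{1..3 < n})
   complex.Re (P@_B * conjc P@_B * (wk k M B)%:C%C)).
  rewrite -e; congr Zk; apply/funext => x; apply/funext => y; apply/funext => z.
  by rewrite mul1r -nsqE.
by apply: eq_bigr => B _; rewrite -nsqE -rmorphM.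
Qed.

(** The coefficient at B + U_(k) is the one that the derivative in direction k moves to B; this is
    how the boundary terms meet the divergence. *)
Lemma Zk_flux k n (P Q : {mpoly C[3]}) : (n < L)%N -> (msize P <= n.+1)%N -> (msize Q <= n)%N ->
  Zk k L M zeta (fun x y z => complex.Re ((pt x y z k)^-1 * (P.@[pt x y z] * conjc Q.@[pt x y z]))) =
    \sum_(B : 'X_{1..3 < n}) complex.Re (P@_(B + U_(k))%MM * conjc Q@_B) * wk k M B.
Proof.
move=> nL sP sQ; rewrite -Re_Zk (Zk_herm_div k nL sP sQ) Re_sum; apply: eq_bigr => B _.
by case: (P@_(B + U_(k))%MM * conjc Q@_B) => a b /=; rewrite mulr0 subr0.
Qed.

End Moments.

End Hermitian.

(** * Beta integrals as finite sums *)

Section BetaSums.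
Variable R : realType.
Variable s : R.
Hypothesis s0 : 0 < s.

(* [p |-> \int_0^1 u ^ (s - 1) p(u) du] *)
Definition lf (p : {poly R}) : R := \sum_(i < size p) p`_i / (i%:R + s).

Lemma lf_wide n (p : {poly R}) : (size p <= n)%N -> lf p = \sum_(i < n) p`_i / (i%:R + s).
Proof.
move=> pn; rewrite /lf (big_ord_widen n (fun i => p`_i / (i%:R + s)) pn) big_mkcond.
by apply: eq_bigr => i _; case: ltnP => // h; rewrite nth_default // mul0r.
Qed.

Lemma lfD p q : lf (p + q) = lf p + lf q.
Proof.
pose n := maxn (size p) (size q).
rewrite (@lf_wide n) ?(leq_trans (size_polyD _ _)) // (@lf_wide n p) ?leq_maxl //.
rewrite (@lf_wide n q) ?leq_maxr // -big_split; apply: eq_bigr => i _ /=.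
by rewrite coefD mulrDl.
Qed.

Lemma lfZ c p : lf (c *: p) = c * lf p.
Proof.
rewrite (@lf_wide (size p)) ?size_scale_leq // /lf mulr_sumr; apply: eq_bigr => i _.
by rewrite coefZ mulrA.
Qed.

Lemma lf_sum (I : Type) (r : seq I) (F : I -> {poly R}) :
  lf (\sum_(i <- r) F i) = \sum_(i <- r) lf (F i).
Proof.
apply: (big_morph lf lfD); by rewrite /lf size_poly0 big_ord0.
Qed.

Lemma lfXn n : lf 'X^n = (n%:R + s)^-1.
Proof.
rewrite /lf size_polyXn big_ord_recr /= coefXn eqxx mul1r big1 ?add0r // => i _.
by rewrite coefXn ltn_eqF ?mul0r.
Qed.

(** The Beta integral B(u, j + 1), that is, the integral of t^(u-1) (1-t)^j over [0, 1]. *)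
Definition beta (j : nat) (u : R) : R := j`!%:R / \prod_(i < j.+1) (u + i%:R).

Lemma beta_gt0 j u : 0 < u -> 0 < beta j u.
Proof.
move=> u0; rewrite divr_gt0 ?ltr0n ?fact_gt0 //; apply: prodr_gt0 => i _.
by rewrite ltr_wpDr.
Qed.

Lemma betaS j u : 0 < u -> beta j u - beta j (u + 1) = beta j.+1 u.
Proof.
move=> u0; rewrite /beta; set P := \prod_(i < j) (u + 1 + i%:R).
have P0 : P != 0.
  by rewrite gt_eqF //; apply: prodr_gt0 => i _; rewrite !ltr_wpDr.
have -> : \prod_(i < j.+1) (u + i%:R) = u * P.
  by rewrite big_ord_recl addr0; congr (_ * _); apply: eq_bigr => i _; rewrite lift0 -natr1; ring.
have -> : \prod_(i < j.+1) (u + 1 + i%:R) = P * (u + 1 + j%:R) by rewrite big_ord_recr.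
have -> : \prod_(i < j.+2) (u + i%:R) = u * (P * (u + 1 + j%:R)).
  rewrite big_ord_recl addr0; congr (_ * _); rewrite big_ord_recr /=; congr (_ * _).
    by apply: eq_bigr => i _; rewrite /bump /= add1n -natr1; ring.
  by rewrite /bump /= add1n -natr1; ring.
have u1 : u != 0 by rewrite gt_eqF.
have u2 : u + 1 + j%:R != 0 by rewrite gt_eqF // !ltr_wpDr.
rewrite factS natrM -natr1; field; by rewrite u1 u2 P0.
Qed.

Lemma lf_beta j m : lf ((1 - 'X) ^+ j * 'X^m) = beta j (m%:R + s).
Proof.
elim: j m => [|j IH] m.
  by rewrite expr0 mul1r lfXn /beta big_ord1 addr0 mul1r.
rewrite exprSr -mulrA mulrBl mul1r -exprS mulrBr.
rewrite -[X in _ + X](scaleN1r) lfD lfZ mulN1r !IH -natr1 -betaS ?ltr_wpDl //.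
by congr (_ - beta _ _); ring.
Qed.

(** Consecutive values have the quotient (N+1)/(s+N+1), which is at least (N/(N+1))^s: by
    ln((N+1)/N) >= 1/(N+1) and 1 + y <= exp y. *)
Lemma beta_lower N : (0 < N)%N -> beta 1 s * ng s N%:R <= beta N s.
Proof.
elim: N => // [[|N] IH] _; first by rewrite ng1 mulr1.
have {IH} := IH isT.
have bS : beta N.+2 s = beta N.+1 s * (N.+2%:R / (s + N.+2%:R)).
  rewrite /beta big_ord_recr /= factS natrM invfM; ring.
have h : ng s N.+2%:R <= ng s N.+1%:R * (N.+2%:R / (s + N.+2%:R)).
  have e : N.+2%:R = N.+1%:R * (N.+2%:R / N.+1%:R) :> R by rewrite mulrC divfK ?pnatr_eq0.
  rewrite [in ng s N.+2%:R]e ngM ?divr_gt0 ?ltr0n // ler_pM2l ?ng_gt0 //.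
  have l1 : N.+2%:R^-1 <= ln (N.+2%:R / N.+1%:R) :> R.
    have : ln (1 - N.+2%:R^-1) <= - N.+2%:R^-1 :> R.
      by apply: le_ln1Dx; rewrite ltrN2 invf_lt1 ?ltr0n // ltr1n.
    have -> : 1 - N.+2%:R^-1 = (N.+2%:R / N.+1%:R)^-1 :> R.
      have n2 : N.+2%:R != 0 :> R by rewrite pnatr_eq0.
      apply: (mulIf n2); rewrite invf_div divfK // mulrBl mul1r mulVf //.
      by rewrite -natr1 addrK.
    by rewrite lnV ?posrE ?divr_gt0 ?ltr0n // lerN2.
  rewrite /ng -[X in _ <= X]invrK invf_div -lef_pV2 ?posrE ?expR_gt0 ?invr_gt0 ?divr_gt0 ?ltr0n ?addr_gt0 ?ltr0n //.
  rewrite invrK -expRN opprK; apply: le_trans (expR_ge1Dx _).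
  rewrite mulrDl divff ?pnatr_eq0 // addrC lerD2l.
  by rewrite ler_wpM2l // ltW.
move=> IH; rewrite bS; apply: le_trans (ler_wpM2r _ IH); last by rewrite divr_ge0 ?ler0n // addr_ge0 ?ler0n // ltW.
by rewrite -[X in _ <= X]mulrA; apply: ler_wpM2l h; apply/ltW/beta_gt0.
Qed.

(* [lf ((1 - t X) ^+ N)] is the integral of [u ^ (s - 1) (1 - t u) ^ N] over [0, 1]. *)
Lemma lf_power_ge N (t : R) : 0 <= t <= 1 ->
  beta N s <= lf ((1 - t *: 'X) ^+ N).
Proof.
move=> /andP[t0 t1].
(* For this decomposition all terms of the binomial expansion have a nonnegative integral, and the
   last one is exactly [beta N s]. *)
have -> : 1 - t *: 'X = (1 - t) *: 'X + (1 - 'X) :> {poly R}.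
  by rewrite scalerBl scale1r; ring.
rewrite exprDn lf_sum big_ord_recr /= subnn expr0 mul1r binn mulr1n.
have -> : lf ((1 - 'X) ^+ N) = beta N s.
  by rewrite -[X in lf X]mulr1 -(expr0 'X) lf_beta add0r.
rewrite lerDr; apply: sumr_ge0 => i _.
rewrite exprZn -scalerAl -scaler_nat lfZ lfZ mulrC mulr_ge0 ?ler0n //.
by rewrite mulr_ge0 ?exprn_ge0 ?subr_ge0 // mulrC lf_beta ltW // beta_gt0 // ltr_wpDl.
Qed.

Lemma lf_power_expand N (t : R) : lf ((1 - t *: 'X) ^+ N) =
  \sum_(n < N.+1) (-1) ^+ n * 'C(N, n)%:R / (n%:R + s) * t ^+ n.
Proof.
rewrite exprBn lf_sum; apply: eq_bigr => i _.
rewrite expr1n mulr1 exprZn -scaler_nat lfZ.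
have -> : (-1) ^+ i * (t ^+ i *: 'X^i) = ((-1) ^+ i * t ^+ i) *: 'X^i :> {poly R}.
  by rewrite -scalerA; rewrite -[(-1) ^+ i *: _]mul_polyC rmorphXn rmorphN1.
rewrite lfZ lfXn; ring.
Qed.

Lemma power_expand_alt N (t : R) : (1 - t) ^+ N =
  \sum_(n < N.+1) (-1) ^+ n * 'C(N, n)%:R * t ^+ n.
Proof.
rewrite exprBn; apply: eq_bigr => i _.
by rewrite expr1n mulr1 -mulr_natr mulrAC.
Qed.

End BetaSums.

(** * Integration by parts and the vanishing of the divergence *)

Section DivergenceVanishes.
Variable R : realType.
Local Notation C := R[i].
Local Notation mpoly3 := {mpoly C[3]}.

Lemma mpoly_bounded (P : mpoly3) : exists2 B : R, 0 <= B &
  forall x y z, nsq x <= 2 -> nsq y <= 2 -> nsq z <= 2 -> nsq P.@[pt x y z] <= B.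
Proof.
have bX (A : 'X_{1..3}) : bnd3 (mon A : C -> C -> C -> C).
  have bE (f : C -> C -> C -> C) n : bnd3 f -> bnd3 (fun x y z => f x y z ^+ n).
    move=> bf; elim: n => [|n IH]; first exact: (@eq_bnd3 _ (fun _ _ _ => 1)) (bnd3_c 1).
    by apply: eq_bnd3 (bnd3M bf IH) => x y z; rewrite exprS.
  exact: bnd3M (bE _ _ (bnd3_x R)) (bnd3M (bE _ _ (bnd3_y R)) (bE _ _ (bnd3_z R))).
have [B B1 HB] : bnd3 (fun x y z => P.@[pt x y z]).
  apply: (@eq_bnd3 _ (fun x y z => \sum_(A : 'X_{1..3 < msize P}) P@_A * mon A x y z)).
    by move=> x y z; rewrite (@meval_mon _ (msize P)).
  have bsum (r : seq 'X_{1..3 < msize P}) : bnd3 (fun x y z => \sum_(A <- r) P@_A * mon A x y z).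
    elim: r => [|A r IH].
      by apply: (@eq_bnd3 _ (fun _ _ _ => 0)) (bnd3_c 0) => x y z; rewrite big_nil.
    by apply: eq_bnd3 (bnd3D (bnd3M (bnd3_c P@_A) (bX A)) IH) => x y z; rewrite big_cons.
  exact: bsum.
by exists B => [|x y z hx hy hz]; [lra | apply: HB; lra].
Qed.

Definition divergence (th : 'I_3 -> mpoly3) : mpoly3 := \sum_(i < 3) mderiv i (th i).

Lemma divergence_scale (F : mpoly3) (th : 'I_3 -> mpoly3) n :
  \sum_(i < 3) th i * mderiv i F = 0 ->
  divergence (fun i => th i * F ^+ n) = divergence th * F ^+ n.
Proof.
move=> hF; rewrite /divergence mulr_suml.
have -> : \sum_(i < 3) mderiv i (th i * F ^+ n) =
    \sum_(i < 3) mderiv i (th i) * F ^+ n + \sum_(i < 3) th i * mderiv i (F ^+ n).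
  by rewrite -big_split; apply: eq_bigr => i _; rewrite mderivM.
suff -> : \sum_(i < 3) th i * mderiv i (F ^+ n) = 0 by rewrite addr0.
elim: n => [|n IH].
  by rewrite big1 // => i _; rewrite expr0 -mpolyC1 mderivC mulr0.
have -> : \sum_(i < 3) th i * mderiv i (F ^+ n.+1) =
   (\sum_(i < 3) th i * mderiv i F) * F ^+ n + F * \sum_(i < 3) th i * mderiv i (F ^+ n).
  rewrite mulr_suml mulr_sumr -big_split; apply: eq_bigr => i _.
  by rewrite exprS mderivM /=; ring.
by rewrite hF IH mul0r mulr0 addr0.
Qed.

Lemma mcoeff_divergence (th : 'I_3 -> mpoly3) B :
  (divergence th)@_B = \sum_(k < 3) (B k).+1%:R * (th k)@_(B + U_(k))%MM.
Proof.
rewrite /divergence raddf_sum; apply: eq_bigr => k _ /=.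
by rewrite mcoeff_deriv mulr_natl.
Qed.

Definition om (B : 'X_{1..3}) : R := \prod_(i < 3) omA R (B i).

Lemma om_gt0 B : 0 < om B.
Proof. by apply: prodr_gt0 => i _; apply: omA_gt0. Qed.

Local Open Scope classical_set_scope.
Local Open Scope ring_scope.

(** By [omB_omA], putting coordinate k on the boundary multiplies the limit moment by (B k).+1, the
    same factor that a derivative in direction k produces on the coefficient at B + U_(k). *)
Lemma wk_cvg k B : (fun M => wk R k M B) @ \oo --> ((B k).+1%:R * om B : R).
Proof.
have -> : (B k).+1%:R * om B = \prod_(i < 3) if i == k then omB R (B i) else omA R (B i).
  rewrite /om (bigD1 k) //= mulrA -omB_omA [RHS](bigD1 k) //= eqxx; congr (_ * _).
  by apply: eq_bigr => i /negbTE ->.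
rewrite big_ord3 /=.
rewrite (_ : (fun M => _) = fun M => (if o0 == k then wB R M (B o0) else wA R M (B o0)) *
  ((if o1 == k then wB R M (B o1) else wA R M (B o1)) *
   (if o2 == k then wB R M (B o2) else wA R M (B o2)))); last first.
  by apply/funext => M; rewrite /wk big_ord3.
have h i : (fun M => if i == k then wB R M (B i) else wA R M (B i)) @ \oo -->
    (if i == k then omB R (B i) else omA R (B i)).
  by case: (i == k); [apply: wB_cvg|apply: wA_cvg].
exact: cvgM (h _) (cvgM (h _) (h _)).
Qed.

End DivergenceVanishes.

Lemma dhomog_coeff0 (K : nzRingType) d (P : {mpoly K[3]}) B :
  P \is d.-homog -> mdeg B != d -> P@_B = 0.
Proof. by move=> hP; apply: dhomog_nemf_coeff. Qed.

Section DivergenceVanishes.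
Variable R : realType.
Local Notation C := R[i].
Local Notation mpoly3 := {mpoly C[3]}.
Local Open Scope classical_set_scope.
Local Open Scope ring_scope.

Lemma dhomog_msize_le d n (P : mpoly3) : P \is d.-homog -> (d < n)%N -> (msize P <= n)%N.
Proof.
move=> /dhomogP hP dn; rewrite msizeE big_seq; elim/big_ind: _ => // [a b|B hB] ; first by rewrite geq_max => -> ->.
by rewrite (hP B hB).
Qed.

Lemma sum_succ_mdeg (B : 'X_{1..3}) : \sum_(k < 3) (B k).+1%:R = (mdeg B + 3)%:R :> R.
Proof.
rewrite mdegE -natr_sum; congr _%:R.
by rewrite (eq_bigr (fun k : 'I_3 => B k + 1)%N) ?big_split /= ?sum_nat_const ?card_ord // => k _; rewrite addn1.
Qed.

Lemma Re_le1 (z : C) : complex.Re z <= 1 + nsq z.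
Proof.
case: z => a b; rewrite /nsq /=; have := sqr_ge0 (a - 1); have := sqr_ge0 b.
by rewrite sqrrB; have := sqr_ge0 a; nra.
Qed.

Variables (m d : nat) (F : mpoly3) (th : 'I_3 -> mpoly3).
Hypothesis d0 : (0 < d)%N.
Hypothesis hF : F \is d.-homog.
Hypothesis hth : forall i, th i \is m.+1.-homog.
Hypothesis syz : \sum_(i < 3) th i * mderiv i F = 0.

Let de := divergence th.
Let s : R := (m + 3)%:R / d%:R.

Lemma divergence_homog : de \is m.-homog.
Proof.
apply/dhomogP => B; rewrite mcoeff_msupp => nz; apply/eqP; apply: contraNT nz => nB.
rewrite mcoeff_divergence big1 // => k _.
rewrite (dhomog_coeff0 (hth k)) ?mulr0 //.
by rewrite mdegD mdeg1 addn1 eqSS.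
Qed.

Let s0 : 0 < s.
Proof. by rewrite divr_gt0 ?ltr0n // addn3. Qed.

Lemma deF_homog n : de * F ^+ n \is (m + d * n).-homog.
Proof. by rewrite dhomogM ?divergence_homog // dhomogMn. Qed.

Lemma thF_homog k n : th k * F ^+ n \is (m + d * n).+1.-homog.
Proof. by rewrite -addSn dhomogM // dhomogMn. Qed.

Section FixedPower.
Variable N : nat.
Let w := (m + d * N).+1.
Let L := w.+2.
Variable zeta : C.
Hypothesis zetaP : L.-primitive_root zeta.

Let cn (n : nat) : R := (-1) ^+ n * 'C(N, n)%:R.

(** Expanding [lf] gives the alternating binomial sum of the means of |div|^2 |F|^(2n) with the
    extra weights 1/(n + s); in the unexpanded form it is visibly nonnegative and bounded below. *)
Definition energy M : R := \sum_(k < 3) Zk k L M zeta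
  (fun x y z => nsq de.@[pt x y z] * lf s ((1 - nsq F.@[pt x y z] *: 'X) ^+ N)).
(** The boundary terms of theta F^n against the conjugate of div(theta) F^n, summed with the same
    binomial weights. *)
Definition flux M : R := \sum_(k < 3) Zk k L M zeta
  (fun x y z => complex.Re ((pt x y z k)^-1 * ((th k).@[pt x y z] * conjc de.@[pt x y z])) *
     (1 - nsq F.@[pt x y z]) ^+ N).
Definition mass n : R := \sum_(B : 'X_{1..3 < w}) nsq (de * F ^+ n)@_B * om R B.

Lemma deF_msize (n : 'I_N.+1) : (msize (de * F ^+ n) <= w)%N.
Proof.
apply: dhomog_msize_le (deF_homog n) _; rewrite ltnS leq_add2l leq_mul2l -ltnS.
by rewrite ltn_ord orbT.
Qed.

Lemma thF_msize k (n : 'I_N.+1) : (msize (th k * F ^+ n) <= w.+1)%N.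
Proof.
apply: dhomog_msize_le (thF_homog k n) _; rewrite !ltnS leq_add2l leq_mul2l -ltnS.
by rewrite ltn_ord orbT.
Qed.

(** Summed over the three kinds of faces, the coefficient at B gets the weight of the sum of the (B
    k).+1, which is m + dn + 3 on the degree of div(theta) F^n. As m + dn + 3 = d (n + s), this
    cancels the denominators of [lf]; hence the choice of s. *)
Lemma energy_cvg : energy @ \oo --> (d%:R * \sum_(n < N.+1) cn n * mass n : R).
Proof.
have -> : energy = fun M => \sum_(k < 3) \sum_(n < N.+1) (cn n / (n%:R + s)) *
    \sum_(B : 'X_{1..3 < w}) nsq (de * F ^+ n)@_B * wk R k M B.
  apply/funext => M; apply: eq_bigr => k _.
  have -> : (fun x y z => nsq de.@[pt x y z] * lf s ((1 - nsq F.@[pt x y z] *: 'X) ^+ N)) =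
     fun x y z => \sum_(n < N.+1) (cn n / (n%:R + s)) * nsq (de * F ^+ n).@[pt x y z].
    apply/funext => x; apply/funext => y; apply/funext => z.
    rewrite lf_power_expand // mulr_sumr; apply: eq_bigr => n _.
    by rewrite mevalM rmorphXn nsqM nsqX mulrCA.
  rewrite Zk_lin; apply: eq_bigr => n _.
  by rewrite (@Zk_nsq R L M zeta zetaP k w) ?deF_msize.
have -> : d%:R * \sum_(n < N.+1) cn n * mass n =
    \sum_(k < 3) \sum_(n < N.+1) (cn n / (n%:R + s)) *
    \sum_(B : 'X_{1..3 < w}) nsq (de * F ^+ n)@_B * ((B k).+1%:R * om R B).
  rewrite exchange_big /= mulr_sumr; apply: eq_bigr => n _.
  rewrite -mulr_sumr exchange_big /=.
  have -> : \sum_(B : 'X_{1..3 < w}) \sum_(k < 3) nsq (de * F ^+ n)@_B * ((B k).+1%:R * om R B) =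
      (m + d * n + 3)%:R * mass n.
    rewrite mulr_sumr; apply: eq_bigr => B _; rewrite -mulr_sumr -mulr_suml.
    have [eB|nB] := eqVneq (mdeg B) (m + d * n)%N; last first.
      by rewrite (dhomog_coeff0 (deF_homog n) nB) nsq0 !mul0r mulr0.
    by rewrite sum_succ_mdeg eB mulrCA.
  have -> : (m + d * n + 3)%:R = d%:R * (n%:R + s) :> R.
    rewrite mulrDr /s mulrCA divff ?mulr1 ?pnatr_eq0 -?lt0n //.
    by rewrite -natrM -natrD; congr _%:R; lia.
  have ns : n%:R + s != 0 by rewrite gt_eqF // ltr_wpDl.
  by move: (mass n) => a; field.
apply: sum_cvg => k _; apply: sum_cvg => n _; apply: cvgMl_tmp.
by apply: sum_cvg => B _; apply: cvgMl_tmp; apply: wk_cvg.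
Qed.

(** The sum over k of (B k).+1 times the coefficient at B + U_(k) is a coefficient of the divergence
    of theta F^n, and this is div(theta) F^n because theta kills F. So the energy tends to d times
    the limit of the flux. *)
Lemma flux_cvg : flux @ \oo --> (\sum_(n < N.+1) cn n * mass n : R).
Proof.
have -> : flux = fun M => \sum_(k < 3) \sum_(n < N.+1) cn n *
    \sum_(B : 'X_{1..3 < w}) complex.Re ((th k * F ^+ n)@_(B + U_(k))%MM * conjc (de * F ^+ n)@_B)
       * wk R k M B.
  apply/funext => M; apply: eq_bigr => k _.
  have -> : (fun x y z => complex.Re ((pt x y z k)^-1 * ((th k).@[pt x y z] * conjc de.@[pt x y z])) *
     (1 - nsq F.@[pt x y z]) ^+ N) =
     fun x y z => \sum_(n < N.+1) cn n * complex.Re ((pt x y z k)^-1 *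
        ((th k * F ^+ n).@[pt x y z] * conjc (de * F ^+ n).@[pt x y z])).
    apply/funext => x; apply/funext => y; apply/funext => z.
    rewrite power_expand_alt mulr_sumr; apply: eq_bigr => n _.
    rewrite mulrCA; congr (_ * _).
    have RerC (c : C) (t : R) : complex.Re c * t = complex.Re (c * t%:C%C).
      by case: c => a b /=; rewrite mulr0 subr0.
    have ev (P : mpoly3) : (P * F ^+ n).@[pt x y z] = P.@[pt x y z] * F.@[pt x y z] ^+ n.
      by rewrite mevalM rmorphXn.
    rewrite RerC -nsqX nsqE !ev; congr complex.Re.
    move: (th k).@[_] de.@[_] (F.@[_] ^+ n) => a b f.
    rewrite [conjc (b * f)]rmorphM /=; ring.
  rewrite Zk_lin; apply: eq_bigr => n _.
  by rewrite (@Zk_flux R L M zeta zetaP k w) ?deF_msize ?thF_msize.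
have -> : \sum_(n < N.+1) cn n * mass n =
    \sum_(k < 3) \sum_(n < N.+1) cn n *
    \sum_(B : 'X_{1..3 < w}) complex.Re ((th k * F ^+ n)@_(B + U_(k))%MM * conjc (de * F ^+ n)@_B)
      * ((B k).+1%:R * om R B).
  rewrite exchange_big; apply: eq_bigr => n _ /=; rewrite -mulr_sumr exchange_big /=.
  congr (_ * _); apply: eq_bigr => B _.
  have e : (de * F ^+ n)@_B = \sum_(k < 3) (B k).+1%:R * (th k * F ^+ n)@_(B + U_(k))%MM.
    by rewrite -(divergence_scale _ syz) mcoeff_divergence.
  have -> : nsq (de * F ^+ n)@_B = complex.Re ((de * F ^+ n)@_B * conjc (de * F ^+ n)@_B) by rewrite -nsqE.
  rewrite [X in complex.Re (X * _)]e mulr_suml Re_sum mulr_suml; apply: eq_bigr => k _.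
  rewrite mulrA; congr (_ * _); rewrite -mulrA.
  move: (_ * conjc _) => c; rewrite -(rmorph_nat (real_complex R)).
  by case: c => a b /=; rewrite mul0r subr0 mulrC.
apply: sum_cvg => k _; apply: sum_cvg => n _; apply: cvgMl_tmp.
by apply: sum_cvg => B _; apply: cvgMl_tmp; apply: wk_cvg.
Qed.

End FixedPower.

Hypothesis F_le1 : forall x y z, nsq x <= 2 -> nsq y <= 2 -> nsq z <= 2 ->
  nsq F.@[pt x y z] <= 1.

Definition mass0 : R := \sum_(B : 'X_{1..3 < m.+1}) nsq de@_B * om R B.

(** The energy is at least [beta N s] times the mean of |div|^2, and the flux at most a constant
    times the mean of (1 - |F|^2)^N. Their limits agree up to the factor d, so the two bounds can be
    compared. *)
Lemma mass0_bound : exists2 B : R, 0 <= B & forall N T, (0 < N)%N ->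
  (exists M0, forall L M zeta, (M0 <= M)%N -> (0 < L)%N -> nsq zeta = 1 ->
     \sum_(k < 3) Zk k L M zeta (fun x y z => (1 - nsq F.@[pt x y z]) ^+ N) <= T) ->
  beta N s * ((m + 3)%:R * mass0) <= d%:R * (B * T).
Proof.
have [B1 B10 HB1] := mpoly_bounded de.
have [B2 B20 HB2] : exists2 B : R, 0 <= B & forall k, forall x y z, nsq x <= 2 -> nsq y <= 2 ->
    nsq z <= 2 -> nsq (th k).@[pt x y z] <= B.
  apply: uniform_bound => [k|k c c' cc' h x y z hx hy hz]; first exact: mpoly_bounded.
  exact: le_trans (h x y z hx hy hz) cc'.
(* [Re_le1] bounds a real part by 1 plus the squared modulus, and the factor 1/x has modulus at most
   1 on the boundary. *)
exists (1 + B2 * B1) => [|N T N0 [M0 hM0]]; first by rewrite addr_ge0 ?mulr_ge0.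
have [zeta zetaP] := @exists_prim_root C (m + d * N).+3 isT.
have z1 := prim_root_nsq zetaP.
set L := (m + d * N).+3 in zetaP.
have cE := energy_cvg zetaP; have cU := flux_cvg zetaP.
set X := \sum_(n < N.+1) _ in cE cU.
have w3 : (fun M => \sum_(k < 3) Zk k L M zeta (fun x y z => nsq de.@[pt x y z]))
    @ \oo --> ((m + 3)%:R * mass0 : R).
  have -> : (fun M => \sum_(k < 3) Zk k L M zeta (fun x y z => nsq de.@[pt x y z])) =
      fun M => \sum_(k < 3) \sum_(B : 'X_{1..3 < m.+1}) nsq de@_B * wk R k M B.
    apply/funext => M; apply: eq_bigr => k _.
    rewrite (@Zk_nsq R L M zeta zetaP k m.+1) //; first by rewrite !ltnS; lia.
    by apply: dhomog_msize_le divergence_homog _.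
  have -> : (m + 3)%:R * mass0 =
      \sum_(k < 3) \sum_(B : 'X_{1..3 < m.+1}) nsq de@_B * ((B k).+1%:R * om R B).
    rewrite exchange_big /= mulr_sumr; apply: eq_bigr => B _; rewrite -mulr_sumr -mulr_suml.
    have [eB|nB] := eqVneq (mdeg B) m; last first.
      by rewrite (dhomog_coeff0 divergence_homog nB) nsq0 !mul0r mulr0.
    by rewrite sum_succ_mdeg eB mulrCA.
  apply: sum_cvg => k _; apply: sum_cvg => B _; apply: cvgMl_tmp; exact: wk_cvg.
have X_le : X <= (1 + B2 * B1) * T.
  apply: (ler_cvg_to cU (cvg_cst ((1 + B2 * B1) * T : R))); near=> M.
  have MM0 : (M0 <= M)%N by near: M; exists M0.
  have M1 : (0 < M)%N by near: M; exists 1%N.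
  apply: le_trans (ler_wpM2l _ (hM0 L M zeta MM0 isT z1)); last by rewrite addr_ge0 ?mulr_ge0.
  rewrite mulr_sumr; apply: ler_sum => k _; rewrite -Zk_scale; apply: Zk_le => // x y z hx hy hz hk.
  apply: ler_wpM2r; first by rewrite exprn_ge0 // subr_ge0 F_le1.
  apply: le_trans (Re_le1 _) _; rewrite lerD2l !nsqM nsqJ nsqV.
  rewrite -[X in _ <= X]mul1r ler_pM ?mulr_ge0 ?invr_ge0 ?nsq_ge0 //.
    by rewrite invf_le1 // (lt_le_trans _ hk).
  by rewrite ler_pM ?nsq_ge0 ?HB1 ?HB2.
apply: le_trans (ler_wpM2l (ler0n R d) X_le).
have w4 : (fun M => beta N s * \sum_(k < 3) Zk k L M zeta (fun x y z => nsq de.@[pt x y z]))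
    @ \oo --> (beta N s * ((m + 3)%:R * mass0) : R) by exact: cvgMl_tmp.
apply: (ler_cvg_to w4 cE); near=> M.
have M1 : (0 < M)%N by near: M; exists 1%N.
rewrite mulr_sumr; apply: ler_sum => k _; rewrite -Zk_scale; apply: Zk_le => // x y z hx hy hz _.
rewrite mulrC ler_wpM2l ?nsq_ge0 //; apply: lf_power_ge => //.
by rewrite nsq_ge0 F_le1.
Unshelve. all: by end_near.
Qed.

Lemma mass0_gt0 : de != 0 -> 0 < mass0.
Proof.
move=> nz; have m0 : 0 <= mass0 by apply: sumr_ge0 => A _; rewrite mulr_ge0 ?nsq_ge0 // ltW // om_gt0.
rewrite lt0r m0 andbT; apply: contra nz => h; apply/eqP/mpolyP => B; rewrite mcoeff0.
have [eB|nB] := eqVneq (mdeg B) m; last exact: dhomog_coeff0 divergence_homog nB.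
have hB : (mdeg B < m.+1)%N by rewrite eB.
move: h; rewrite psumr_eq0; last first.
  by move=> A _; rewrite mulr_ge0 ?nsq_ge0 // ltW // om_gt0.
move/allP/(_ (BMultinom hB) (mem_index_enum _)).
by rewrite /= mulf_eq0 nsq_eq0 (gt_eqF (om_gt0 _ _)) orbF => /eqP.
Qed.

(* Since [div (F ^ n th) = F ^ n div th], integration by parts compares the means of [|div th|^2 |F|^2n]
   with boundary terms. Summing over [n] with weights [(-1) ^ n 'C(N, n)] bounds [beta N s], of order
   [N ^ (- (m + 3) / d)], by the mean of [(1 - |F|^2) ^ N], of order [N ^ (- p)]. *)
Lemma divergence_eq0 (p K : R) : (m + 3)%:R < p * d%:R -> 0 <= K ->
  (forall n0, exists2 N, (n0 <= N)%N & exists M0, forall L M zeta,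
     (M0 <= M)%N -> (0 < L)%N -> nsq zeta = 1 ->
     \sum_(k < 3) Zk k L M zeta (fun x y z => (1 - nsq F.@[pt x y z]) ^+ N) <= K * ng p N%:R) ->
  divergence th = 0.
Proof.
move=> hp K0 hN; apply/eqP; apply: contraT => nz; have mu0 := mass0_gt0 nz.
have [B B0 hB] := mass0_bound.
have ps : 0 < p - s by rewrite subr_gt0 ltr_pdivrMr ?ltr0n.
set A := beta 1 s * ((m + 3)%:R * mass0).
have A0 : 0 < A by rewrite mulr_gt0 ?beta_gt0 // mulr_gt0 // ltr0n addn3.
(* N^(p - s) exceeds (p - s) ln N, so a value of N beyond exp X contradicts the comparison of N^(-s)
   with N^(-p). *)
set X := (d%:R * (B * K) / A) / (p - s).
have [N hn [M0 hM0]] := hN (Num.truncn (expR X)).+1.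
have N0 : (0 < N)%N by apply: leq_trans hn.
have N0' : 0 < N%:R :> R by rewrite ltr0n.
have h1 := hB N (K * ng p N%:R) N0 (ex_intro _ M0 hM0).
have h2 := beta_lower s0 N0.
have h3 : A * ng s N%:R <= d%:R * (B * K) * ng p N%:R.
  rewrite -[_ * _ * ng p _]mulrA -[B * K * _]mulrA; apply: le_trans h1.
  rewrite /A mulrAC ler_wpM2r // ltW // mulr_gt0 // ltr0n addn3 //.
have h4 : A * ng (s - p) N%:R <= d%:R * (B * K).
  have -> : ng (s - p) N%:R = ng s N%:R / ng p N%:R.
    have -> : ng s N%:R = ng (s - p) N%:R * ng p N%:R by rewrite -ngD subrK.
    by rewrite mulfK // gt_eqF // ng_gt0.
  by rewrite mulrA ler_pdivrMr ?ng_gt0.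
have hX : X < ln N%:R.
  rewrite -[X]expRK ltr_ln ?posrE ?expR_gt0 //.
  by apply: lt_le_trans (truncnS_gt _) _; rewrite ler_nat.
have h5 : X * (p - s) < ng (s - p) N%:R.
  apply: (@lt_trans _ _ (ln N%:R * (p - s))); first by rewrite ltr_pM2r.
  rewrite /ng; have := expR_ge1Dx (- ((s - p) * ln N%:R)).
  rewrite -mulNr opprB mulrC; apply: lt_le_trans; exact: ltr_pwDl.
have h6 : X * (p - s) = d%:R * (B * K) / A by rewrite /X divfK // gt_eqF.
by move: h4; rewrite mulrC -ler_pdivlMr // -h6 leNgt h5.
Qed.

End DivergenceVanishes.

(** * Polynomial derivations and the Euler field *)

Section Derivations.
Variables (K : comNzRingType).
Local Notation mpoly3 := {mpoly K[3]}.
Implicit Types (th : 'I_3 -> mpoly3) (P Q : mpoly3).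

Definition der th P : mpoly3 := \sum_(i < 3) th i * mderiv i P.

Lemma derM th P Q : der th (P * Q) = der th P * Q + P * der th Q.
Proof.
rewrite /der mulr_suml mulr_sumr -big_split; apply: eq_bigr => i _.
by rewrite mderivM /=; ring.
Qed.

Lemma der1 th : der th 1 = 0.
Proof. by rewrite /der big1 // => i _; rewrite -mpolyC1 mderivC mulr0. Qed.

Lemma derZ th c P : der th (c *: P) = c *: der th P.
Proof. by rewrite /der scaler_sumr; apply: eq_bigr => i _; rewrite mderivZ scalerAr. Qed.

Lemma der_prod_eigen th (I : Type) (r : seq I) (q L : I -> mpoly3) :
  (forall i, der th (q i) = L i * q i) ->
  der th (\prod_(i <- r) q i) = (\sum_(i <- r) L i) * \prod_(i <- r) q i.
Proof.
move=> h; elim: r => [|i r IH]; first by rewrite !big_nil der1 mul0r.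
by rewrite !big_cons derM h IH; ring.
Qed.

Lemma der_exp_eq0 th P n : der th P = 0 -> der th (P ^+ n) = 0.
Proof.
move=> h; elim: n => [|n IH]; first exact: der1.
by rewrite exprS derM h IH mul0r mulr0 addr0.
Qed.

Lemma der_add_euler th (a : mpoly3) P :
  der (fun i => th i - a * 'X_i) P = der th P - a * der (fun i => 'X_i) P.
Proof.
rewrite /der mulr_sumr -sumrB; apply: eq_bigr => i _; ring.
Qed.

Lemma der_sum th (I : Type) (r : seq I) (F : I -> mpoly3) :
  der th (\sum_(i <- r) F i) = \sum_(i <- r) der th (F i).
Proof.
rewrite /der exchange_big; apply: eq_bigr => i _ /=.
by rewrite raddf_sum mulr_sumr.
Qed.

Lemma euler_homog d P : P \is d.-homog -> der (fun i => 'X_i) P = d%:R *: P.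
Proof.
move=> /dhomogP hP; rewrite [in LHS](mpolyE P) der_sum [in RHS](mpolyE P) scaler_sumr.
rewrite big_seq [RHS]big_seq; apply: eq_bigr => A hA; rewrite derZ scalerA mulrC -scalerA.
congr (_ *: _); have -> : d = (\sum_i A i)%N by rewrite -mdegE; exact/esym/hP.
rewrite natr_sum /der scaler_suml; apply: eq_bigr => i _.
rewrite mderivX -scalerAr -mpolyXD; case Ai : (A i) => [|a]; first by rewrite !scale0r.
congr (_ *: 'X_[_]); apply/mnmP => l; rewrite mnmDE mnmBE mnm1E.
by case: eqP => [<-|_]; rewrite ?Ai; lia.
Qed.

Lemma dhomog_prod_const d (I : Type) (r : seq I) (F : I -> mpoly3) :
  (forall i, F i \is d.-homog) -> \prod_(i <- r) F i \is (d * size r).-homog.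
Proof.
move=> h; elim: r => [|i r IH]; first by rewrite big_nil muln0 dhomog1.
by rewrite big_cons mulnS dhomogM.
Qed.

Lemma mderiv_mulXU i P : mderiv i (P * 'X_i) = mderiv i P * 'X_i + P.
Proof.
rewrite mderivM mderivX mnm1E eqxx scale1r.
have -> : (U_(i) - U_(i))%MM = 0%MM by apply/mnmP => j; rewrite mnmBE subnn mnm0E.
by rewrite mpolyX0 mulr1.
Qed.

End Derivations.

(** * The cofactors L_j of the conics vanish *)

Section Eigenvalues.
Variables (R : realType) (k m : nat).
Local Notation C := R[i].
Local Notation mpoly3 := {mpoly C[3]}.
Variables (Q : 'I_k -> conic C) (q : 'I_k -> mpoly3).
Variables (th : 'I_3 -> mpoly3) (Lm : 'I_k -> mpoly3).
Hypothesis k5 : (5 <= k)%N.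
Hypothesis mk : (m + 3 <= k + 1)%N.
Hypothesis q_homog : forall i, q i \is 2.-homog.
Hypothesis q_eval : forall i x y z, (q i).@[pt x y z] = qf (Q i) x y z.
Hypothesis volume : exists2 K : R, 0 <= K & forall L M zeta e, good_mesh L M zeta e ->
    Z1 L M zeta (pole Q e) + Z2 L M zeta (pole Q e) + Z3 L M zeta (pole Q e) <= K.
Hypothesis th_homog : forall i, th i \is m.+1.-homog.
Hypothesis Lm_homog : forall j, Lm j \is m.-homog.
Hypothesis th_q : forall j, der th (q j) = Lm j * q j.
Hypothesis sum_Lm : \sum_j Lm j = 0.

Let f : mpoly3 := \prod_j q j.

(** By Bernoulli the second factor is at most (1 + u)^N, and (1 - u^2)^N <= 1. *)
Lemma power_decay (u : R) N : 0 <= u <= 1 -> (1 - u) ^+ N * (1 + N%:R * u) <= 1.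
Proof.
move=> /andP[u0 u1]; have h0 : 0 <= (1 - u) ^+ N by rewrite exprn_ge0 // subr_ge0.
apply: (@le_trans _ _ ((1 - u) ^+ N * (1 + u) ^+ N)).
  apply: (ler_wpM2l h0); elim: (N) => [|n IH]; first by rewrite mul0r addr0 expr0.
  rewrite exprS; apply: (@le_trans _ _ ((1 + u) * (1 + n%:R * u))).
    by rewrite -natr1; have := ler0n R n; nra.
  by rewrite ler_wpM2l // addr_ge0.
rewrite -exprMn exprn_ile1 //; first by nra.
by nra.
Qed.

(** With x = n t, [power_decay] bounds the left side by 1/(1 + x^r) <= 2/(1 + x), and the exponent 1
    may be lowered to [pair_exp]. In terms of N = n^r the decay is N^(-p/r). *)
Lemma power_decay_ng (t : R) r n : (0 < r)%N -> (0 < n)%N -> 0 <= t <= 1 ->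
  (1 - t ^+ r) ^+ (n ^ r) <= 2 * ng (pair_exp R) (1 + n%:R * t).
Proof.
move=> r0 n0 t01; case/andP: (t01) => t0 t1.
have u01 : 0 <= t ^+ r <= 1 by rewrite exprn_ge0 // exprn_ile1.
have := power_decay (n ^ r) u01; rewrite natrX -exprMn.
set x := n%:R * t; have x0 : 0 <= x by rewrite mulr_ge0 ?ler0n.
have xr0 : 0 <= x ^+ r by rewrite exprn_ge0.
have h1 : 1 + x <= 2 * (1 + x ^+ r).
  have [x1|/ltW x1] := leP x 1; first lra.
  have : x <= x ^+ r by rewrite -[X in X <= _]expr1 ler_weXn2l.
  lra.
have h2 : (1 + x)^-1 <= ng (pair_exp R) (1 + x).
  rewrite -ng_1E; last lra.
  rewrite /ng ler_expR lerN2 ler_wpM2r //; last by rewrite /pair_exp; lra.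
  by rewrite ln_ge0; lra.
move=> h3; apply: le_trans (ler_wpM2l _ h2) => //.
have p1 : 0 < 1 + x ^+ r by lra.
have p2 : 0 < 1 + x by lra.
apply: (@le_trans _ _ (1 + x ^+ r)^-1); first by rewrite -[X in _ <= X]mul1r ler_pdivlMr.
rewrite -[X in _ <= X]invrK invfM invrK lef_pV2 ?posrE ?mulr_gt0 ?invr_gt0 //.
by rewrite mulrC ler_pdivrMr // mulrC.
Qed.

Let D := (2 * k * 100 + 2)%N.

Lemma f_homog : f \is (2 * k).-homog.
Proof.
rewrite /f -big_enum; have := dhomog_prod_const (enum 'I_k) q_homog.
by rewrite size_enum_ord.
Qed.

Lemma der_f : der th f = 0.
Proof. by rewrite (der_prod_eigen _ th_q) sum_Lm mul0r. Qed.

(* The exponent 100 makes [(m + 3) / D < pair_exp / 101], which needs [k >= 5]. *)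
Lemma decay_exists j : exists (c : C) (K : R), [/\ c != 0, 0 <= K,
   forall x y z, nsq x <= 2 -> nsq y <= 2 -> nsq z <= 2 ->
     nsq (c *: (f ^+ 100 * q j)).@[pt x y z] <= 1 &
   forall n L M zeta, (0 < n)%N -> (n <= M)%N -> (0 < L)%N -> nsq zeta = 1 ->
     \sum_(l < 3) Zk l L M zeta
       (fun x y z => (1 - nsq (c *: (f ^+ 100 * q j)).@[pt x y z]) ^+ (n ^ 101)) <=
     K * ng (pair_exp R) n%:R].
Proof.
have [B B0 hB] : exists2 B : R, 0 <= B & forall i, forall x y z, nsq x <= 2 -> nsq y <= 2 ->
    nsq z <= 2 -> nsq (q i).@[pt x y z] <= B.
  apply: uniform_bound => [i|i c c' cc' h x y z hx hy hz]; first exact: mpoly_bounded.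
  exact: le_trans (h x y z hx hy hz) cc'.
set B' := B + 1; have B1 : 1 <= B' by rewrite /B'; lra.
have [BG BG0 hBG] := mpoly_bounded (f ^+ 100 * q j).
have [K K0 hK] := volume.
(* Normalizes the polynomial to modulus at most 1 on the polysquare. *)
pose c : R := (1 + BG)^-1.
have c0 : 0 < c by rewrite invr_gt0; lra.
have c1 : c <= 1 by rewrite invf_le1; lra.
pose a := c ^+ 2 / B' ^+ k.
have Bk1 : 1 <= B' ^+ k by rewrite exprn_ege1.
have a0 : 0 < a by rewrite divr_gt0 ?exprn_gt0 //; lra.
have a1 : a <= 1.
  rewrite ler_pdivrMr; last lra.
  by rewrite mul1r; apply: le_trans Bk1; rewrite exprn_ile1 // ltW.
have evF x y z : nsq (c%:C%C *: (f ^+ 100 * q j)).@[pt x y z] = c ^+ 2 * nsq (f ^+ 100 * q j).@[pt x y z].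
  by rewrite mevalZ nsqM nsq_real.
have F1 x y z : nsq x <= 2 -> nsq y <= 2 -> nsq z <= 2 ->
     nsq (c%:C%C *: (f ^+ 100 * q j)).@[pt x y z] <= 1.
  move=> hx hy hz; rewrite evF; apply: (@le_trans _ _ (c * (1 + BG))); last by rewrite mulVf // gt_eqF //; lra.
  rewrite expr2 -mulrA ler_pM2l //; apply: (@le_trans _ _ (nsq (f ^+ 100 * q j).@[pt x y z])).
    by rewrite ler_piMl ?nsq_ge0.
  by apply: le_trans (hBG x y z hx hy hz) _; rewrite lerDr.
have fE x y z : f.@[pt x y z] = \prod_i qf (Q i) x y z.
  by rewrite /f rmorph_prod; apply: eq_bigr => i _ /=; rewrite q_eval.
(* The conics other than q_j are bounded, so |q_j| is at least a constant times |f|, and f^100 q_j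
   is bounded below by the 101st power of a multiple of f. This is the origin of the exponent
   101. *)
have tF x y z : nsq x <= 2 -> nsq y <= 2 -> nsq z <= 2 ->
     (a * nsq f.@[pt x y z]) ^+ 101 <= nsq (c%:C%C *: (f ^+ 100 * q j)).@[pt x y z].
  move=> hx hy hz; rewrite evF mevalM rmorphXn nsqM nsqX exprMn.
  set t := nsq f.@[_]; have t0 : 0 <= t by exact: nsq_ge0.
  have ht : t <= nsq (q j).@[pt x y z] * B' ^+ k.
    rewrite /t /f rmorph_prod /= (bigD1 j) //= nsqM ler_wpM2l ?nsq_ge0 //.
    rewrite nsq_prod; apply: (@le_trans _ _ (\prod_(i < k | i != j) B')).
      by apply: ler_prod => i _; rewrite nsq_ge0 (le_trans (hB i x y z hx hy hz)) // /B' lerDl.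
    rewrite prodr_const ler_weXn2l // (leq_trans (max_card _)) ?card_ord //.
  have a101 : a ^+ 101 <= a by rewrite exprS ger_pMr // exprn_ile1 // ltW.
  apply: (@le_trans _ _ (a * t ^+ 101)); first by rewrite ler_wpM2r ?exprn_ge0.
  have -> : a * t ^+ 101 = c ^+ 2 * (t ^+ 100 * (t / B' ^+ k)) by rewrite /a exprSr; ring.
  rewrite ler_pM2l ?exprn_gt0 //; apply: ler_wpM2l; first by rewrite exprn_ge0.
  by rewrite ler_pdivrMr //; lra.
exists c%:C%C, (2 * ng (pair_exp R) a * K); split=> //.
- by rewrite fmorph_eq0 gt_eqF.
- by rewrite !mulr_ge0 ?ng_ge0.
move=> n L M zeta n0 nM L0 z1.
have n0' : 0 < n%:R :> R by rewrite ltr0n.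
have M0 : (0 < M)%N by apply: leq_trans nM.
(* The regularization is 1/n, which every grid with M >= n resolves. *)
have mesh : good_mesh L M zeta (n%:R^-1 : R).
  split=> //; first by rewrite invr_gt0 n0' invf_le1 // ler1n.
  rewrite ler_pdivlMr // mul1r -natrX ler_nat (leq_trans nM) // -[X in (X <= _)%N]expn1.
  by rewrite leq_pexp2l.
have e : \sum_(l < 3) Zk l L M zeta (pole Q n%:R^-1) <= K.
  by rewrite big_ord3 /= addrA; apply: hK mesh.
rewrite -mulrA [K * _]mulrC mulrA; apply: le_trans (ler_wpM2l _ e); last by rewrite !mulr_ge0 ?ng_ge0.
rewrite mulr_sumr; apply: ler_sum => l _; rewrite -Zk_scale; apply: Zk_le => // x y z hx hy hz _.
have h1 := tF x y z hx hy hz; have h2 := F1 x y z hx hy hz.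
set t := a * nsq f.@[pt x y z] in h1.
have t0 : 0 <= t by rewrite mulr_ge0 ?nsq_ge0 // ltW.
have t1 : t <= 1 by rewrite -(@expr_le1 _ 101) //; apply: le_trans h1 h2.
apply: (@le_trans _ _ ((1 - t ^+ 101) ^+ (n ^ 101))).
  by rewrite lerXn2r ?nnegrE ?subr_ge0 ?lerD2l ?lerN2 //; apply: le_trans h1 h2.
have t01 : 0 <= t <= 1 by rewrite t0.
have h3 := @power_decay_ng t 101 n isT n0 t01; apply: le_trans h3 _.
rewrite -!mulrA ler_pM2l // /pole -fE.
have w0 : 0 < nsq f.@[pt x y z] + n%:R^-1 by apply: addr_pos; rewrite ?nsq_ge0 ?invr_gt0.
have -> : ng (pair_exp R) a * (ng (pair_exp R) n%:R * ng (pair_exp R) (nsq f.@[pt x y z] + n%:R^-1)) =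
    ng (pair_exp R) (a * (n%:R * (nsq f.@[pt x y z] + n%:R^-1))).
  by rewrite -!ngM // mulr_gt0.
apply: ng_le; first by rewrite /pair_exp; lra.
  exact: mulr_gt0 a0 (mulr_gt0 n0' w0).
rewrite mulrDr divff ?gt_eqF // mulrDr mulr1 /t mulrCA addrC; lra.
Qed.

(** theta multiplies F = c f^100 q_j by L_j and the Euler field E multiplies it by the degree D, so
    theta - (L_j / D) E kills F. The divergence of L_j E is (m + 3) L_j, so its vanishing expresses
    L_j through div(theta) in a way that does not depend on j. *)
Lemma eigenvalues_eq_divergence j : Lm j = (D%:R / (m + 3)%:R) *: divergence th.
Proof.
have [c [K [c0 K0 hF1 hK]]] := decay_exists j.
set F := c *: (f ^+ 100 * q j) in hF1 hK.
have D0 : D%:R != 0 :> C by rewrite pnatr_eq0 /D; lia.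
have m0 : (m + 3)%:R != 0 :> C by rewrite pnatr_eq0; lia.
have F_homog : F \is D.-homog.
  by rewrite dhomogZ // dhomogM ?q_homog // dhomogMn // f_homog.
pose th' i := th i - (D%:R^-1 *: Lm j) * 'X_i.
have th'_homog i : th' i \is m.+1.-homog.
  rewrite rpredB // -[m.+1]addn1 dhomogM ?dhomogZ // dhomogX; apply/eqP; exact: mdeg1.
have derF : der th F = Lm j * F.
  by rewrite derZ derM (der_exp_eq0 _ der_f) mul0r add0r th_q mulrCA -scalerAr.
have th'F : \sum_(i < 3) th' i * mderiv i F = 0.
  rewrite -[LHS]/(der th' F) der_add_euler derF (euler_homog F_homog).
  have e (G : mpoly3) : D%:R^-1 *: Lm j * (D%:R *: G) = Lm j * G.
    by rewrite -scalerAl -scalerAr scalerA mulVf // scale1r.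
  by rewrite e subrr.
have divth' : divergence th' = divergence th - ((m + 3)%:R / D%:R) *: Lm j.
  have -> : divergence th' = divergence th -
      \sum_(i < 3) (mderiv i (D%:R^-1 *: Lm j) * 'X_i + D%:R^-1 *: Lm j).
    rewrite /divergence -sumrB; apply: eq_bigr => i _.
    by rewrite mderivB mderiv_mulXU.
  congr (_ - _); rewrite big_split /= sumr_const card_ord.
  have -> : \sum_(i < 3) mderiv i (D%:R^-1 *: Lm j) * 'X_i = m%:R *: (D%:R^-1 *: Lm j).
    rewrite -(euler_homog (dhomogZ D%:R^-1 (Lm_homog j))); apply: eq_bigr => i _; exact: mulrC.
  by rewrite -[_ *+ 3]scaler_nat -scalerDl -natrD scalerA.
(* Here k >= 5 enters the analytic estimate: (k + 1)/(200 k + 2) < 61/10100 holds at k = 5 and fails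
   at k = 4. *)
have hp : (m + 3)%:R < pair_exp R / 101%:R * D%:R.
  have h1 : (m + 3)%:R <= k%:R + 1 :> R by rewrite natr1 ler_nat; move: mk; rewrite addn1.
  have h2 : 5 <= k%:R :> R by rewrite ler_nat.
  have -> : D%:R = 200%:R * k%:R + 2 :> R by rewrite /D natrD !natrM; ring.
  rewrite /pair_exp; lra.
have h0 : divergence th' = 0.
  apply: (@divergence_eq0 R m D F th' _ F_homog th'_homog th'F _ (pair_exp R / 101%:R) K hp K0).
  - by rewrite /D addn2.
  - exact: hF1.
  move=> n0; exists (n0.+1 ^ 101)%N.
    by apply: leq_trans (leqnSn n0) _; rewrite -[X in (X <= _)%N]expn1 leq_pexp2l.
  exists n0.+1 => L M zeta hM L0 z1; rewrite natrX -ng_exp // ngX.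
  have -> : 101%:R * (pair_exp R / 101%:R) = pair_exp R by rewrite /pair_exp; field.
  exact: hK.
move: h0; rewrite divth' => /eqP; rewrite subr_eq0 => /eqP ->.
rewrite scalerA; have -> : D%:R / (m + 3)%:R * ((m + 3)%:R / D%:R) = 1 :> C.
  by rewrite mulrA divfK // divff.
by rewrite scale1r.
Qed.

Lemma eigenvalues_eq0 j : Lm j = 0.
Proof.
have := sum_Lm; rewrite (eq_bigr (fun=> Lm j)); last first.
  by move=> i _; rewrite !eigenvalues_eq_divergence.
rewrite sumr_const card_ord -scaler_nat => /eqP.
by rewrite scaler_eq0 pnatr_eq0; case: (k) k5 => //= ? _ /eqP.
Qed.

End Eigenvalues.

(** * Linear substitutions in polynomials and derivations *)

Section MPolyTools.
Variable K : comNzRingType.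
Local Notation mpoly3 := {mpoly K[3]}.

Lemma mpoly_alg_ind (S : mpoly3 -> Prop) :
  (forall c, S c%:MP) -> (forall P Q, S P -> S Q -> S (P + Q)) ->
  (forall P i, S P -> S (P * 'X_i)) -> forall P, S P.
Proof.
move=> hC hD hX P.
have hXX Q i n : S Q -> S (Q * 'X_i ^+ n).
  by move=> hQ; elim: n => [|n IH]; rewrite ?mulr1 // exprSr mulrA; apply: hX.
have hM c A : S (c *: 'X_[A]).
  rewrite mpolyXE_id big_ord3 /= -mul_mpolyC !mulrA; exact: (hXX _ _ _ (hXX _ _ _ (hXX _ _ _ (hC c)))).
rewrite (mpolyE P); elim: (msupp P) => [|A s IH]; first by rewrite big_nil -[0]mpolyC0.
by rewrite big_cons; apply: hD.
Qed.

Lemma mderiv_homog d i (P : mpoly3) : P \is d.+1.-homog -> mderiv i P \is d.-homog.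
Proof.
move=> hP; apply/dhomogP => B; rewrite mcoeff_msupp mcoeff_deriv => nz; apply/eqP; apply: contraNT nz => nB.
by rewrite (dhomog_coeff0 hP) ?mul0rn // mdegD mdeg1 addn1 eqSS.
Qed.

Lemma homog0_const (P : mpoly3) : P \is 0.-homog -> P = (P@_0%MM)%:MP.
Proof.
move=> hP; apply/mpolyP => B; rewrite mcoeffC; have [->|nB] := eqVneq 0%MM B; first by rewrite mulr1.
by rewrite mulr0 (dhomog_coeff0 hP) // mdeg_eq0 eq_sym.
Qed.

Definition lin (T : 'M[K]_3) i : mpoly3 := \sum_(j < 3) T i j *: 'X_j.
Definition sub (T : 'M[K]_3) (P : mpoly3) : mpoly3 := P \mPo [tuple lin T i | i < 3].
Definition act (T : 'M[K]_3) (v : 'I_3 -> K) i : K := \sum_(j < 3) T i j * v j.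

Lemma lin_eval T i v : (lin T i).@[v] = act T v i.
Proof. by rewrite /lin raddf_sum; apply: eq_bigr => j _ /=; rewrite mevalZ mevalXU. Qed.

Lemma sub_eval T P v : (sub T P).@[v] = P.@[act T v].
Proof.
rewrite /sub comp_mpoly_meval; apply: meval_eq => i.
by rewrite tnth_mktuple lin_eval.
Qed.

Lemma sub_X T i : sub T 'X_i = lin T i.
Proof. by rewrite /sub comp_mpolyXU -tnth_nth tnth_mktuple. Qed.

Lemma subM T P Q : sub T (P * Q) = sub T P * sub T Q.
Proof. by rewrite /sub rmorphM. Qed.

Lemma subD T P Q : sub T (P + Q) = sub T P + sub T Q.
Proof. by rewrite /sub raddfD. Qed.

Lemma mderiv_lin T i j : mderiv i (lin T j) = (T j i)%:MP.
Proof.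
rewrite /lin raddf_sum /= (bigD1 i) //= mderivZ mderivX mnm1E eqxx scale1r.
have -> : (U_(i) - U_(i))%MM = 0%MM by apply/mnmP => l; rewrite mnmBE subnn mnm0E.
rewrite mpolyX0 big1 => [|l li]; first by rewrite addr0 -mul_mpolyC mulr1.
by rewrite mderivZ mderivX mnm1E (negbTE li) scale0r scaler0.
Qed.

Lemma mderiv_XU (i j : 'I_3) : mderiv i ('X_j : mpoly3) = (i == j)%:R.
Proof.
rewrite mderivX mnm1E; have [->|ij] := eqVneq i j; last by rewrite scale0r.
have -> : (U_(j) - U_(j))%MM = 0%MM by apply/mnmP => l; rewrite mnmBE subnn mnm0E.
by rewrite scale1r mpolyX0.
Qed.

Lemma mderiv_sub T i P : mderiv i (sub T P) = \sum_(l < 3) T l i *: sub T (mderiv l P).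
Proof.
elim/mpoly_alg_ind: P => [c|P Q hP hQ|P j hP].
- rewrite /sub comp_mpolyC mderivC big1 // => l _.
  by rewrite mderivC comp_mpoly0 scaler0.
- rewrite subD mderivD hP hQ -big_split; apply: eq_bigr => l _ /=.
  by rewrite mderivD subD scalerDr.
- rewrite subM mderivM hP sub_X mderiv_lin.
  have -> : \sum_(l < 3) T l i *: sub T (mderiv l (P * 'X_j)) =
     (\sum_(l < 3) T l i *: sub T (mderiv l P)) * lin T j + \sum_(l < 3) T l i *: (sub T P * (l == j)%:R).
    rewrite mulr_suml -big_split; apply: eq_bigr => l _ /=.
    rewrite mderivM subD !subM sub_X mderiv_XU scalerDr -scalerAl; congr (_ + _ *: (_ * _)).
    by rewrite /sub; case: (l == j); rewrite ?comp_mpoly1 ?comp_mpoly0.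
  congr (_ + _); rewrite (bigD1 j) //= eqxx mulr1 big1 => [|l /negbTE ->]; last by rewrite mulr0 scaler0.
  by rewrite addr0 -mul_mpolyC mulrC.
Qed.

Lemma dhomog_sub T d P : P \is d.-homog -> sub T P \is d.-homog.
Proof.
move=> /dhomogP hP; rewrite /sub comp_mpolyEX big_seq rpred_sum // => A hA.
apply: dhomogZ.
have hl i : lin T i \is 1.-homog.
  by apply: rpred_sum => j _; rewrite dhomogZ // dhomogX; apply/eqP; exact: mdeg1.
have -> : d = (1 * A o0 + (1 * A o1 + 1 * A o2))%N.
  have e : mdeg A = (1 * A o0 + (1 * A o1 + 1 * A o2))%N by rewrite mdegE !big_ord_recl big_ord0; lia.
  by rewrite -e; exact/esym/hP.
rewrite comp_mpolyX big_ord3 /= !tnth_mktuple.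
by rewrite dhomogM ?dhomogM // dhomogMn.
Qed.

Lemma actE T T' v i : act T (act T' v) i = act (T *m T') v i.
Proof.
rewrite /act; under eq_bigr => j _ do rewrite mulr_sumr.
rewrite exchange_big; apply: eq_bigr => l _ /=.
by rewrite mxE mulr_suml; apply: eq_bigr => j _; rewrite mulrA.
Qed.

Lemma act1 v i : act 1%:M v i = v i.
Proof.
rewrite /act (bigD1 i) //= mxE eqxx mul1r big1 ?addr0 // => j ji.
by rewrite mxE eq_sym (negbTE ji) mul0r.
Qed.

(** The derivation conjugated by [sub T], with [T'] meant to be the inverse matrix. *)
Definition transport (T T' : 'M[K]_3) (th : 'I_3 -> mpoly3) i : mpoly3 :=
  \sum_(j < 3) T' i j *: sub T (th j).

Lemma der_transport T T' th P : T *m T' = 1%:M ->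
  der (transport T T' th) (sub T P) = sub T (der th P).
Proof.
move=> TT; rewrite /der /transport.
have -> : sub T (\sum_(j < 3) th j * mderiv j P) = \sum_(j < 3) sub T (th j) * sub T (mderiv j P).
  by rewrite /sub raddf_sum; apply: eq_bigr => j _; apply: subM.
have e i : (\sum_(j < 3) T' i j *: sub T (th j)) * mderiv i (sub T P) =
   \sum_(j < 3) \sum_(l < 3) (T l i * T' i j) *: (sub T (th j) * sub T (mderiv l P)).
  rewrite mderiv_sub mulr_suml; apply: eq_bigr => j _; rewrite mulr_sumr; apply: eq_bigr => l _.
  by rewrite -scalerAl -scalerAr scalerA mulrC.
rewrite (eq_bigr _ (fun i _ => e i)) exchange_big; apply: eq_bigr => j _ /=.
rewrite exchange_big (bigD1 j) //= [X in _ + X]big1 => [|l lj].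
  rewrite addr0 -scaler_suml; have := congr1 (fun M : 'M_3 => M j j) TT.
  by rewrite !mxE eqxx => ->; rewrite scale1r.
rewrite -scaler_suml; have := congr1 (fun M : 'M_3 => M l j) TT.
by rewrite !mxE (negbTE lj) => ->; rewrite scale0r.
Qed.

End MPolyTools.

(** * Polynomials vanishing at all points *)

Section MPolyComplex.
Variable R : realType.
Local Notation C := R[i].
Local Notation mpoly3 := {mpoly C[3]}.

(** For M = 2 the grid is -1/2, 1/2, so no sample point is zero and every moment is positive. *)
Lemma wk_gt0 k B : 0 < wk R k 2 B.
Proof.
have g0 (j : 'I_2) : grid R j ^+ 2 != 0.
  rewrite expf_neq0 // /grid mulf_neq0 ?invr_neq0 ?pnatr_eq0 //.
  by case: j => -[|[|//]] h /=; rewrite /grid ?subr_eq0 ?eqr_nat.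
have pos (f : 'I_2 * 'I_2 -> R) : (forall t, 0 < f t) -> 0 < \sum_t f t.
  move=> f0; rewrite (bigD1 (ord0, ord0)) //=; apply: ltr_wpDr; last exact: f0.
  by apply: sumr_ge0 => t _; apply/ltW/f0.
apply: prodr_gt0 => i _; case: ifP => _; rewrite /wA /wB /mean divr_gt0 ?ltr0n ?card_prod ?card_ord //.
- rewrite !big_ord_recl big_ord0 addr0 ltr_wpDl ?exprn_ge0 ?nsq_ge0 //.
  by rewrite exprn_gt0 // nsq_gt0 eq_complex /= oner_eq0.
- have h (t : 'I_2 * 'I_2) : 0 < nsq (grid R t.1 +i* grid R t.2)%C ^+ B i.
    rewrite exprn_gt0 // /nsq /= ltr_wpDr ?sqr_ge0 // lt0r g0 sqr_ge0 //.
  exact: (pos _ h).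
Qed.

(** The mean of |P|^2 is a diagonal form in the coefficients of P with positive weights, so it
    detects every coefficient. *)
Lemma mpoly_eq0 (P : mpoly3) : (forall x y z, P.@[pt x y z] = 0) -> P = 0.
Proof.
move=> h; have [zeta zetaP] := @exists_prim_root C (msize P).+1 isT.
have := Zk_nsq 2 zetaP o0 (ltnSn (msize P)) (leqnn _).
have -> : (fun x y z => nsq P.@[pt x y z]) = fun x y z => 0 * 0 :> R.
  by apply/funext => x; apply/funext => y; apply/funext => z; rewrite h nsq0 mulr0.
rewrite Zk_scale mul0r => /esym/eqP; rewrite psumr_eq0; last first.
  by move=> B _; rewrite mulr_ge0 ?nsq_ge0 // ltW // wk_gt0.
move=> /allP h0; apply/mpolyP => B; rewrite mcoeff0.
have [hB|hB] := ltnP (mdeg B) (msize P); last first.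
  by apply/eqP; rewrite mcoeff_eq0; apply: msize_mdeg_ge.
have := h0 (BMultinom hB) (mem_index_enum _).
by rewrite mulf_eq0 nsq_eq0 (gt_eqF (wk_gt0 _ _)) orbF => /eqP.
Qed.

End MPolyComplex.

(** * Homogeneity through scaling *)

Section Scaling.
Variable K : numFieldType.
Local Notation mpoly3 := {mpoly K[3]}.

Lemma sub_scalar_coeff (t : K) (P : mpoly3) B : (sub t%:M P)@_B = t ^+ mdeg B * P@_B.
Proof.
have ht i : lin t%:M i = t *: 'X_i :> mpoly3.
  rewrite /lin (bigD1 i) //= mxE eqxx mulr1n big1 ?addr0 // => j ji.
  by rewrite mxE eq_sym (negbTE ji) scale0r.
rewrite /sub comp_mpolyEX raddf_sum /=.
have e A : (P@_A *: ('X_[A] \mPo [tuple lin t%:M i | i < 3]))@_B = t ^+ mdeg B * (P@_A * (A == B)%:R).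
  have -> : 'X_[A] \mPo [tuple lin t%:M i | i < 3] = t ^+ mdeg A *: 'X_[A].
    rewrite comp_mpolyX [in RHS]mpolyXE_id mdegE -prodrXr -scaler_prod.
    by apply: eq_bigr => i _; rewrite tnth_mktuple ht exprZn.
  rewrite !mcoeffZ mcoeffX; have [->|_] := eqVneq A B; last by rewrite !mulr0.
  by rewrite mulrCA.
rewrite (eq_bigr _ (fun A _ => e A)) -mulr_sumr; congr (_ * _).
have [hB|hB] := boolP (B \in msupp P); last first.
  rewrite big_seq big1 => [|A hA]; first by apply/esym/eqP; rewrite mcoeff_eq0.
  by case: eqP => [eA|_]; rewrite ?mulr0 //; rewrite eA (negbTE hB) in hA.
rewrite (bigD1_seq B) ?msupp_uniq //= eqxx mulr1 big1 ?addr0 // => A /negbTE ->.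
by rewrite mulr0.
Qed.

Lemma sub_scalar_homog (t : K) d (P : mpoly3) : P \is d.-homog -> sub t%:M P = t ^+ d *: P.
Proof.
move=> hP; apply/mpolyP => B; rewrite sub_scalar_coeff mcoeffZ.
have [->//|nB] := eqVneq (mdeg B) d.
by rewrite (dhomog_coeff0 hP nB) !mulr0.
Qed.

(** Substituting 2x, 2y, 2z multiplies the product and q by powers of 2, hence also A. Since the
    powers of 2 are distinct, A has a single degree. *)
Lemma homog_of_mul d e (A q : mpoly3) : q \is e.-homog -> q != 0 ->
  A * q \is (d + e).-homog -> A \is d.-homog.
Proof.
move=> hq q0 hAq.
have h2 : 2 != 0 :> K by rewrite pnatr_eq0.
have e1 : sub 2%:M A = 2 ^+ d *: A.
  apply: (mulIf q0); apply: (@scalerI _ _ (2 ^+ e)); first by rewrite expf_neq0.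
  transitivity (sub 2%:M A * sub 2%:M q); first by rewrite (sub_scalar_homog 2 hq) -scalerAr.
  rewrite -subM (sub_scalar_homog 2 hAq).
  by rewrite exprD -scalerAl scalerA mulrC.
apply/dhomogP => B; rewrite mcoeff_msupp => nz.
have := congr1 (mcoeff B) e1; rewrite sub_scalar_coeff mcoeffZ => /(mulIf nz).
rewrite -!natrX => /eqP; rewrite eqr_nat eqn_exp2l // => /eqP; exact.
Qed.

End Scaling.

(** * The symmetric matrix of a quadratic form *)

Section ConicOfPolynomial.
Variable K : numClosedFieldType.
Local Notation mpoly3 := {mpoly K[3]}.

Definition hess (q : mpoly3) i j : K := (mderiv j (mderiv i q))@_0%MM.

(** All entries are halved: a pure second derivative is twice the coefficient of a square, and a
    mixed one is the full coefficient, of which [Conic] stores one half. *)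
Definition conic_of (q : mpoly3) : conic K :=
  Conic (hess q o0 o0 / 2) (hess q o1 o1 / 2) (hess q o2 o2 / 2)
        (hess q o0 o1 / 2) (hess q o0 o2 / 2) (hess q o1 o2 / 2).

Lemma hess_sym q i j : hess q i j = hess q j i.
Proof. by rewrite /hess mderiv_comm. Qed.

Variable q : mpoly3.
Hypothesis hq : q \is 2.-homog.

Lemma mderiv_expand i : mderiv i q = \sum_(j < 3) hess q i j *: 'X_j.
Proof.
have h1 := mderiv_homog i hq.
rewrite -[LHS]scale1r -(euler_homog h1); apply: eq_bigr => j _.
by rewrite [mderiv j _]homog0_const ?mderiv_homog // mulrC mul_mpolyC.
Qed.

Lemma mderiv_eval i v : (mderiv i q).@[v] = \sum_(j < 3) hess q i j * v j.
Proof.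
by rewrite mderiv_expand raddf_sum; apply: eq_bigr => j _ /=; rewrite mevalZ mevalXU.
Qed.

Lemma conic_of_gx x y z : (mderiv o0 q).@[pt x y z] = 2 * gx (conic_of q) x y z.
Proof. by rewrite mderiv_eval big_ord3 /= /gx /conic_of /pt /=; field. Qed.

Lemma conic_of_gy x y z : (mderiv o1 q).@[pt x y z] = 2 * gy (conic_of q) x y z.
Proof. by rewrite mderiv_eval big_ord3 /= /gy /conic_of /pt /= (hess_sym q o1 o0); field. Qed.

Lemma conic_of_gz x y z : (mderiv o2 q).@[pt x y z] = 2 * gz (conic_of q) x y z.
Proof.
by rewrite mderiv_eval big_ord3 /= /gz /conic_of /pt /= (hess_sym q o2 o0) (hess_sym q o2 o1); field.
Qed.

Lemma euler_conic (Q : conic K) x y z :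
  qf Q x y z = x * gx Q x y z + y * gy Q x y z + z * gz Q x y z.
Proof. by rewrite /qf /gx /gy /gz; ring. Qed.

Lemma conic_of_qf x y z : q.@[pt x y z] = qf (conic_of q) x y z.
Proof.
have n2 : 2 != 0 :> K by rewrite pnatr_eq0.
apply: (mulfI n2); rewrite -mevalZ -(euler_homog hq) raddf_sum big_ord3 /=.
rewrite !mevalM !mevalXU conic_of_gx conic_of_gy conic_of_gz euler_conic /pt /=; ring.
Qed.

End ConicOfPolynomial.

(** * Three conics with dependent gradients *)

Definition det3 (K : comNzRingType) (a1 a2 a3 b1 b2 b3 c1 c2 c3 : K) : K :=
  (a2 * b3 - a3 * b2) * c1 + (a3 * b1 - a1 * b3) * c2 + (a1 * b2 - a2 * b1) * c3.

(** Cramer's rule without division, so that it applies over the polynomial ring. *)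
Lemma kernel_det3 (K : comNzRingType) (t1 t2 t3 a1 a2 a3 b1 b2 b3 c1 c2 c3 : K) :
  t1 * a1 + t2 * a2 + t3 * a3 = 0 -> t1 * b1 + t2 * b2 + t3 * b3 = 0 ->
  t1 * c1 + t2 * c2 + t3 * c3 = 0 -> let D := det3 a1 a2 a3 b1 b2 b3 c1 c2 c3 in
  [/\ t1 * D = 0, t2 * D = 0 & t3 * D = 0].
Proof.
move=> ha hb hc D; split.
- transitivity ((t1 * a1 + t2 * a2 + t3 * a3) * (b2 * c3 - b3 * c2) +
    (t1 * b1 + t2 * b2 + t3 * b3) * (a3 * c2 - a2 * c3) +
    (t1 * c1 + t2 * c2 + t3 * c3) * (a2 * b3 - a3 * b2)); first by rewrite /D /det3; ring.
  by rewrite ha hb hc !mul0r !addr0.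
- transitivity ((t1 * a1 + t2 * a2 + t3 * a3) * (b3 * c1 - b1 * c3) +
    (t1 * b1 + t2 * b2 + t3 * b3) * (a1 * c3 - a3 * c1) +
    (t1 * c1 + t2 * c2 + t3 * c3) * (a3 * b1 - a1 * b3)); first by rewrite /D /det3; ring.
  by rewrite ha hb hc !mul0r !addr0.
- transitivity ((t1 * a1 + t2 * a2 + t3 * a3) * (b1 * c2 - b2 * c1) +
    (t1 * b1 + t2 * b2 + t3 * b3) * (a2 * c1 - a1 * c2) +
    (t1 * c1 + t2 * c2 + t3 * c3) * (a1 * b2 - a2 * b1)); first by rewrite /D /det3; ring.
  by rewrite ha hb hc !mul0r !addr0.
Qed.

Section CommonKernel.
Variable K : numClosedFieldType.
Implicit Types A B : conic K.

Lemma parallelP (a1 a2 a3 b1 b2 b3 : K) :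
  [&& a2 * b3 - a3 * b2 == 0, a3 * b1 - a1 * b3 == 0 & a1 * b2 - a2 * b1 == 0] ->
  ~ [/\ a1 = 0, a2 = 0 & a3 = 0] -> exists k, [/\ b1 = k * a1, b2 = k * a2 & b3 = k * a3].
Proof.
rewrite !subr_eq0 => /and3P[/eqP e1 /eqP e2 /eqP e3] nz.
have [a10|a10] := eqVneq a1 0; last first.
  exists (b1 / a1); rewrite divfK //; split=> //; rewrite mulrAC.
    by rewrite mulrC [b1 * _]mulrC -e3 mulKf.
  by rewrite [b1 * _]mulrC e2 mulrC mulKf.
have [a20|a20] := eqVneq a2 0; last first.
  exists (b2 / a2); rewrite divfK //; split=> //; rewrite mulrAC.
    by rewrite [b2 * _]mulrC e3 mulrC mulKf.
  by rewrite mulrC [b2 * _]mulrC -e1 mulKf.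
have [a30|a30] := eqVneq a3 0; last first.
  exists (b3 / a3); rewrite divfK //; split=> //; rewrite mulrAC.
    by rewrite mulrC [b3 * _]mulrC -e2 mulKf.
  by rewrite [b3 * _]mulrC e1 mulrC mulKf.
by case: nz.
Qed.

(** If a and b were independent, p would be a multiple of their cross product, and the product of p
    and c a multiple of the vanishing determinant. *)
Lemma perp_det (a1 a2 a3 b1 b2 b3 p1 p2 p3 c1 c2 c3 : K) :
  a1 * p1 + a2 * p2 + a3 * p3 = 0 -> b1 * p1 + b2 * p2 + b3 * p3 = 0 ->
  p1 * c1 + p2 * c2 + p3 * c3 != 0 -> det3 a1 a2 a3 b1 b2 b3 c1 c2 c3 = 0 ->
  [&& a2 * b3 - a3 * b2 == 0, a3 * b1 - a1 * b3 == 0 & a1 * b2 - a2 * b1 == 0].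
Proof.
move=> ha hb hc hd; apply: contraNT hc => nz.
have [k [-> -> ->]] := cross_proportional ha hb nz.
by rewrite -[X in _ == X](mulr0 k) -hd /det3; apply/eqP; ring.
Qed.

Lemma cubic_coefs (d1 d2 d3 : K) : (forall t, t * d1 + t ^+ 2 * d2 + t ^+ 3 * d3 = 0) ->
  d1 = 0 /\ d2 = 0.
Proof.
move=> h; have h1 := h 1; have h2 := h (-1); have h3 := h 2.
have n2 : 2 != 0 :> K by rewrite pnatr_eq0.
have n6 : 6 != 0 :> K by rewrite pnatr_eq0.
have e2 : d2 = 0.
  apply: (mulfI n2); rewrite mulr0 -[RHS]addr0 -{1}h1 -{1}h2; ring.
split=> //; apply: (mulfI n6); rewrite mulr0.
transitivity (8 * (1 * d1 + 1 ^+ 2 * d2 + 1 ^+ 3 * d3) - (2 * d1 + 2 ^+ 2 * d2 + 2 ^+ 3 * d3) - 4 * d2).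
  by ring.
by rewrite h1 h3 e2 !mulr0 !subr0.
Qed.

Definition subc A k B := Conic (ca A - k * ca B) (cb A - k * cb B) (cc A - k * cc B)
  (cd A - k * cd B) (ce A - k * ce B) (cf A - k * cf B).

(** The obstruction sits at tangency points. Euler's identity makes the gradients of A1 and A2
    orthogonal to the point, that of A3 is not, so dependence forces A1 and A2 to be tangent there.
    The determinant is then expanded to second order around the point, until the gradient of A3 is
    also forced to be parallel to that of A1, against A3 being nonzero at the point. *)
Lemma no_common_kernel A1 A2 A3 x y z :
  smooth A1 -> ~ proportional A1 A2 -> ~ [/\ x = 0, y = 0 & z = 0] ->
  qf A1 x y z = 0 -> qf A2 x y z = 0 -> qf A3 x y z != 0 ->
  ~ (forall u v w, det3 (gx A1 u v w) (gy A1 u v w) (gz A1 u v w)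
       (gx A2 u v w) (gy A2 u v w) (gz A2 u v w)
       (gx A3 u v w) (gy A3 u v w) (gz A3 u v w) = 0).
Proof.
move=> sm nprop nzP q1 q2 q3 hdet.
rewrite !euler_conic in q1 q2 q3.
have q1' : gx A1 x y z * x + gy A1 x y z * y + gz A1 x y z * z = 0 by rewrite -[RHS]q1; ring.
have q2' : gx A2 x y z * x + gy A2 x y z * y + gz A2 x y z * z = 0 by rewrite -[RHS]q2; ring.
have n1 : ~ [/\ gx A1 x y z = 0, gy A1 x y z = 0 & gz A1 x y z = 0].
  by case=> h1 h2 h3; apply: nzP; apply: sm.
have [k [k1 k2 k3]] := parallelP (perp_det q1' q2' q3 (hdet x y z)) n1.
(* The member of the pencil of A1 and A2 that is singular at the point; the determinant does not
   change when A2 is replaced by it. *)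
pose B := subc A2 k A1.
have Bx u v w : gx B u v w = gx A2 u v w - k * gx A1 u v w by rewrite /gx /B /subc /=; ring.
have By u v w : gy B u v w = gy A2 u v w - k * gy A1 u v w by rewrite /gy /B /subc /=; ring.
have Bz u v w : gz B u v w = gz A2 u v w - k * gz A1 u v w by rewrite /gz /B /subc /=; ring.
have P1 : gx B x y z = 0 by rewrite Bx k1 subrr.
have P2 : gy B x y z = 0 by rewrite By k2 subrr.
have P3 : gz B x y z = 0 by rewrite Bz k3 subrr.
have hdetB u v w : det3 (gx A1 u v w) (gy A1 u v w) (gz A1 u v w)
       (gx B u v w) (gy B u v w) (gz B u v w)
       (gx A3 u v w) (gy A3 u v w) (gz A3 u v w) = 0.
  by rewrite -[RHS](hdet u v w) Bx By Bz /det3; ring.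
have lx A t u v w : gx A (x + t * u) (y + t * v) (z + t * w) = gx A x y z + t * gx A u v w.
  by rewrite /gx; ring.
have ly A t u v w : gy A (x + t * u) (y + t * v) (z + t * w) = gy A x y z + t * gy A u v w.
  by rewrite /gy; ring.
have lz A t u v w : gz A (x + t * u) (y + t * v) (z + t * w) = gz A x y z + t * gz A u v w.
  by rewrite /gz; ring.
(* The coefficients of t and t^2 of the determinant at P + t (u, v, w), with P = (x, y, z); the
   gradient of B vanishes at P, so there is no constant term. *)
have D u v w :
    det3 (gx A1 x y z) (gy A1 x y z) (gz A1 x y z) (gx B u v w) (gy B u v w) (gz B u v w)
      (gx A3 x y z) (gy A3 x y z) (gz A3 x y z) = 0 /\
    det3 (gx A1 u v w) (gy A1 u v w) (gz A1 u v w) (gx B u v w) (gy B u v w) (gz B u v w)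
      (gx A3 x y z) (gy A3 x y z) (gz A3 x y z) +
    det3 (gx A1 x y z) (gy A1 x y z) (gz A1 x y z) (gx B u v w) (gy B u v w) (gz B u v w)
      (gx A3 u v w) (gy A3 u v w) (gz A3 u v w) = 0.
  apply: (@cubic_coefs _ _ (det3 (gx A1 u v w) (gy A1 u v w) (gz A1 u v w)
    (gx B u v w) (gy B u v w) (gz B u v w) (gx A3 u v w) (gy A3 u v w) (gz A3 u v w))) => t.
  rewrite -[RHS](hdetB (x + t * u) (y + t * v) (z + t * w)) !lx !ly !lz P1 P2 P3 /det3; ring.
(* By the symmetry of B all its gradients are orthogonal to the point, and the coefficient of t
   makes them parallel to the gradient of A1 there: B is a double tangent line or zero. *)
have par u v w : exists b, [/\ gx B u v w = b * gx A1 x y z, gy B u v w = b * gy A1 x y z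
    & gz B u v w = b * gz A1 x y z].
  apply: parallelP n1; apply: (perp_det q1' _ q3 (D u v w).1).
  transitivity (u * gx B x y z + v * gy B x y z + w * gz B x y z); first by rewrite /gx /gy /gz; ring.
  by rewrite P1 P2 P3 !mulr0 !addr0.
pose g u v w := det3 (gx A1 x y z) (gy A1 x y z) (gz A1 x y z)
   (gx A3 x y z) (gy A3 x y z) (gz A3 x y z) (gx A1 u v w) (gy A1 u v w) (gz A1 u v w).
have gB u v w : ~ [/\ gx B u v w = 0, gy B u v w = 0 & gz B u v w = 0] -> g u v w = 0.
  have [b [b1 b2 b3]] := par u v w; rewrite b1 b2 b3 => nb.
  have b0 : b != 0 by apply/eqP => b0; apply: nb; rewrite b0 !mul0r.
  apply: (mulfI b0); rewrite mulr0 -[RHS](D u v w).2 b1 b2 b3 /g /det3; ring.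
have [[[u0 v0] w0] nB0] : exists t : K * K * K,
    ~ [/\ gx B t.1.1 t.1.2 t.2 = 0, gy B t.1.1 t.1.2 t.2 = 0 & gz B t.1.1 t.1.2 t.2 = 0].
  apply: contrapT => hB; apply: nprop; exists k => u v w.
  apply/eqP; rewrite -subr_eq0; apply/eqP.
  transitivity (qf B u v w); first by rewrite /qf /B /subc /=; ring.
  rewrite euler_conic; have [-> -> ->] : [/\ gx B u v w = 0, gy B u v w = 0 & gz B u v w = 0].
    by apply: contrapT => h; apply: hB; exists (u, v, w).
  by rewrite !mulr0 !addr0.
rewrite /= in nB0.
(* [g] is linear and vanishes outside the kernel of B; adding a vector outside the kernel reaches
   the remaining points. *)
have g0 u v w : g u v w = 0.
  have [hB|hB] := pselect [/\ gx B u v w = 0, gy B u v w = 0 & gz B u v w = 0]; last exact: gB.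
  case: hB => h1 h2 h3.
  have e : g (u + u0) (v + v0) (w + w0) = g u v w + g u0 v0 w0.
    by rewrite /g /det3 /gx /gy /gz; ring.
  rewrite gB in e; first by rewrite (gB _ _ _ nB0) addr0 in e.
  case=> h1' h2' h3'; apply: nB0; split.
  - by rewrite -[RHS]h1' -[LHS]add0r -{1}h1 /gx; ring.
  - by rewrite -[RHS]h2' -[LHS]add0r -{1}h2 /gy; ring.
  - by rewrite -[RHS]h3' -[LHS]add0r -{1}h3 /gz; ring.
(* The cross product c of the gradients of A1 and A3 at the point is orthogonal to every gradient of
   A1. By symmetry the gradient of A1 at c is zero, so c = 0 by smoothness. *)
pose c1 := gy A1 x y z * gz A3 x y z - gz A1 x y z * gy A3 x y z.
pose c2 := gz A1 x y z * gx A3 x y z - gx A1 x y z * gz A3 x y z.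
pose c3 := gx A1 x y z * gy A3 x y z - gy A1 x y z * gx A3 x y z.
have [e1 e2 e3] : [/\ c1 = 0, c2 = 0 & c3 = 0].
  apply: sm.
  - by rewrite -[RHS](g0 1 0 0) /g /det3 -/c1 -/c2 -/c3; move: c1 c2 c3 => *; rewrite /gx /gy /gz; ring.
  - by rewrite -[RHS](g0 0 1 0) /g /det3 -/c1 -/c2 -/c3; move: c1 c2 c3 => *; rewrite /gx /gy /gz; ring.
  - by rewrite -[RHS](g0 0 0 1) /g /det3 -/c1 -/c2 -/c3; move: c1 c2 c3 => *; rewrite /gx /gy /gz; ring.
have [l [l1 l2 l3]] : exists l, [/\ gx A3 x y z = l * gx A1 x y z, gy A3 x y z = l * gy A1 x y z
    & gz A3 x y z = l * gz A1 x y z].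
  by apply: parallelP n1; rewrite -/c1 -/c2 -/c3 e1 e2 e3 eqxx.
move: q3; rewrite l1 l2 l3 => /eqP; apply.
transitivity (l * (x * gx A1 x y z + y * gy A1 x y z + z * gz A1 x y z)); first by ring.
by rewrite q1 mulr0.
Qed.

End CommonKernel.

Lemma poly_nonroot (K : numFieldType) (p : {poly K}) : p != 0 -> exists n : nat, p.[n%:R] != 0.
Proof.
move=> p0; apply: contrapT => h.
have hr n : root p n%:R by rewrite rootE; apply/negPn/negP => hn; apply: h; exists n.
have := max_poly_roots (rs := [seq n%:R | n <- iota 0 (size p)]) p0.
rewrite size_map size_iota ltnn => hh; apply: notF; apply: hh.
  by apply/allP => _ /mapP[n _ ->].
by rewrite map_inj_uniq ?iota_uniq // => m n /eqP; rewrite eqr_nat => /eqP.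
Qed.

Lemma two_zeros (K : idomainType) (a b z1 z2 : K) :
  z1 - z2 != 0 -> a * z1 + b = 0 -> a * z2 + b = 0 -> a = 0.
Proof.
move=> z12 e1 e2; apply: (mulIf z12).
by rewrite mul0r mulrBr -[a * z1](addrK b) e1 -[a * z2](addrK b) e2 subrr.
Qed.

Lemma derM_eval (K : comNzRingType) (th : 'I_3 -> {mpoly K[3]}) (P A : {mpoly K[3]}) v :
  (der th (P * A)).@[v] = (der th P).@[v] * A.@[v] + P.@[v] * (der th A).@[v].
Proof. by rewrite derM mevalD !mevalM. Qed.

(** * Division by a conic and the existence of the cofactors *)

Section DivisionByConic.
Variable R : realType.
Local Notation C := R[i].
Local Notation mpoly3 := {mpoly C[3]}.
Implicit Types P A : mpoly3.

(** Independence of z is expressed by values, which [mpoly_eq0] later converts into identities of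
    polynomials. *)
Definition no_z P := forall x y z, P.@[pt x y z] = P.@[pt x y 0].

Lemma no_zD P A : no_z P -> no_z A -> no_z (P + A).
Proof. by move=> h1 h2 x y z; rewrite !mevalD h1 h2. Qed.

Lemma no_zM P A : no_z P -> no_z A -> no_z (P * A).
Proof. by move=> h1 h2 x y z; rewrite !mevalM h1 h2. Qed.

Lemma no_zZ c P : no_z P -> no_z (c *: P).
Proof. by move=> h x y z; rewrite !mevalZ h. Qed.

Lemma no_zC c : no_z c%:MP.
Proof. by move=> x y z; rewrite !mevalC. Qed.

Lemma no_z_x : no_z 'X_o0.
Proof. by move=> x y z; rewrite !mevalXU. Qed.

Lemma no_z_y : no_z 'X_o1.
Proof. by move=> x y z; rewrite !mevalXU. Qed.

Section Division.
Variable q : mpoly3.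
Hypothesis hq : q \is 2.-homog.
Let Q := conic_of q.
Hypothesis c0 : cc Q != 0.

Let l : mpoly3 := (2 * ce Q) *: 'X_o0 + (2 * cf Q) *: 'X_o1.
Let m : mpoly3 := ca Q *: ('X_o0 * 'X_o0) + cb Q *: ('X_o1 * 'X_o1) + (2 * cd Q) *: ('X_o0 * 'X_o1).

Lemma linear_eval (a b : C) x y z :
  (a *: 'X_o0 + b *: 'X_o1 : mpoly3).@[pt x y z] = a * x + b * y.
Proof. by rewrite mevalD !mevalZ !mevalXU. Qed.

Lemma quadratic_eval (a b d : C) x y z :
  (a *: ('X_o0 * 'X_o0) + b *: ('X_o1 * 'X_o1) + d *: ('X_o0 * 'X_o1) : mpoly3).@[pt x y z] =
  a * (x * x) + b * (y * y) + d * (x * y).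
Proof. by rewrite 2!mevalD !mevalZ !mevalM !mevalXU. Qed.

Lemma vertical_eval (a : C) (u v : mpoly3) x y z :
  (a *: ('X_o2 * 'X_o2) + u * 'X_o2 + v).@[pt x y z] = a * (z * z) + u.@[pt x y z] * z + v.@[pt x y z].
Proof. by rewrite 2!mevalD mevalZ !mevalM !mevalXU. Qed.

Lemma conic_mpoly : q = cc Q *: ('X_o2 * 'X_o2) + l * 'X_o2 + m.
Proof.
apply/eqP; rewrite -subr_eq0; apply/eqP/mpoly_eq0 => x y z.
rewrite mevalB conic_of_qf // vertical_eval linear_eval quadratic_eval -/Q /qf; ring.
Qed.

(** Division by q with respect to z is possible because the coefficient of z^2 is a nonzero
    constant. *)
Lemma z_division P : exists A R1 R0, [/\ no_z R1, no_z R0 & P = A * q + (R1 * 'X_o2 + R0)].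
Proof.
have n0 : no_z 0 by rewrite -mpolyC0; apply: no_zC.
have nl : no_z l by apply: no_zD; apply: no_zZ; [apply: no_z_x|apply: no_z_y].
have nm : no_z m.
  by apply: no_zD; [apply: no_zD|]; apply: no_zZ; apply: no_zM; (apply: no_z_x || apply: no_z_y).
elim/mpoly_alg_ind: P => [c|P P' [A [R1 [R0 [h1 h0 ->]]]] [A' [R1' [R0' [h1' h0' ->]]]]|P i [A [R1 [R0 [h1 h0 ->]]]]].
- exists 0, 0, c%:MP; split=> //; first exact: no_zC.
  by rewrite !mul0r !add0r.
- exists (A + A'), (R1 + R1'), (R0 + R0'); split; [exact: no_zD|exact: no_zD|ring].
- have xy i' : no_z 'X_i' -> exists A0 R10 R00, [/\ no_z R10, no_z R00 &
      (A * q + (R1 * 'X_o2 + R0)) * 'X_i' = A0 * q + (R10 * 'X_o2 + R00)].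
    move=> hi; exists (A * 'X_i'), (R1 * 'X_i'), (R0 * 'X_i').
    by split; [exact: no_zM|exact: no_zM|ring].
  elim/ord3P: i; [exact: xy no_z_x|exact: xy no_z_y|].
  pose k : mpoly3 := (cc Q)^-1%:MP.
  have nk : no_z k by exact: no_zC.
  have e : 'X_o2 * 'X_o2 = k * (q - l * 'X_o2 - m).
    rewrite [in RHS]conic_mpoly; have -> : cc Q *: ('X_o2 * 'X_o2) = (cc Q)%:MP * ('X_o2 * 'X_o2) :> mpoly3.
      by rewrite mul_mpolyC.
    have -> : k * ((cc Q)%:MP * ('X_o2 * 'X_o2) + l * 'X_o2 + m - l * 'X_o2 - m) =
      (k * (cc Q)%:MP) * ('X_o2 * 'X_o2) by ring.
    by rewrite -mpolyCM mulVf // mpolyC1 mul1r.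
  have nN P0 : no_z P0 -> no_z (- P0) by rewrite -scaleN1r; apply: no_zZ.
  exists (A * 'X_o2 + k * R1), (R0 - k * (R1 * l)), (- (k * (R1 * m))).
  split; [apply: no_zD => //; apply: nN|apply: nN|].
  + by do 2! apply: no_zM => //.
  + by do 2! apply: no_zM => //.
  have -> : (A * q + (R1 * 'X_o2 + R0)) * 'X_o2 = A * 'X_o2 * q + R1 * ('X_o2 * 'X_o2) + R0 * 'X_o2 by ring.
  rewrite e; ring.
Qed.

End Division.

Lemma meval_line P (x y a b : C) : exists p : {poly C}, forall t,
  p.[t] = P.@[pt (x + t * a) (y + t * b) 0].
Proof.
elim/mpoly_alg_ind: P => [c|P P' [p hp] [p' hp']|P i [p hp]].
- by exists c%:P => t; rewrite hornerC mevalC.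
- by exists (p + p') => t; rewrite hornerD mevalD hp hp'.
have hX (g : {poly C}) : (forall t, g.[t] = ('X_i : mpoly3).@[pt (x + t * a) (y + t * b) 0]) ->
    exists p : {poly C}, forall t, p.[t] = (P * 'X_i).@[pt (x + t * a) (y + t * b) 0].
  by move=> hg; exists (p * g) => t; rewrite hornerM mevalM hp hg.
elim/ord3P: i hX => hX.
- by apply: (hX (x%:P + a *: 'X)) => t; rewrite !hornerE mevalXU /pt /= mulrC.
- by apply: (hX (y%:P + b *: 'X)) => t; rewrite !hornerE mevalXU /pt /= mulrC.
- by apply: (hX 0) => t; rewrite !hornerE mevalXU.
Qed.

Lemma exists_off_lines (s : seq (C * C)) : all (fun u => u != (0, 0)) s ->
  exists a b, \prod_(u <- s) lam u a b != 0.
Proof.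
move=> hs; have [|n hn] := @poly_nonroot _ (\prod_(u <- s) (u.1%:P + u.2 *: 'X) : {poly C}).
  rewrite prodf_seq_neq0; apply/allP => u us; apply/implyP => _.
  apply: contraNneq (allP hs u us) => e0; apply/eqP.
  have e1 := congr1 (fun p : {poly C} => p`_0) e0; have e2 := congr1 (fun p : {poly C} => p`_1) e0.
  move: e1 e2; rewrite !coefD !coefC !coefZ !coefX /= mulr0 mulr1 addr0 add0r.
  by case: u {us e0} => u1 u2 /= -> ->.
exists 1, n%:R; move: hn; rewrite horner_prod; congr (_ != 0); apply: eq_bigr => u _.
by rewrite !hornerE /lam mulr1.
Qed.

(** Join (x, y) to infinity along a direction (a, b) on none of the lines. On this parametrized line
    P times the product of the forms vanishes at all natural numbers, and the product is a nonzero
    polynomial, so P vanishes. *)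
Lemma vanish_off_lines P (s : seq (C * C)) : all (fun u => u != (0, 0)) s ->
  (forall x y, \prod_(u <- s) lam u x y != 0 -> P.@[pt x y 0] = 0) ->
  forall x y, P.@[pt x y 0] = 0.
Proof.
move=> hs hP x y; have [a [b hab]] := exists_off_lines hs.
have [p hp] := meval_line P x y a b.
pose h : {poly C} := \prod_(u <- s) ((lam u x y)%:P + (lam u a b) *: 'X).
have hh t : h.[t] = \prod_(u <- s) lam u (x + t * a) (y + t * b).
  rewrite horner_prod; apply: eq_bigr => u _; rewrite !hornerE /lam; ring.
have h0 : h != 0.
  rewrite prodf_seq_neq0; apply/allP => u us; apply/implyP => _.
  apply: contraNneq hab => e0.
  have := congr1 (fun p : {poly C} => p`_1) e0; rewrite coefD coefC coefZ coefX /= mulr1 add0r coef0 => e1.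
  by rewrite prodf_seq_eq0; apply/hasP; exists u => //=; apply/eqP.
have : p * h == 0.
  apply: contraT => /poly_nonroot [n]; rewrite hornerM hp hh.
  set w := \prod_(u <- s) _; have [->|nw] := eqVneq w 0; first by rewrite mulr0 eqxx.
  by rewrite (hP _ _ nw) mul0r eqxx.
rewrite mulf_eq0 (negbTE h0) orbF => /eqP p0.
by have := hp 0; rewrite p0 horner0 !mul0r !addr0.
Qed.

(** Over a general (x, y) the conic has two distinct roots z, and the remainder of degree at most
    one in z vanishes at both. So the remainder is zero. *)
Lemma dvd_of_vanishing (q P : mpoly3) (s : seq (C * C)) : q \is 2.-homog ->
  cc (conic_of q) != 0 -> all (fun u => u != (0, 0)) s ->
  (forall x y, \prod_(u <- s) lam u x y != 0 ->
     disc (conic_of q) x y != 0 /\ forall z, q.@[pt x y z] = 0 -> P.@[pt x y z] = 0) ->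
  exists A, P = A * q.
Proof.
move=> hq c0 hs hP; have [A [R1 [R0 [h1 h0 eP]]]] := z_division hq c0 P.
have hv x y : \prod_(u <- s) lam u x y != 0 -> R1.@[pt x y 0] = 0 /\ R0.@[pt x y 0] = 0.
  case/hP => hd hz; have [z1 [z2 [el em]]] := conic_roots x y c0.
  have ev z : q.@[pt x y z] = 0 -> R1.@[pt x y 0] * z + R0.@[pt x y 0] = 0.
    move=> qz; have := hz z qz; rewrite eP mevalD mevalM qz mulr0 add0r mevalD mevalM mevalXU.
    by rewrite h1 h0.
  have q1 : q.@[pt x y z1] = 0 by rewrite conic_of_qf // (qf_factor _ el em) subrr mulr0 mul0r.
  have q2 : q.@[pt x y z2] = 0 by rewrite conic_of_qf // (qf_factor _ el em) subrr mulr0.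
  have z12 : z1 - z2 != 0.
    by apply: contraNneq hd => e; rewrite (disc_factor el em) e expr0n mulr0.
  have e1 := ev _ q1; have e2 := ev _ q2.
  have r1 : R1.@[pt x y 0] = 0.
    exact: two_zeros z12 e1 e2.
  by split=> //; move: e1; rewrite r1 mul0r add0r.
have R1_0 : R1 = 0.
  apply: mpoly_eq0 => x y z; rewrite h1; apply: (vanish_off_lines hs) => {}x {}y hxy.
  by case: (hv x y hxy).
have R0_0 : R0 = 0.
  apply: mpoly_eq0 => x y z; rewrite h0; apply: (vanish_off_lines hs) => {}x {}y hxy.
  by case: (hv x y hxy).
by exists A; rewrite eP R1_0 R0_0 mul0r !addr0.
Qed.

(** By the Leibniz rule, at a point of q_j the value of theta q_j times the product of the other
    conics is zero. So theta q_j vanishes at every point of q_j on no other conic, and hence is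
    divisible by q_j. *)
Lemma eigen_exists (k m : nat) (q : 'I_k -> mpoly3) (th : 'I_3 -> mpoly3) :
  (forall i, q i \is 2.-homog) -> (forall i, cc (conic_of (q i)) != 0) ->
  (forall i, smooth (conic_of (q i))) ->
  (forall i j, i != j -> ~ proportional (conic_of (q i)) (conic_of (q j))) ->
  (forall i, th i \is m.+1.-homog) -> der th (\prod_i q i) = 0 ->
  exists L : 'I_k -> mpoly3, [/\ forall j, L j \is m.-homog,
    forall j, der th (q j) = L j * q j & \sum_j L j = 0].
Proof.
move=> hq hc hs hd hth hf.
have q0 j : q j != 0.
  apply: contraNneq (hc j) => e; rewrite /cc /conic_of /= /hess e !mderivC mcoeff0 mul0r //.
have [cR [sR hR]] := res_factoring hc hs hd.
have ex j : exists A, der th (q j) = A * q j.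
  have [c [s [c0 ss sn hs']]] := factor_of_form (disc_form (conic_of (q j))) (size_Poly _)
    (disc_neq0 (hc j) (hs j)).
  (* The lines of the discriminant of q_j and of its resultants with the other conics: outside them
     the roots in z are distinct and lie on no other conic. *)
  pose s' := s ++ flatten [seq sR j l | l <- enum 'I_k & j != l].
  apply: (@dvd_of_vanishing _ _ s') => // [|x y].
    rewrite all_cat sn /=; apply/allP => u /flattenP [_ /mapP[l hl ->]].
    by rewrite mem_filter in hl; case/andP: hl => jl _; have [_ _ h _] := hR j l jl; apply: (allP h).
  rewrite big_cat mulf_eq0 negb_or => /andP[d0 r0]; split; first by rewrite hs' mulf_neq0.
  move=> z qz; rewrite conic_of_qf // in qz.
  have eG : \prod_i q i = q j * \prod_(i | i != j) q i by rewrite (bigD1 j).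
  have := derM_eval th (q j) (\prod_(i | i != j) q i) (pt x y z).
  rewrite -eG hf meval0 (conic_of_qf (hq j)) qz mul0r addr0 => /esym/eqP.
  rewrite mulf_eq0 => /orP[/eqP //|]; rewrite rmorph_prod prodf_seq_eq0.
  move=> /hasP [l _ /andP[lj]] /=; rewrite (conic_of_qf (hq l)) => /eqP qlz.
  have jl : j != l by rewrite eq_sym.
  have [cR0 _ _ hRl] := hR j l jl.
  have : res (conic_of (q j)) (conic_of (q l)) x y == 0 by rewrite (res_common qz qlz).
  rewrite hRl mulf_eq0 (negbTE cR0) /= => /eqP e.
  move: r0; rewrite big_flatten prodf_seq_eq0 /= => /hasPn /(_ (sR j l)).
  have hin : sR j l \in [seq sR j l' | l' <- enum 'I_k & j != l'].
    by apply: map_f; rewrite mem_filter jl mem_enum.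
  by move=> /(_ hin); rewrite e eqxx.
have [L hL] := choice ex.
exists L; split=> // [j|].
  apply: (homog_of_mul (hq j) (q0 j)); rewrite -hL addn2.
  by apply: rpred_sum => i _; rewrite -[m.+2]addn1 dhomogM ?mderiv_homog.
have := der_prod_eigen (index_enum 'I_k) hL; rewrite hf => /esym/eqP.
rewrite mulf_eq0 => /orP[/eqP //|]; rewrite prodf_seq_eq0 => /hasP [l _].
by rewrite (negbTE (q0 l)) andbF.
Qed.

End DivisionByConic.

Lemma det3_eval (K : comNzRingType) (a1 a2 a3 b1 b2 b3 c1 c2 c3 : {mpoly K[3]}) v :
  (det3 a1 a2 a3 b1 b2 b3 c1 c2 c3).@[v] = det3 a1.@[v] a2.@[v] a3.@[v] b1.@[v] b2.@[v] b3.@[v]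
    c1.@[v] c2.@[v] c3.@[v].
Proof. by rewrite /det3 2!mevalD !mevalM !mevalB !mevalM. Qed.

Lemma det3_scale (K : comNzRingType) (a1 a2 a3 b1 b2 b3 c1 c2 c3 : K) :
  8 * det3 a1 a2 a3 b1 b2 b3 c1 c2 c3 =
  det3 (2 * a1) (2 * a2) (2 * a3) (2 * b1) (2 * b2) (2 * b3) (2 * c1) (2 * c2) (2 * c3).
Proof. by rewrite /det3; ring. Qed.

(** * The contradiction in general coordinates *)

Section Arrangements.
Variable R : realType.
Local Notation C := R[i].
Local Notation mpoly3 := {mpoly C[3]}.

Definition independent_triples (k : nat) (Q : 'I_k -> conic C) : Prop :=
  forall i j l x y z, uniq [:: i; j; l] ->
    qf (Q i) x y z = 0 -> qf (Q j) x y z = 0 -> qf (Q l) x y z = 0 ->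
    [&& gy (Q i) x y z * gz (Q j) x y z - gz (Q i) x y z * gy (Q j) x y z == 0,
        gz (Q i) x y z * gx (Q j) x y z - gx (Q i) x y z * gz (Q j) x y z == 0 &
        gx (Q i) x y z * gy (Q j) x y z - gy (Q i) x y z * gx (Q j) x y z == 0] ->
    [/\ x = 0, y = 0 & z = 0].

(** The hypotheses invariant under linear coordinate changes. The conditions that depend on the
    projection along z are kept apart, since coordinates are chosen afterwards. *)
Record annihilated (k m : nat) (q : 'I_k -> mpoly3) (th : 'I_3 -> mpoly3) : Prop := Annihilated {
  an_homog : forall i, q i \is 2.-homog;
  an_smooth : forall i, smooth (conic_of (q i));
  an_distinct : forall i j, i != j -> ~ proportional (conic_of (q i)) (conic_of (q j));
  an_four : no_four_concurrent (fun i => conic_of (q i));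
  an_triple : independent_triples (fun i => conic_of (q i));
  an_th_homog : forall i, th i \is m.+1.-homog;
  an_th_neq0 : exists i, th i != 0;
  an_der : der th (\prod_i q i) = 0 }.

Section GenericPosition.
Variables (k m : nat) (q : 'I_k -> mpoly3) (th : 'I_3 -> mpoly3).
Hypothesis k5 : (5 <= k)%N.
Hypothesis mk : (m + 3 <= k + 1)%N.
Hypothesis han : annihilated m q th.
Let Q i := conic_of (q i).
Hypothesis Q_cc : forall i, cc (Q i) != 0.

(** The resultant vanishes along any of its linear factors, and over such (x, y) two conics with
    nonzero coefficients of z^2 have a common root. *)
Lemma exists_common i j : i != j -> exists x y z,
  [/\ ~ [/\ x = 0, y = 0 & z = 0], qf (Q i) x y z = 0 & qf (Q j) x y z = 0].
Proof.
move=> ij; have [cR [sR hR]] := res_factoring Q_cc (an_smooth han) (an_distinct han).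
have [_ ss sn hs] := hR i j ij.
case: (sR i j) ss sn hs => // u s _ /andP[u0 _] hs.
have r0 : res (Q i) (Q j) u.2 (- u.1) = 0.
  rewrite hs big_cons /lam; have -> : u.1 * u.2 + u.2 * - u.1 = 0 by ring.
  by rewrite mul0r mulr0.
have [z [h1 h2]] := common_of_res (Q_cc i) (Q_cc j) r0.
exists u.2, (- u.1), z; split=> // -[e2 /eqP e1 _].
move: u0; rewrite oppr_eq0 in e1; case: u e1 e2 {hs r0 h1 h2} => u1 u2 /= /eqP -> ->.
by rewrite eqxx.
Qed.

Hypothesis Q_vertical : no_vertical_tangent Q.
Hypothesis Q_triple : simple_triple_points Q.
Hypothesis Q_top : forall i x y z, nsq x <= 4 -> nsq y <= 4 -> 1 <= nsq z ->
  1 <= nsq (qf (Q i) x y z).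

Lemma der_eq0 j : der th (q j) = 0.
Proof.
have hq := an_homog han; have hth := an_th_homog han.
have [L [hL hLq sL]] := eigen_exists hq Q_cc (an_smooth han) (an_distinct han) hth (an_der han).
have vol := volume_estimate Q_cc (an_smooth han) (an_distinct han) (an_four han) Q_vertical Q_triple Q_top.
have hev i x y z : (q i).@[pt x y z] = qf (Q i) x y z by exact: conic_of_qf.
by rewrite hLq (eigenvalues_eq0 k5 mk hq hev vol hth hL hLq sL) mul0r.
Qed.

Lemma det_gradients i j l x y z :
  det3 (gx (Q i) x y z) (gy (Q i) x y z) (gz (Q i) x y z)
       (gx (Q j) x y z) (gy (Q j) x y z) (gz (Q j) x y z)
       (gx (Q l) x y z) (gy (Q l) x y z) (gz (Q l) x y z) = 0.
Proof.
pose d a b : mpoly3 := mderiv b (q a).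
have hd a : th o0 * d a o0 + th o1 * d a o1 + th o2 * d a o2 = 0.
  by rewrite -[RHS](der_eq0 a) /der big_ord3 /= addrA.
have [h0 h1 h2] := kernel_det3 (hd i) (hd j) (hd l).
set D := det3 _ _ _ _ _ _ _ _ _ in h0 h1 h2.
have D0 : D = 0.
  have [b] := an_th_neq0 han.
  have hb : th b * D = 0 by elim/ord3P: b.
  by move=> /negbTE nz; move/eqP: hb; rewrite mulf_eq0 nz => /eqP.
have n8 : 8 != 0 :> C by rewrite pnatr_eq0.
apply: (mulfI n8); rewrite mulr0; have e : D.@[pt x y z] = 0 by rewrite D0 meval0.
rewrite -[RHS]e /D det3_eval /d.
have hq a := an_homog han a.
have ex a := conic_of_gx (hq a) x y z; have ey a := conic_of_gy (hq a) x y z.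
have ez a := conic_of_gz (hq a) x y z.
rewrite det3_scale; congr det3; apply/esym;
  [exact: ex|exact: ey|exact: ez|exact: ex|exact: ey|exact: ez|exact: ex|exact: ey|exact: ez].
Qed.

Lemma generic_contradiction : False.
Proof.
have k0 : (0 < k)%N by lia.
pose a n (h : (n < 5)%N) : 'I_k := Ordinal (leq_trans h k5).
have [x [y [z [nz h0 h1]]]] := @exists_common (a 0 isT) (a 1 isT) isT.
have [l ql] : exists l, qf (Q l) x y z != 0.
  apply: contrapT => h; apply: nz.
  have hz l : qf (Q l) x y z = 0 by apply/eqP; apply: contrapT => hl; apply: h; exists l; apply/negP.
  have u : uniq [:: a 0%N isT; a 1%N isT; a 2%N isT; a 3%N isT] by [].
  have h4 := an_four han.
  exact: (h4 _ _ _ _ x y z u (hz _) (hz _) (hz _) (hz _)).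
apply: (@no_common_kernel _ (Q (a 0 isT)) (Q (a 1 isT)) (Q l) x y z) => //.
- by have sm := an_smooth han; exact: sm.
- by have ds := an_distinct han; exact: (ds (a 0%N isT) (a 1%N isT) isT).
- move=> u v w; exact: det_gradients.
Qed.

End GenericPosition.

End Arrangements.

Lemma cross_scale (K : numFieldType) (a1 a2 a3 b1 b2 b3 a1' a2' a3' b1' b2' b3' : K) :
  a1 = 2 * a1' -> a2 = 2 * a2' -> a3 = 2 * a3' -> b1 = 2 * b1' -> b2 = 2 * b2' -> b3 = 2 * b3' ->
  [/\ a2 * b3 - a3 * b2 = 0, a3 * b1 - a1 * b3 = 0 & a1 * b2 - a2 * b1 = 0] <->
  [&& a2' * b3' - a3' * b2' == 0, a3' * b1' - a1' * b3' == 0 & a1' * b2' - a2' * b1' == 0].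
Proof.
move=> -> -> -> -> -> ->.
have n4 : 4 != 0 :> K by rewrite pnatr_eq0.
have e (a b c d : K) : 2 * a * (2 * b) - 2 * c * (2 * d) = 4 * (a * b - c * d) by ring.
rewrite !e; split=> [[h1 h2 h3]|/and3P[/eqP -> /eqP -> /eqP ->]]; last by rewrite mulr0.
by apply/and3P; split; apply/eqP; apply: (mulfI n4); rewrite mulr0.
Qed.

(** * Invariance under linear coordinate changes *)

Section TransportArrangement.
Variable R : realType.
Local Notation C := R[i].
Local Notation mpoly3 := {mpoly C[3]}.

Lemma meval_pt (P : mpoly3) (v : 'I_3 -> C) : P.@[v] = P.@[pt (v o0) (v o1) (v o2)].
Proof. by apply: meval_eq; elim/ord3P. Qed.

Lemma smooth_gradP (q : mpoly3) : q \is 2.-homog ->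
  smooth (conic_of q) <-> forall v, (forall i, (mderiv i q).@[v] = 0) -> forall i, v i = 0.
Proof.
move=> hq; have n2 : 2 != 0 :> C by rewrite pnatr_eq0.
split=> [sm v hv|h x y z hx hy hz].
  have e (a : C) : 2 * a = 0 -> a = 0 by move/eqP; rewrite mulf_eq0 (negbTE n2) => /eqP.
  have hv' i : (mderiv i q).@[pt (v o0) (v o1) (v o2)] = 0 by rewrite -meval_pt; exact: hv.
  have e0 := etrans (esym (conic_of_gx hq (v o0) (v o1) (v o2))) (hv' o0).
  have e1 := etrans (esym (conic_of_gy hq (v o0) (v o1) (v o2))) (hv' o1).
  have e2 := etrans (esym (conic_of_gz hq (v o0) (v o1) (v o2))) (hv' o2).
  have [v0 v1 v2] := sm _ _ _ (e _ e0) (e _ e1) (e _ e2).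
  by elim/ord3P.
have {}h : forall i, pt x y z i = 0.
  apply: h; elim/ord3P.
  - by apply: etrans (conic_of_gx hq x y z) _; rewrite hx mulr0.
  - by apply: etrans (conic_of_gy hq x y z) _; rewrite hy mulr0.
  - by apply: etrans (conic_of_gz hq x y z) _; rewrite hz mulr0.
by split; [exact: h o0|exact: h o1|exact: h o2].
Qed.

(** By Cauchy-Binet the 2x2 minors of the images are combinations of the minors of a and b. *)
Lemma parallel_mul (M : 'M[C]_3) (a b a' b' : 'I_3 -> C) :
  (forall i, a' i = \sum_(l < 3) M l i * a l) -> (forall i, b' i = \sum_(l < 3) M l i * b l) ->
  a o1 * b o2 - a o2 * b o1 = 0 -> a o2 * b o0 - a o0 * b o2 = 0 -> a o0 * b o1 - a o1 * b o0 = 0 ->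
  forall i j, a' i * b' j - a' j * b' i = 0.
Proof.
move=> ha hb h0 h1 h2 i j; rewrite !ha !hb !big_ord3 /=.
transitivity ((M o1 i * M o2 j - M o2 i * M o1 j) * (a o1 * b o2 - a o2 * b o1) +
   (M o2 i * M o0 j - M o0 i * M o2 j) * (a o2 * b o0 - a o0 * b o2) +
   (M o0 i * M o1 j - M o1 i * M o0 j) * (a o0 * b o1 - a o1 * b o0)); first by ring.
by rewrite h0 h1 h2 !mulr0 !addr0.
Qed.

Variables (T T' : 'M[C]_3).
Hypothesis TT' : T *m T' = 1%:M.

Lemma grad_sub (q : mpoly3) i v :
  (mderiv i (sub T q)).@[v] = \sum_(l < 3) T l i * (mderiv l q).@[act T v].
Proof.
by rewrite mderiv_sub raddf_sum; apply: eq_bigr => l _ /=; rewrite mevalZ sub_eval.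
Qed.

Lemma grad_unsub (q : mpoly3) l v :
  (mderiv l q).@[act T v] = \sum_(i < 3) T' i l * (mderiv i (sub T q)).@[v].
Proof.
transitivity (\sum_(m < 3) (T *m T') m l * (mderiv m q).@[act T v]).
  rewrite TT' (bigD1 l) //= mxE eqxx mul1r big1 ?addr0 // => m ml.
  by rewrite mxE (negbTE ml) mul0r.
under [RHS]eq_bigr => i _ do rewrite grad_sub mulr_sumr.
rewrite exchange_big; apply: eq_bigr => m _ /=; rewrite mxE mulr_suml.
by apply: eq_bigr => i _; rewrite mulrCA mulrA.
Qed.

Lemma act_inj v : (forall i, act T v i = 0) -> forall i, v i = 0.
Proof.
move=> h i; rewrite -(act1 v i) -(mulmx1C TT') -actE /act big1 // => j _.
by rewrite -/(act T v j) h mulr0.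
Qed.

Lemma act_surj v i : act T (act T' v) i = v i.
Proof. by rewrite actE TT' act1. Qed.

Lemma conic_sub_qf (q : mpoly3) x y z : q \is 2.-homog ->
  qf (conic_of (sub T q)) x y z =
  qf (conic_of q) (act T (pt x y z) o0) (act T (pt x y z) o1) (act T (pt x y z) o2).
Proof.
move=> hq; have e1 := conic_of_qf (dhomog_sub T hq) x y z.
set v := act T (pt x y z); have e2 := conic_of_qf hq (v o0) (v o1) (v o2).
exact: etrans (esym e1) (etrans (sub_eval _ _ _) (etrans (meval_pt _ _) e2)).
Qed.

Lemma transport_annihilated k m (q : 'I_k -> mpoly3) th :
  annihilated m q th -> annihilated m (fun i => sub T (q i)) (transport T T' th).
Proof.
move=> [hq hs hd h4 h3 hth nth hder].
have hq' i : sub T (q i) \is 2.-homog by apply: dhomog_sub.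
have nzT x y z : [/\ act T (pt x y z) o0 = 0, act T (pt x y z) o1 = 0 & act T (pt x y z) o2 = 0] ->
    [/\ x = 0, y = 0 & z = 0].
  case=> e0 e1 e2; have h : forall i, pt x y z i = 0 by apply: act_inj; elim/ord3P.
  by split; [exact: h o0|exact: h o1|exact: h o2].
apply: Annihilated; first exact: hq'.
- move=> i; apply/(smooth_gradP (hq' i)) => v hv; apply: act_inj.
  apply: ((smooth_gradP (hq i)).1 (hs i)) => l; rewrite grad_unsub big1 // => j _.
  by rewrite hv mulr0.
- move=> i j ij [c hc]; apply: (hd i j ij); exists c => x y z.
  pose w := act T' (pt x y z).
  have e (P : mpoly3) : P \is 2.-homog ->
      qf (conic_of (sub T P)) (w o0) (w o1) (w o2) = qf (conic_of P) x y z.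
    move=> hP; have e1 := conic_of_qf (dhomog_sub T hP) (w o0) (w o1) (w o2).
    have e2 : (sub T P).@[pt (w o0) (w o1) (w o2)] = P.@[pt x y z].
      by rewrite -meval_pt sub_eval; apply: meval_eq => l; apply: act_surj.
    exact: etrans (esym e1) (etrans e2 (conic_of_qf hP x y z)).
  exact: etrans (esym (e _ (hq j))) (etrans (hc (w o0) (w o1) (w o2)) (congr1 (fun t => c * t) (e _ (hq i)))).
- move=> i j l n x y z u e1 e2 e3 e4; apply: nzT.
  have e a : qf (conic_of (sub T (q a))) x y z = 0 -> _ = 0 := etrans (esym (conic_sub_qf x y z (hq a))).
  exact: h4 u (e _ e1) (e _ e2) (e _ e3) (e _ e4).
- move=> i j l x y z u e1' e2' e3' par.
  have e a : qf (conic_of (sub T (q a))) x y z = 0 -> _ = 0 := etrans (esym (conic_sub_qf x y z (hq a))).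
  have e1 := e _ e1'; have e2 := e _ e2'; have e3 := e _ e3'; apply: nzT.
  apply: (h3 i j l _ _ _ u e1 e2 e3).
  pose v := pt x y z; pose w := act T v.
  have gr (P : mpoly3) : P.@[w] = P.@[pt (w o0) (w o1) (w o2)] by exact: meval_pt.
  have [p0 p1 p2] := (cross_scale (conic_of_gx (hq' i) x y z) (conic_of_gy (hq' i) x y z)
    (conic_of_gz (hq' i) x y z) (conic_of_gx (hq' j) x y z) (conic_of_gy (hq' j) x y z)
    (conic_of_gz (hq' j) x y z)).2 par.
  have key := @parallel_mul T' (fun s => (mderiv s (sub T (q i))).@[v])
    (fun s => (mderiv s (sub T (q j))).@[v]) (fun s => (mderiv s (q i)).@[w])
    (fun s => (mderiv s (q j)).@[w]) (fun s => grad_unsub (q i) s v) (fun s => grad_unsub (q j) s v)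
    p0 p1 p2.
  apply: (cross_scale (etrans (gr _) (conic_of_gx (hq i) _ _ _)) (etrans (gr _) (conic_of_gy (hq i) _ _ _))
    (etrans (gr _) (conic_of_gz (hq i) _ _ _)) (etrans (gr _) (conic_of_gx (hq j) _ _ _))
    (etrans (gr _) (conic_of_gy (hq j) _ _ _)) (etrans (gr _) (conic_of_gz (hq j) _ _ _))).1.
  by split; apply: key.
- move=> i; apply: rpred_sum => j _; apply: dhomogZ; exact: dhomog_sub.
- apply: contrapT => h0; case: nth => j; apply/negP; rewrite negbK; apply/eqP.
  have t0 i : transport T T' th i = 0.
    by apply/eqP; apply: contrapT => h; apply: h0; exists i; apply/negP.
  have s0 : sub T (th j) = 0.
    transitivity (\sum_(l < 3) (T *m T') j l *: sub T (th l)).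
      rewrite TT' (bigD1 j) //= mxE eqxx scale1r big1 ?addr0 // => l lj.
      by rewrite mxE eq_sym (negbTE lj) scale0r.
    transitivity (\sum_(i < 3) T j i *: transport T T' th i); last first.
      by rewrite big1 // => i _; rewrite t0 scaler0.
    rewrite /transport; under [RHS]eq_bigr => i _ do rewrite scaler_sumr.
    rewrite exchange_big; apply: eq_bigr => l _ /=; rewrite mxE scaler_suml.
    by apply: eq_bigr => i _; rewrite scalerA.
  apply: mpoly_eq0 => x y z.
  rewrite -(meval_eq (th j) (act_surj (pt x y z))) -sub_eval s0; exact: meval0.
- have -> : \prod_i sub T (q i) = sub T (\prod_i q i) by rewrite /sub rmorph_prod.
  by rewrite der_transport // hder /sub comp_mpoly0.
Qed.

End TransportArrangement.

#[local] Opaque conic_of sub.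

(** * Shears that move the centre of projection *)

Section GenericCoordinates.
Variable R : realType.
Local Notation C := R[i].
Local Notation mpoly3 := {mpoly C[3]}.

Definition mx3 (K : nzRingType) (rows : seq (seq K)) : 'M[K]_3 :=
  \matrix_(i, j) nth 0 (nth [::] rows i) j.

(** Sends the centre of projection (0, 0, 1) to r (1, t, t^3). The parameter t is chosen to avoid
    finitely many conditions, and a large r makes the conics large wherever |z| >= 1. *)
Definition shear (t r : C) : 'M[C]_3 :=
  mx3 [:: [:: 0; 0; r]; [:: 1; 0; r * t]; [:: 0; 1; r * t ^+ 3]].
Definition unshear (t r : C) : 'M[C]_3 :=
  mx3 [:: [:: - t; 1; 0]; [:: - t ^+ 3; 0; 1]; [:: r^-1; 0; 0]].

Lemma shearK t r : r != 0 -> shear t r *m unshear t r = 1%:M.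
Proof.
move=> r0; apply/matrixP; elim/ord3P; elim/ord3P; rewrite !mxE big_ord3 /= !mxE /=.
all: by rewrite ?mulr1n ?mulr0n; field.
Qed.

Lemma act_shear t r x y z :
  [/\ act (shear t r) (pt x y z) o0 = r * z, act (shear t r) (pt x y z) o1 = x + r * t * z
    & act (shear t r) (pt x y z) o2 = y + r * t ^+ 3 * z].
Proof. by rewrite /act !big_ord3 /= !mxE /pt /=; split; ring. Qed.

Lemma shear_qf t r (q : mpoly3) x y z : q \is 2.-homog ->
  qf (conic_of (sub (shear t r) q)) x y z =
  qf (conic_of q) (r * z) (x + r * t * z) (y + r * t ^+ 3 * z).
Proof.
move=> hq; apply: etrans (conic_sub_qf _ x y z hq) _.
by have [-> -> ->] := act_shear t r x y z.
Qed.

Lemma shear_gz t r (q : mpoly3) x y z : q \is 2.-homog ->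
  let X := r * z in let Y := x + r * t * z in let Z := y + r * t ^+ 3 * z in
  gz (conic_of (sub (shear t r) q)) x y z =
  r * (gx (conic_of q) X Y Z + t * gy (conic_of q) X Y Z + t ^+ 3 * gz (conic_of q) X Y Z).
Proof.
move=> hq X Y Z; have n2 : 2 != 0 :> C by rewrite pnatr_eq0.
apply: (mulfI n2); rewrite -(conic_of_gz (dhomog_sub _ hq)) grad_sub.
have [e0 e1 e2] := act_shear t r x y z.
have eP (P : mpoly3) : P.@[act (shear t r) (pt x y z)] = P.@[pt X Y Z].
  by apply: meval_eq; elim/ord3P; [exact: e0|exact: e1|exact: e2].
rewrite big_ord3 /= !mxE /= !eP.
have ex := conic_of_gx hq X Y Z; have ey := conic_of_gy hq X Y Z; have ez := conic_of_gz hq X Y Z.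
transitivity (r * (2 * gx (conic_of q) X Y Z) + (r * t * (2 * gy (conic_of q) X Y Z) +
   r * t ^+ 3 * (2 * gz (conic_of q) X Y Z))); last by ring.
congr (_ * _ + (_ * _ + _ * _)); [exact: ex|exact: ey|exact: ez].
Qed.

Lemma exists_avoid (s : seq {poly C}) : exists t : C, forall p, p \in s -> p != 0 -> p.[t] != 0.
Proof.
have [|n hn] := @poly_nonroot _ (\prod_(p <- s | p != 0) p).
  by rewrite prodf_seq_neq0; apply/allP => p _; apply/implyP.
exists n%:R => p ps p0; apply: contraNneq hn => e.
by rewrite horner_prod prodf_seq_eq0; apply/hasP; exists p => //; rewrite p0 e eqxx.
Qed.

Definition pol3 (a b c : C) : {poly C} := a%:P + b *: 'X + c *: 'X^3.

Lemma pol3_eval a b c t : (pol3 a b c).[t] = a + t * b + t ^+ 3 * c.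
Proof. by rewrite /pol3 !hornerD !hornerZ hornerC hornerX hornerXn; ring. Qed.

Lemma pol3_eq0 a b c : pol3 a b c = 0 -> [/\ a = 0, b = 0 & c = 0].
Proof.
move=> e; have h n := etrans (congr1 (fun p : {poly C} => p`_n) e) (coef0 C n).
have := (h 0%N, h 1%N, h 3%N); rewrite /= /pol3 !coefD !coefC !coefZ !coefX !coefXn /=.
by rewrite !mulr0 !mulr1 !addr0 !add0r => -[[-> ->] ->].
Qed.

(** On the curve (1, t, t^3) the six quadratic monomials become six different powers of t, so no
    nonzero conic contains the curve. Along (1, t, t^2) the conic xz = y^2 would vanish
    identically. *)
Definition pol6 (Q : conic C) : {poly C} := (ca Q)%:P + (2 * cd Q) *: 'X + cb Q *: 'X^2 +
  (2 * ce Q) *: 'X^3 + (2 * cf Q) *: 'X^4 + cc Q *: 'X^6.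

Lemma pol6_eval Q t : (pol6 Q).[t] = qf Q 1 t (t ^+ 3).
Proof. by rewrite /pol6 !hornerD !hornerZ hornerC hornerX !hornerXn /qf; ring. Qed.

Lemma pol6_neq0 Q : smooth Q -> pol6 Q != 0.
Proof.
move=> sm; apply/eqP => e; have h n := etrans (congr1 (fun p : {poly C} => p`_n) e) (coef0 C n).
have := (h 0%N, h 1%N, h 3%N); rewrite /= /pol6 !coefD !coefC !coefZ !coefX !coefXn /=.
rewrite !mulr0 !mulr1 !addr0 !add0r => -[[a0 d0] e0].
have n2 : 2 != 0 :> C by rewrite pnatr_eq0.
have {}d0 : cd Q = 0 by apply: (mulfI n2); rewrite d0 mulr0.
have {}e0 : ce Q = 0 by apply: (mulfI n2); rewrite e0 mulr0.
have [/eqP] : [/\ (1 : C) = 0, (0 : C) = 0 & (0 : C) = 0].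
  by apply: sm; rewrite /gx /gy /gz ?a0 ?d0 ?e0 !mulr0 !mul0r !addr0.
by rewrite oner_eq0.
Qed.

(** In powers of w = r z the conic is a w^2 plus terms of lower degree with bounded coefficients,
    and a is its value at the new centre; for large r the leading term dominates. *)
Lemma top_bound (Q : conic C) t : qf Q 1 t (t ^+ 3) != 0 -> exists2 r0 : R, 0 <= r0 &
  forall r, r0 <= r -> forall x y z, nsq x <= 4 -> nsq y <= 4 -> 1 <= nsq z ->
  1 <= nsq (qf Q (r%:C%C * z) (x + r%:C%C * t * z) (y + r%:C%C * t ^+ 3 * z)).
Proof.
set a := qf Q 1 t _ => a0.
pose b x y := 2 * (gy Q 1 t (t ^+ 3) * x + gz Q 1 t (t ^+ 3) * y).
have [B B1 HB] : bnd3 (fun x y _ => b x y).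
  apply: (eq_bnd3 _ (bnd3_lin (2 * gy Q 1 t (t ^+ 3)) (2 * gz Q 1 t (t ^+ 3)) 0)) => x y z.
  by rewrite /b; ring.
have [D D1 HD] : bnd3 (fun x y _ => qf Q 0 x y).
  have h : bnd3 (fun x y z : C => cb Q * (x * x) + cc Q * (y * y) + (2 * cf Q) * (x * y)).
    apply: bnd3D; [apply: bnd3D|]; apply: bnd3M; try exact: bnd3_c;
      by apply: bnd3M; (exact: bnd3_x || exact: bnd3_y).
  by apply: eq_bnd3 h => x y z; rewrite /qf; ring.
have na0 : 0 < nsq a by rewrite nsq_gt0.
pose s0 := (4 * B + 4 * D + 2) / nsq a + 1.
have s1 : 1 <= s0 by rewrite lerDr divr_ge0 ?nsq_ge0 //; lra.
exists s0 => [|r hr x y z hx hy hz]; first lra.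
pose w := r%:C%C * z.
have hw : s0 <= nsq w.
  rewrite nsqM nsq_real; apply: (@le_trans _ _ (r ^+ 2 * 1)); first by nra.
  by rewrite ler_wpM2l // sqr_ge0.
have -> : qf Q (r%:C%C * z) (x + r%:C%C * t * z) (y + r%:C%C * t ^+ 3 * z) =
    a * w ^+ 2 + (b x y * w + qf Q 0 x y).
  by rewrite /a /b /w /qf /gy /gz; ring.
set v := a * w ^+ 2 + _.
have e : a * w ^+ 2 = v + - (b x y * w + qf Q 0 x y) by rewrite /v; ring.
have h1 : nsq (a * w ^+ 2) <= 2 * (nsq v + 2 * (B * nsq w + D)).
  rewrite e; apply: le_trans (nsqD_le _ _) _; rewrite ler_pM2l // lerD2l nsqN.
  apply: le_trans (nsqD_le _ _) _; rewrite ler_pM2l // lerD //.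
    by rewrite nsqM ler_wpM2r ?nsq_ge0 // (HB x y 0) // nsq0; lra.
  by rewrite (HD x y 0) // nsq0; lra.
rewrite nsqM nsqX in h1.
have h2 : (4 * B + 4 * D + 2) + nsq a <= nsq a * nsq w.
  apply: (@le_trans _ _ (nsq a * s0)); last by rewrite ler_pM2l.
  by rewrite /s0 mulrDr mulrCA divff ?gt_eqF // !mulr1.
have h3 : ((4 * B + 4 * D + 2) + nsq a) * nsq w <= nsq a * nsq w ^+ 2.
  by rewrite expr2 mulrA ler_wpM2r // nsq_ge0.
by nra.
Qed.

Section CommonPoints.
Variables (k : nat) (Q : 'I_k -> conic C).
Hypothesis Q_cc : forall i, cc (Q i) != 0.
Hypothesis Q_smooth : forall i, smooth (Q i).
Hypothesis Q_distinct : forall i j, i != j -> ~ proportional (Q i) (Q j).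

Lemma qf_scale (P : conic C) c x y z : qf P (c * x) (c * y) (c * z) = c ^+ 2 * qf P x y z.
Proof. by rewrite /qf; ring. Qed.

Lemma direction_neq0 i x y z : ~ [/\ x = 0, y = 0 & z = 0] -> qf (Q i) x y z = 0 ->
  ~ (x = 0 /\ y = 0).
Proof.
move=> nz q0 [x0 y0]; apply: nz; split=> //; move/eqP: q0; rewrite x0 y0.
have -> : qf (Q i) 0 0 z = cc (Q i) * z ^+ 2 by rewrite /qf; ring.
by rewrite mulf_eq0 (negbTE (@Q_cc i)) expf_eq0 /= => /eqP.
Qed.

Lemma line_param (u : C * C) x y : u != (0, 0) -> lam u x y = 0 ->
  exists c, x = c * u.2 /\ y = c * - u.1.
Proof.
case: u => u1 u2 /= nz; rewrite /lam /= => e.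
have [e2|n2] := eqVneq u2 0.
  have n1 : u1 != 0 by apply: contraNneq nz => ->; rewrite e2.
  exists (- y / u1); rewrite mulrN divfK // opprK; split=> //.
  by apply: (mulfI n1); rewrite e2 !mulr0 -[RHS]e e2; ring.
exists (x / u2); rewrite divfK //; split=> //.
by apply: (mulfI n2); rewrite -[LHS](addKr (u1 * x)) e; field.
Qed.

(** Finitely many representatives of the pairwise intersection points: each linear factor of a
    resultant fixes the direction (x : y), and over it the first conic has two roots z. *)
Lemma common_points : exists s : seq (C * C * C), forall i j x y z, i != j ->
  ~ [/\ x = 0, y = 0 & z = 0] -> qf (Q i) x y z = 0 -> qf (Q j) x y z = 0 ->
  exists2 p, p \in s & exists c, [/\ x = c * p.1.1, y = c * p.1.2 & z = c * p.2].
Proof.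
have [cR [sR hR]] := res_factoring Q_cc Q_smooth Q_distinct.
have ex (t : 'I_k * (C * C)) : exists w : C * C, cl (Q t.1) t.2.2 (- t.2.1) = - (cc (Q t.1) * (w.1 + w.2))
    /\ cm (Q t.1) t.2.2 (- t.2.1) = cc (Q t.1) * w.1 * w.2.
  by have [z1 [z2 h]] := conic_roots t.2.2 (- t.2.1) (@Q_cc t.1); exists (z1, z2).
have [r hr] := choice ex.
exists (flatten [seq [seq (u.2, - u.1, (r (t.1, u)).1) | u <- sR t.1 t.2] ++
    [seq (u.2, - u.1, (r (t.1, u)).2) | u <- sR t.1 t.2] | t <- enum [set: 'I_k * 'I_k]]).
move=> i j x y z ij nz qi qj.
have [cR0 ss sn hs] := hR i j ij.
have nxy := direction_neq0 nz qi.
have := res_common qi qj; rewrite hs => /eqP; rewrite mulf_eq0 (negbTE cR0) /= prodf_seq_eq0.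
case/hasP => u us /= /eqP lu.
have [c [xc yc]] := line_param (allP sn u us) lu.
have c0 : c != 0 by apply/eqP => c0; apply: nxy; rewrite xc yc c0 !mul0r.
have [el em] := hr (i, u).
have qz : qf (Q i) u.2 (- u.1) (z / c) = 0.
  have := qi; have -> : z = c * (z / c) by rewrite mulrC divfK.
  rewrite xc yc qf_scale => /eqP; rewrite mulf_eq0 expf_eq0 (negbTE c0) andbF /= => /eqP.
  by rewrite [c * (z / c)]mulrC divfK.
move/eqP: qz; rewrite (qf_factor _ el em) !mulf_eq0 (negbTE (@Q_cc i)) /= !subr_eq0.
have ht : (i, j) \in enum [set: 'I_k * 'I_k] by rewrite mem_enum inE.
case/orP => /eqP e.
- exists (u.2, - u.1, (r (i, u)).1).
    apply/flattenP; eexists; first by apply: map_f ht.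
    by rewrite mem_cat; apply/orP; left; apply: (map_f (fun u => (u.2, - u.1, (r (i, u)).1)) us).
  by exists c; rewrite /= -e; split=> //; rewrite mulrC divfK.
- exists (u.2, - u.1, (r (i, u)).2).
    apply/flattenP; eexists; first by apply: map_f ht.
    by rewrite mem_cat; apply/orP; right; apply: (map_f (fun u => (u.2, - u.1, (r (i, u)).2)) us).
  by exists c; rewrite /= -e; split=> //; rewrite mulrC divfK.
Qed.

End CommonPoints.

End GenericCoordinates.

(** * Choice of the centre of projection *)

Section ChooseCoordinates.
Variable R : realType.
Local Notation C := R[i].
Local Notation mpoly3 := {mpoly C[3]}.
#[local] Opaque conic_of sub.

Lemma resA_eq0 (P Q : conic C) x y : res P Q x y = 0 -> resB P Q x y = 0 -> resA P Q x y = 0.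
Proof. by rewrite /res => h hb; move/eqP: h; rewrite hb mul0r subr0 expf_eq0 /= => /eqP. Qed.

(* If the resultant has a double zero below a common point with independent gradients, the
   vertical line through that point meets both conics in the same two points. *)
Lemma second_common_point (P Q : conic C) x y z : cc P != 0 -> cc Q != 0 -> gz P x y z != 0 ->
  qf P x y z = 0 -> qf Q x y z = 0 -> resB P Q x y = 0 ->
  exists2 z', z != z' & qf P x y z' = 0 /\ qf Q x y z' = 0.
Proof.
move=> cP cQ gP hP hQ hB; have hA := resA_eq0 (res_common hP hQ) hB.
have e w : cc P * qf Q x y w - cc Q * qf P x y w = 0.
  transitivity (resB P Q x y * w + resA P Q x y); first by rewrite !qf_z /resA /resB; ring.
  by rewrite hA hB mul0r addr0.
have [z1 [z2 [el em]]] := conic_roots x y cP.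
have n2 : 2 != 0 :> C by rewrite pnatr_eq0.
pose z' := z1 + z2 - z.
have gE : 2 * gz P x y z = cc P * (z - z').
  transitivity (2 * cc P * z + cl P x y); first by rewrite /gz /cl; ring.
  by rewrite el /z'; ring.
have hP' : qf P x y z' = 0.
  by rewrite -[RHS]hP !(qf_factor _ el em) /z'; ring.
exists z'; last first.
  by split=> //; apply: (mulfI cP); rewrite mulr0 -[RHS](e z') hP' mulr0 subr0.
apply: contraNneq gP => zz; apply/eqP; apply: (mulfI n2).
by rewrite gE -zz subrr !mulr0.
Qed.

Section Step.
Variables (k : nat) (Q Q' : 'I_k -> conic C).
Variables (s : seq (C * C * C)) (t r : C).
Hypothesis r0 : r != 0.
Hypothesis Q_smooth : forall i, smooth (Q i).
Hypothesis sheared_qf : forall i x y z,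
  qf (Q' i) x y z = qf (Q i) (r * z) (x + r * t * z) (y + r * t ^+ 3 * z).
Hypothesis sheared_gz : forall i x y z,
  let X := r * z in let Y := x + r * t * z in let Z := y + r * t ^+ 3 * z in
  gz (Q' i) x y z = r * (gx (Q i) X Y Z + t * gy (Q i) X Y Z + t ^+ 3 * gz (Q i) X Y Z).
Hypothesis s_common : forall i j (x y z : C), i != j ->
  ~ [/\ x = 0, y = 0 & z = 0] -> qf (Q i) x y z = 0 -> qf (Q j) x y z = 0 ->
  exists2 p, p \in s & exists c, [/\ x = c * p.1.1, y = c * p.1.2 & z = c * p.2].
Hypothesis t_top : forall i, qf (Q i) 1 t (t ^+ 3) != 0.
Hypothesis t_tangent : forall i p, p \in s ->
  let g := pol3 (gx (Q i) p.1.1 p.1.2 p.2) (gy (Q i) p.1.1 p.1.2 p.2) (gz (Q i) p.1.1 p.1.2 p.2) in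
  g != 0 -> g.[t] != 0.
Hypothesis t_line : forall p p', p \in s -> p' \in s ->
  let g := pol3 (p.1.2 * p'.2 - p.2 * p'.1.2) (p.2 * p'.1.1 - p.1.1 * p'.2)
    (p.1.1 * p'.1.2 - p.1.2 * p'.1.1) in g != 0 -> g.[t] != 0.
Hypothesis sheared_independent : independent_triples Q'.

Lemma sheared_cc i : cc (Q' i) != 0.
Proof.
have -> : cc (Q' i) = r ^+ 2 * qf (Q i) 1 t (t ^+ 3).
  have -> : cc (Q' i) = qf (Q' i) 0 0 1 by rewrite /qf; ring.
  by rewrite sheared_qf; rewrite /qf; ring.
by rewrite mulf_neq0 ?expf_neq0.
Qed.

Lemma shear_eq0 x y z : [/\ r * z = 0, x + r * t * z = 0 & y + r * t ^+ 3 * z = 0] ->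
  [/\ x = 0, y = 0 & z = 0].
Proof.
case=> /eqP; rewrite mulf_eq0 (negbTE r0) /= => /eqP -> ; by rewrite !mulr0 !addr0.
Qed.

Lemma sheared_common i j x y z : i != j -> ~ [/\ x = 0, y = 0 & z = 0] ->
  qf (Q' i) x y z = 0 -> qf (Q' j) x y z = 0 -> exists2 p, p \in s & exists2 c, c != 0 &
    [/\ r * z = c * p.1.1, x + r * t * z = c * p.1.2 & y + r * t ^+ 3 * z = c * p.2].
Proof.
move=> ij nz; rewrite (sheared_qf i) (sheared_qf j) => h1 h2.
have [|p ps [c [e1 e2 e3]]] := s_common ij _ h1 h2; first by move/shear_eq0.
exists p => //; exists c => //; apply/eqP => c0; apply: nz; apply: shear_eq0.
by rewrite e1 e2 e3 c0 !mul0r.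
Qed.

(** A vertical tangent at a common point means that the tangent line passes through the centre (1,
    t, t^3). This was excluded for every tangent whose equation is not identically zero, and a zero
    gradient contradicts smoothness. *)
Lemma sheared_vertical : no_vertical_tangent Q'.
Proof.
move=> i j x y z ij h1 h2 h3; apply: contrapT => nz.
have [p ps [c c0 [e1 e2 e3]]] := sheared_common ij nz h1 h2.
have := sheared_gz i x y z; rewrite /= h3 e1 e2 e3 => /esym/eqP.
rewrite mulf_eq0 (negbTE r0) /= => /eqP hg.
have := @t_tangent i p ps; rewrite /= pol3_eval.
set g := pol3 _ _ _ => hg'.
have g0 : g = 0.
  apply/eqP; apply: contraT => /hg'; apply: contraNT => _; apply/eqP.
  apply: (mulfI c0); rewrite mulr0 -[RHS]hg /gx /gy /gz; ring.
have [p1 p2 p3] := pol3_eq0 g0.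
have [a1 a2 a3] := Q_smooth p1 p2 p3.
by apply: nz; apply: shear_eq0; rewrite e1 e2 e3 a1 a2 a3 mulr0.
Qed.

(** Two common points on one vertical line would be collinear with the centre, and t avoids the
    lines through any two different points of the list. *)
Lemma no_second_point i j x y z z' : i != j -> ~ (x = 0 /\ y = 0) -> z != z' ->
  qf (Q' i) x y z = 0 -> qf (Q' j) x y z = 0 ->
  qf (Q' i) x y z' = 0 -> qf (Q' j) x y z' = 0 -> False.
Proof.
move=> ij nxy zz h1 h2 h1' h2'.
have nz (w : C) : ~ [/\ x = 0, y = 0 & w = 0] by case=> x0 y0 _; apply: nxy.
have [p ps [c c0 [e1 e2 e3]]] := sheared_common ij (nz z) h1 h2.
have [p' ps' [c' c0' [e1' e2' e3']]] := sheared_common ij (nz z') h1' h2'.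
have := @t_line p p' ps ps'; rewrite /= pol3_eval; set g := pol3 _ _ _ => hg.
have d0 : r * (z - z') != 0 by rewrite mulf_neq0 // subr_eq0.
have cc0 : c * c' != 0 by rewrite mulf_neq0.
have g0 : g = 0.
  apply/eqP; apply: contraT => /hg; apply: contraNT => _; apply/eqP.
  apply: (mulfI d0); apply: (mulfI cc0); rewrite !mulr0.
  transitivity (r * (z - z') * (((c * p.1.2) * (c' * p'.2) - (c * p.2) * (c' * p'.1.2)) +
    t * ((c * p.2) * (c' * p'.1.1) - (c * p.1.1) * (c' * p'.2)) +
    t ^+ 3 * ((c * p.1.1) * (c' * p'.1.2) - (c * p.1.2) * (c' * p'.1.1)))); first by ring.
  by rewrite -e1 -e2 -e3 -e1' -e2' -e3'; ring.
have [p1 p2 p3] := pol3_eq0 g0.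
apply: nxy; split; apply: (mulfI d0); rewrite mulr0.
- transitivity ((c * p.1.1) * (c' * p'.1.2) - (c * p.1.2) * (c' * p'.1.1)).
    by rewrite -e1 -e2 -e1' -e2'; ring.
  have -> : (c * p.1.1) * (c' * p'.1.2) - (c * p.1.2) * (c' * p'.1.1) =
    c * c' * (p.1.1 * p'.1.2 - p.1.2 * p'.1.1) by ring.
  by rewrite p3 mulr0.
- transitivity (- ((c * p.2) * (c' * p'.1.1) - (c * p.1.1) * (c' * p'.2))).
    by rewrite -e1 -e3 -e1' -e3'; ring.
  have -> : (c * p.2) * (c' * p'.1.1) - (c * p.1.1) * (c' * p'.2) =
    c * c' * (p.2 * p'.1.1 - p.1.1 * p'.2) by ring.
  by rewrite p2 mulr0 oppr0.
Qed.

(** By [dres_jacobian] a zero derivative of the resultant has two possible causes. Either [resB]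
    vanishes, which gives a second common point on the same vertical line, or the gradients of the
    two conics are parallel, which is excluded at a triple point. *)
Lemma sheared_triple : simple_triple_points Q'.
Proof.
move=> i j l x y z u hi hj hl hd; apply: contrapT => nz.
have ij : i != j by move: (u); rewrite uniq3 => /and3P[].
have ji : j != i by rewrite eq_sym.
have gi : gz (Q' i) x y z != 0 by apply/eqP => h; apply: nz; exact: sheared_vertical ij hi hj h.
have gj : gz (Q' j) x y z != 0 by apply/eqP => h; apply: nz; exact: sheared_vertical ji hj hi h.
have nxy := direction_neq0 sheared_cc nz hi.
have [b0|b0] := eqVneq (resB (Q' i) (Q' j) x y) 0.
  have [z' zz [hi' hj']] := second_common_point (sheared_cc i) (sheared_cc j) gi hi hj b0.
  exact: no_second_point ij nxy zz hi hj hi' hj'.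
have n4 : 4 != 0 :> C by rewrite pnatr_eq0.
have mn a b : (gx (Q' i) x y z * a + gy (Q' i) x y z * b) * gz (Q' j) x y z
     - (gx (Q' j) x y z * a + gy (Q' j) x y z * b) * gz (Q' i) x y z = 0.
  have := dres_jacobian a b hi hj; rewrite hd => /esym/eqP.
  by rewrite mulf_eq0 mulf_eq0 (negbTE n4) (negbTE b0) /= => /eqP.
have m1 : gx (Q' i) x y z * gz (Q' j) x y z - gx (Q' j) x y z * gz (Q' i) x y z = 0.
  by rewrite -[RHS](mn 1 0); ring.
have m2 : gy (Q' i) x y z * gz (Q' j) x y z - gy (Q' j) x y z * gz (Q' i) x y z = 0.
  by rewrite -[RHS](mn 0 1); ring.
apply: nz; apply: (sheared_independent u hi hj hl); apply/and3P; split; apply/eqP.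
- by rewrite -[RHS]m2; ring.
- by rewrite -[RHS]oppr0 -[in RHS]m1; ring.
- apply: (mulIf gj); rewrite mul0r.
  transitivity ((gx (Q' i) x y z * gz (Q' j) x y z - gx (Q' j) x y z * gz (Q' i) x y z) * gy (Q' j) x y z
    - (gy (Q' i) x y z * gz (Q' j) x y z - gy (Q' j) x y z * gz (Q' i) x y z) * gx (Q' j) x y z).
    by ring.
  by rewrite m1 m2 !mul0r subrr.
Qed.

End Step.

(** With nonzero coefficients of z^2 the intersection points can be listed, so a second shear can be
    chosen to avoid their tangents and the lines joining them. *)
Lemma annihilated_contradiction_cc (k m : nat) (q : 'I_k -> mpoly3) th :
  (5 <= k)%N -> (m + 3 <= k + 1)%N -> annihilated m q th ->
  (forall i, cc (conic_of (q i)) != 0) -> False.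
Proof.
move=> k5 mk han hc; pose Q i := conic_of (q i).
have hs : forall i, smooth (Q i) := an_smooth han.
have hd : forall i j, i != j -> ~ proportional (Q i) (Q j) := an_distinct han.
have [s hcommon] := common_points hc hs hd.
pose tangent (x : 'I_k * (C * C * C)) := pol3 (gx (Q x.1) x.2.1.1 x.2.1.2 x.2.2)
  (gy (Q x.1) x.2.1.1 x.2.1.2 x.2.2) (gz (Q x.1) x.2.1.1 x.2.1.2 x.2.2).
pose line (x : C * C * C * (C * C * C)) := let: (p, p') := x in
  pol3 (p.1.2 * p'.2 - p.2 * p'.1.2) (p.2 * p'.1.1 - p.1.1 * p'.2)
    (p.1.1 * p'.1.2 - p.1.2 * p'.1.1).
have [t ht] := exists_avoid ([seq pol6 (Q i) | i <- enum 'I_k] ++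
  [seq tangent (i, p) | i <- enum 'I_k, p <- s] ++ [seq line (p, p') | p <- s, p' <- s]).
have t_top i : qf (Q i) 1 t (t ^+ 3) != 0.
  rewrite -pol6_eval; apply: ht; last exact: pol6_neq0.
  by rewrite mem_cat; apply/orP; left; apply: map_f; rewrite mem_enum.
have [r0 r00 hr0] : exists2 r0 : R, 0 <= r0 & forall i : 'I_k,
    forall r, r0 <= r -> forall x y z, nsq x <= 4 -> nsq y <= 4 -> 1 <= nsq z ->
    1 <= nsq (qf (Q i) (r%:C%C * z) (x + r%:C%C * t * z) (y + r%:C%C * t ^+ 3 * z)).
  apply: uniform_bound => [i|i c c' cc' h r hr]; first exact: top_bound.
  by apply: h; apply: le_trans hr.
pose r : C := (r0 + 1)%:C%C.
have r_neq0 : r != 0 by rewrite fmorph_eq0 gt_eqF //; lra.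
have han' := transport_annihilated (shearK t r_neq0) han.
pose Q' i := conic_of (sub (shear t r) (q i)).
have hqf i x y z : qf (Q' i) x y z = qf (Q i) (r * z) (x + r * t * z) (y + r * t ^+ 3 * z).
  exact: shear_qf (an_homog han i).
have hgz i x y z := shear_gz t r x y z (an_homog han i).
have t_tan i p : p \in s -> tangent (i, p) != 0 -> (tangent (i, p)).[t] != 0.
  move=> ps; apply: ht; rewrite !mem_cat; apply/orP; right; apply/orP; left.
  by apply: (allpairs_f (fun i p => tangent (i, p))) => //; rewrite mem_enum.
have t_line p p' : p \in s -> p' \in s -> line (p, p') != 0 -> (line (p, p')).[t] != 0.
  move=> ps ps'; apply: ht; rewrite !mem_cat; apply/orP; right; apply/orP; right.
  exact: (allpairs_f (fun p p' => line (p, p'))).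
have ind : independent_triples Q' := an_triple han'.
have hcc i : cc (Q' i) != 0 := sheared_cc r_neq0 hqf t_top i.
have hv : no_vertical_tangent Q' := sheared_vertical r_neq0 hs hqf hgz hcommon t_tan.
have htr : simple_triple_points Q' :=
  sheared_triple r_neq0 hs hqf hgz hcommon t_top t_tan t_line ind.
apply: (generic_contradiction k5 mk han' hcc hv htr) => i x y z hx hy hz.
have r1 : r0 <= r0 + 1 by rewrite lerDl.
exact: (eq_ind_r (fun w => 1 <= nsq w) (hr0 i (r0 + 1) r1 x y z hx hy hz) (hqf i x y z)).
Qed.

(** A preliminary shear with r = 1 and a centre on no conic makes all coefficients of z^2
    nonzero. *)
Lemma annihilated_contradiction (k m : nat) (q : 'I_k -> mpoly3) th :
  (5 <= k)%N -> (m + 3 <= k + 1)%N -> ~ annihilated m q th.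
Proof.
move=> k5 mk han; pose Q i := conic_of (q i).
have hs : forall i, smooth (Q i) := an_smooth han.
have [t ht] := exists_avoid [seq pol6 (Q i) | i <- enum 'I_k].
have t_top i : qf (Q i) 1 t (t ^+ 3) != 0.
  rewrite -pol6_eval; apply: ht; last exact: pol6_neq0.
  by apply: map_f; rewrite mem_enum.
have one_neq0 : (1 : C) != 0 := oner_neq0 _.
have han' := transport_annihilated (shearK t one_neq0) han.
apply: (annihilated_contradiction_cc k5 mk han').
exact: sheared_cc one_neq0 (fun i x y z => shear_qf t 1 x y z (an_homog han i)) t_top.
Qed.

End ChooseCoordinates.

(** * Local equations modulo terms of high order *)

Section TruncatedSeries.
Variable K : fieldType.
Local Notation poly2 := {poly {poly K}}.
Implicit Types (f g : ps K) (P Q : poly2).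

(** The series and the polynomial agree below total degree n. All local arguments need only terms of
    degree at most 3, so they can be carried out in a ring of polynomials. *)
Definition congruent n f P : Prop := forall i j, (i + j < n)%N -> f i j = P`_i`_j.

Lemma coefM2 P Q i j : (P * Q)`_i`_j = \sum_(a < i.+1) \sum_(b < j.+1) P`_a`_b * Q`_(i - a)`_(j - b).
Proof. by rewrite coefM coef_sum; apply: eq_bigr => a _; rewrite coefM. Qed.

Lemma congruent_ex n f : exists P, congruent n f P.
Proof.
exists (\poly_(i < n) \poly_(j < n) f i j) => i j ij.
have i_n : (i < n)%N by lia.
have j_n : (j < n)%N by lia.
by rewrite coef_poly i_n coef_poly j_n.
Qed.

Lemma congruent_const n c : congruent n (ps_const c) c%:P%:P.
Proof.
move=> i j _; rewrite /ps_const coefC; case: eqP => _ /=; last by rewrite coef0.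
by rewrite coefC.
Qed.

Lemma congruent_X n : congruent n (@ps_X K) 'X.
Proof.
move=> i j _; rewrite /ps_X coefX; case: eqP => _ /=; last by rewrite coef0.
by rewrite coef1; case: j.
Qed.

Lemma congruent_Y n : congruent n (@ps_Y K) ('X)%:P.
Proof.
move=> i j _; rewrite /ps_Y coefC; case: eqP => _ /=; last by rewrite coef0.
by rewrite coefX; case: eqP.
Qed.

Lemma congruent_add n f g P Q : congruent n f P -> congruent n g Q -> congruent n (ps_add f g) (P + Q).
Proof. by move=> h1 h2 i j ij; rewrite /ps_add h1 // h2 // !coefD. Qed.

Lemma congruent_scale n c f P : congruent n f P -> congruent n (ps_scale c f) (c%:P%:P * P).
Proof. by move=> h i j ij; rewrite /ps_scale h // !coefCM. Qed.

Lemma congruent_mul n f g P Q : congruent n f P -> congruent n g Q -> congruent n (ps_mul f g) (P * Q).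
Proof.
move=> h1 h2 i j ij; rewrite /ps_mul coefM2; apply: eq_bigr => a _; apply: eq_bigr => b _.
have := ltn_ord a; have := ltn_ord b => hb ha.
by rewrite h1 ?h2 //; lia.
Qed.

Lemma congruent_pow n f P e : congruent n f P -> congruent n (ps_pow f e) (P ^+ e).
Proof.
move=> h; elim: e => [|e IH]; first by rewrite expr0; apply: congruent_const.
by rewrite exprS; apply: congruent_mul.
Qed.

Lemma congruent_eval n (F : {mpoly K[3]}) (w : 'I_3 -> ps K) (W : 'I_3 -> poly2) :
  (forall i, congruent n (w i) (W i)) ->
  congruent n (ps_eval3 F w) (mmap (polyC \o polyC) W F).
Proof.
move=> h; rewrite /ps_eval3 /mmap.
elim: (msupp F) => [|m s IH]; first by rewrite !big_nil => i j _; rewrite /ps_const coef0; case: ifP => _; rewrite coef0.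
rewrite !big_cons; apply: congruent_add IH; apply: congruent_scale.
rewrite /mmap1; elim: (index_enum _) => [|i r IH]; first by rewrite !big_nil; apply: congruent_const.
by rewrite !big_cons; apply: congruent_mul IH; apply: congruent_pow.
Qed.

Definition order_ge n P : Prop := forall i j, (i + j < n)%N -> P`_i`_j = 0.

Lemma order_ge0 P : order_ge 0 P. Proof. by []. Qed.

Lemma order_geD n P Q : order_ge n P -> order_ge n Q -> order_ge n (P + Q).
Proof. by move=> h1 h2 i j ij; rewrite !coefD h1 // h2 // addr0. Qed.

Lemma order_geM n m P Q : order_ge n P -> order_ge m Q -> order_ge (n + m) (P * Q).
Proof.
move=> h1 h2 i j ij; rewrite coefM2 big1 // => a _; rewrite big1 // => b _.
have := ltn_ord a; have := ltn_ord b => hb ha.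
have [hab|hab] := ltnP (a + b) n; first by rewrite h1 // mul0r.
by rewrite h2 ?mulr0 //; lia.
Qed.

Lemma order_geMl n P Q : order_ge n P -> order_ge n (P * Q).
Proof. by move=> h; have := order_geM h (order_ge0 Q); rewrite addn0. Qed.

Lemma order1P P : P`_0`_0 = 0 -> order_ge 1 P.
Proof. by move=> h [|i] [|j]. Qed.

Definition mono (c : K) i j : poly2 := c%:P%:P * 'X^i * ('X^j)%:P.

Lemma mono_coef c i j a b : (mono c i j)`_a`_b = c * ((a == i) && (b == j))%:R.
Proof.
rewrite /mono coefMC coefCM coefXn; case: (a == i); last by rewrite mulr0 mul0r coef0 mulr0.
by rewrite mulr1 coefCM coefXn.
Qed.

Definition linear_part P : poly2 := mono P`_1`_0 1 0 + mono P`_0`_1 0 1.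

Lemma order_sub_linear P : P`_0`_0 = 0 -> order_ge 2 (P - linear_part P).
Proof.
move=> h i j ij; rewrite /linear_part !coefB !coefD !mono_coef.
case: i j ij => [|[|i]] [|[|j]] ij; try lia.
- by rewrite /= h !mulr0 addr0 subr0.
- by rewrite /= mulr0 mulr1 add0r subrr.
- by rewrite /= mulr0 mulr1 addr0 subrr.
Qed.

Lemma order_linear_part P : order_ge 1 (linear_part P).
Proof. by apply: order1P; rewrite /linear_part !coefD !mono_coef !mulr0 addr0. Qed.

Lemma order_sub_const P : order_ge 1 (P - (P`_0`_0)%:P%:P).
Proof. by apply: order1P; rewrite !coefB !coefC /= subrr. Qed.

(* The discriminant of the binary cubic [a X^3 + b X^2 Y + c X Y^2 + d Y^3]. *)
Definition cubic_disc (a b c d : K) : K :=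
  b ^+ 2 * c ^+ 2 - 4 * a * c ^+ 3 - 4 * b ^+ 3 * d - 27 * a ^+ 2 * d ^+ 2 + 18 * a * b * c * d.

Definition cubic_part_disc P : K := cubic_disc P`_3`_0 P`_2`_1 P`_1`_2 P`_0`_3.

Definition tangent_det P Q : K := P`_1`_0 * Q`_0`_1 - P`_0`_1 * Q`_1`_0.

(** Up to order 4 the product is G(0) times the product of the three linear parts. The discriminant
    of a cubic form is of degree 4 in its coefficients and is the squared product of the pairwise
    determinants of the linear factors. *)
Lemma cubic_disc_product P1 P2 P3 G :
  P1`_0`_0 = 0 -> P2`_0`_0 = 0 -> P3`_0`_0 = 0 ->
  cubic_part_disc (G * (P1 * (P2 * P3))) =
  G`_0`_0 ^+ 4 * (tangent_det P1 P2 * tangent_det P1 P3 * tangent_det P2 P3) ^+ 2.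
Proof.
move=> h1 h2 h3; set c := G`_0`_0.
pose l1 := linear_part P1; pose l2 := linear_part P2; pose l3 := linear_part P3.
have e : order_ge 4 (G * (P1 * (P2 * P3)) - c%:P%:P * (l1 * (l2 * l3))).
  have -> : G * (P1 * (P2 * P3)) - c%:P%:P * (l1 * (l2 * l3)) =
      (P1 - l1) * (P2 * P3) * G + l1 * ((P2 - l2) * P3) * G + l1 * (l2 * (P3 - l3)) * G +
      l1 * (l2 * l3) * (G - c%:P%:P) by ring.
  have o1 := order1P h1; have o2 := order1P h2; have o3 := order1P h3.
  have s1 := order_sub_linear h1; have s2 := order_sub_linear h2; have s3 := order_sub_linear h3.
  have k1 := order_linear_part P1; have k2 := order_linear_part P2; have k3 := order_linear_part P3.
  apply: order_geD; [apply: order_geD; [apply: order_geD|]|].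
  - exact/order_geMl/(order_geM s1 (order_geM o2 o3)).
  - exact/order_geMl/(order_geM k1 (order_geM s2 o3)).
  - exact/order_geMl/(order_geM k1 (order_geM k2 s3)).
  - exact: order_geM (order_geM k1 (order_geM k2 k3)) (order_sub_const G).
have eq i j : (i + j < 4)%N -> (G * (P1 * (P2 * P3)))`_i`_j = (c%:P%:P * (l1 * (l2 * l3)))`_i`_j.
  by move=> ij; apply/eqP; rewrite -subr_eq0 -!coefB e.
set a1 := P1`_1`_0; set b1 := P1`_0`_1; set a2 := P2`_1`_0; set b2 := P2`_0`_1.
set a3 := P3`_1`_0; set b3 := P3`_0`_1.
have ex : c%:P%:P * (l1 * (l2 * l3)) = mono (c * a1 * a2 * a3) 3 0 +
    mono (c * (a1 * a2 * b3 + a1 * b2 * a3 + b1 * a2 * a3)) 2 1 +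
    mono (c * (a1 * b2 * b3 + b1 * a2 * b3 + b1 * b2 * a3)) 1 2 + mono (c * b1 * b2 * b3) 0 3.
  rewrite /l1 /l2 /l3 /linear_part /mono -/a1 -/b1 -/a2 -/b2 -/a3 -/b3.
  by rewrite !(rmorphM, rmorphD, rmorphXn) /= expr0; ring.
rewrite /cubic_part_disc !eq // ex !coefD !mono_coef /= /cubic_disc /tangent_det -/a1 -/a2 -/a3 -/b1 -/b2 -/b3.
ring.
Qed.

Section LocalEquation.
Variables (W : 'I_3 -> poly2).
Let Phi : {mpoly K[3]} -> poly2 := mmap (polyC \o polyC) W.

Lemma PhiM F G : Phi (F * G) = Phi F * Phi G.
Proof. by rewrite /Phi rmorphM. Qed.

Lemma PhiX i : Phi 'X_i = W i.
Proof. by rewrite /Phi mmapX mmap1U. Qed.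

Lemma PhiC c : Phi c%:MP = c%:P%:P.
Proof. by rewrite /Phi mmapC. Qed.

Lemma Phi_00 F : (Phi F)`_0`_0 = F.@[fun i => (W i)`_0`_0].
Proof.
elim/mpoly_alg_ind: F => [c|F G hF hG|F i hF].
- by rewrite PhiC mevalC !coefC.
- by rewrite /Phi raddfD /= -/(Phi F) -/(Phi G) !coefD hF hG mevalD.
- by rewrite PhiM PhiX !coef0M hF mevalM mevalXU.
Qed.

Lemma Phi_10 F : (Phi F)`_1`_0 =
  \sum_(s < 3) (mderiv s F).@[fun i => (W i)`_0`_0] * (W s)`_1`_0.
Proof.
elim/mpoly_alg_ind: F => [c|F G hF hG|F i hF].
- by rewrite PhiC coefC /= coef0 big1 // => s _; rewrite mderivC meval0 mul0r.
- rewrite /Phi raddfD /= -/(Phi F) -/(Phi G) !coefD hF hG -big_split; apply: eq_bigr => s _ /=.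
  by rewrite mderivD mevalD mulrDl.
have -> : (Phi (F * 'X_i))`_1`_0 = (Phi F)`_1`_0 * (W i)`_0`_0 + (Phi F)`_0`_0 * (W i)`_1`_0.
  by rewrite PhiM PhiX coefM2 !big_ord_recr !big_ord0 /= !add0r addrC.
rewrite hF Phi_00; set v := (fun i0 : 'I_3 => (W i0)`_0`_0).
have -> : \sum_(s < 3) (mderiv s (F * 'X_i)).@[v] * (W s)`_1`_0 =
    (\sum_(s < 3) (mderiv s F).@[v] * (W s)`_1`_0) * v i + \sum_(s < 3) F.@[v] * (s == i)%:R * (W s)`_1`_0.
  rewrite mulr_suml -big_split; apply: eq_bigr => s _ /=.
  rewrite mderivM mevalD !mevalM mevalXU mderiv_XU rmorph_nat; ring.
congr (_ + _); rewrite (bigD1 i) //= eqxx mulr1 big1 ?addr0 // => s /negbTE ->.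
by rewrite mulr0 mul0r.
Qed.

Lemma Phi_01 F : (Phi F)`_0`_1 =
  \sum_(s < 3) (mderiv s F).@[fun i => (W i)`_0`_0] * (W s)`_0`_1.
Proof.
elim/mpoly_alg_ind: F => [c|F G hF hG|F i hF].
- by rewrite PhiC !coefC /= big1 // => s _; rewrite mderivC meval0 mul0r.
- rewrite /Phi raddfD /= -/(Phi F) -/(Phi G) !coefD hF hG -big_split; apply: eq_bigr => s _ /=.
  by rewrite mderivD mevalD mulrDl.
have -> : (Phi (F * 'X_i))`_0`_1 = (Phi F)`_0`_1 * (W i)`_0`_0 + (Phi F)`_0`_0 * (W i)`_0`_1.
  by rewrite PhiM PhiX coefM2 !big_ord_recr !big_ord0 /= !add0r addrC.
rewrite hF Phi_00; set v := (fun i0 : 'I_3 => (W i0)`_0`_0).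
have -> : \sum_(s < 3) (mderiv s (F * 'X_i)).@[v] * (W s)`_0`_1 =
    (\sum_(s < 3) (mderiv s F).@[v] * (W s)`_0`_1) * v i + \sum_(s < 3) F.@[v] * (s == i)%:R * (W s)`_0`_1.
  rewrite mulr_suml -big_split; apply: eq_bigr => s _ /=.
  rewrite mderivM mevalD !mevalM mevalXU mderiv_XU rmorph_nat; ring.
congr (_ + _); rewrite (bigD1 i) //= eqxx mulr1 big1 ?addr0 // => s /negbTE ->.
by rewrite mulr0 mul0r.
Qed.

End LocalEquation.

Definition local_eq_rep (g : 'M[K]_3) (P1 P2 : poly2) (i : 'I_3) : poly2 :=
  (g i 0%:R)%:P%:P * P1 + (g i 1%:R)%:P%:P * P2 + (g i 2%:R)%:P%:P.

Lemma congruent_local_eq n (F : {mpoly K[3]}) (g : 'M_3) p1 p2 P1 P2 :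
  congruent n p1 P1 -> congruent n p2 P2 ->
  congruent n (local_eq F g p1 p2) (mmap (polyC \o polyC) (local_eq_rep g P1 P2) F).
Proof.
move=> h1 h2; apply: congruent_eval => i; apply: congruent_add; last exact: congruent_const.
by apply: congruent_add; apply: congruent_scale.
Qed.

Lemma local_eq_rep_00 (g : 'M_3) P1 P2 v i : chart_at v g -> P1`_0`_0 = 0 -> P2`_0`_0 = 0 ->
  (local_eq_rep g P1 P2 i)`_0`_0 = v i.
Proof.
by move=> [_ gv] h1 h2; rewrite /local_eq_rep !coefD !coefCM h1 h2 !mulr0 !add0r !coefC /= gv.
Qed.

Lemma meval_chart (F : {mpoly K[3]}) (g : 'M_3) P1 P2 v : chart_at v g -> P1`_0`_0 = 0 -> P2`_0`_0 = 0 ->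
  (mmap (polyC \o polyC) (local_eq_rep g P1 P2) F)`_0`_0 = F.@[v].
Proof.
by move=> gv h1 h2; rewrite Phi_00; apply: meval_eq => i; apply: local_eq_rep_00 gv h1 h2.
Qed.

(** Three factors vanishing at the point give multiplicity at least 3, but the normal form of A_j
    with j >= 1 has a nonzero term x^2, and a unit factor does not remove it. *)
Lemma A_sing_two j (F1 F2 F3 G : {mpoly K[3]}) v : A_sing j (G * (F1 * (F2 * F3))) v ->
  F1.@[v] = 0 -> F2.@[v] = 0 -> F3.@[v] = 0 -> False.
Proof.
move=> [j1 [g [p1 [p2 [u [gv [p10 [p20 _]] u0 heq]]]]]] h1 h2 h3.
have [P1 c1] := congruent_ex 3 p1; have [P2 c2] := congruent_ex 3 p2.
have [U cU] := congruent_ex 3 u.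
have e1 : P1`_0`_0 = 0 by rewrite -c1.
have e2 : P2`_0`_0 = 0 by rewrite -c2.
have hl := congruent_local_eq (G * (F1 * (F2 * F3))) g c1 c2.
have hr := congruent_mul cU (congruent_add (@congruent_pow 3 _ _ 2 (@congruent_X 3)) (@congruent_pow 3 _ _ j.+1 (@congruent_Y 3))).
have := hr 2%N 0%N isT; rewrite -heq hl // !PhiM.
have o F : F.@[v] = 0 -> order_ge 1 (mmap (polyC \o polyC) (local_eq_rep g P1 P2) F).
  by move=> hF; apply: order1P; rewrite (meval_chart _ gv e1 e2).
have h := order_geM (order_ge0 (mmap (polyC \o polyC) (local_eq_rep g P1 P2) G))
  (order_geM (o _ h1) (order_geM (o _ h2) (o _ h3))).
rewrite h // mulrDr !coefD coefMXn /= -rmorphXn coefMC coefMXn /= addr0 => /esym e.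
by move: u0; rewrite /ps_unit (cU 0%N 0%N isT) e eqxx.
Qed.

Lemma tangent_det_parallel (W : 'I_3 -> poly2) (F1 F2 : {mpoly K[3]}) v :
  (forall i, (W i)`_0`_0 = v i) ->
  (forall s t, (mderiv s F1).@[v] * (mderiv t F2).@[v] = (mderiv s F2).@[v] * (mderiv t F1).@[v]) ->
  tangent_det (mmap (polyC \o polyC) W F1) (mmap (polyC \o polyC) W F2) = 0.
Proof.
move=> Wv par; rewrite /tangent_det !Phi_10 !Phi_01.
have ev F : F.@[fun i => (W i)`_0`_0] = F.@[v] by apply: meval_eq.
under eq_bigr do rewrite ev; under [X in _ * X - _]eq_bigr do rewrite ev.
under [X in _ - X * _]eq_bigr do rewrite ev; under [X in _ - _ * X]eq_bigr do rewrite ev.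
rewrite [X in _ - X]mulrC !mulr_suml -sumrB big1 // => s _; rewrite !mulr_sumr -sumrB big1 // => t _.
set a := _.@[v]; set c := (_ F2).@[v]; set c' := (_ F2).@[v]; set a' := (_ F1).@[v].
have p : a * c = c' * a' by exact: par.
have -> : a * (W s)`_1`_0 * (c * (W t)`_0`_1) = (a * c) * ((W s)`_1`_0 * (W t)`_0`_1) by ring.
by rewrite p; ring.
Qed.

(** The factors F_i need not be matched with the branches: the discriminant of the cubic part is
    computed from both factorizations. The branches show that it is nonzero, so neither G(v) nor the
    tangent determinant of F1 and F2 can vanish. *)
Lemma ord_triple_transverse (F1 F2 F3 G : {mpoly K[3]}) v : ord_triple (G * (F1 * (F2 * F3))) v ->
  F1.@[v] = 0 -> F2.@[v] = 0 -> F3.@[v] = 0 ->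
  G.@[v] != 0 /\
  ~ forall s t, (mderiv s F1).@[v] * (mderiv t F2).@[v] = (mderiv s F2).@[v] * (mderiv t F1).@[v].
Proof.
move=> [g [u [b1 [b2 [b3 [gv u0 [s1 [s2 s3]] [d12 [d13 d23]] heq]]]]]] h1 h2 h3.
have [B1 c1] := congruent_ex 4 b1; have [B2 c2] := congruent_ex 4 b2.
have [B3 c3] := congruent_ex 4 b3; have [U cU] := congruent_ex 4 u.
have hl := congruent_local_eq (G * (F1 * (F2 * F3))) g (@congruent_X 4) (@congruent_Y 4).
have hr := congruent_mul cU (congruent_mul c1 (congruent_mul c2 c3)).
have x0 : ('X : poly2)`_0`_0 = 0 by rewrite coefX coef0.
have y0 : (('X)%:P : poly2)`_0`_0 = 0 by rewrite coefC /= coefX.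
have e i j : (i + j < 4)%N -> (mmap (polyC \o polyC) (local_eq_rep g 'X ('X)%:P) (G * (F1 * (F2 * F3))))`_i`_j
    = (U * (B1 * (B2 * B3)))`_i`_j.
  by move=> ij; rewrite -hl // -hr.
have B0 b B : congruent 4 b B -> smooth_branch b -> B`_0`_0 = 0 by move=> c [b0 _]; rewrite -c.
have D b B c C : congruent 4 b B -> congruent 4 c C -> distinct_tangents b c -> tangent_det B C != 0.
  by move=> hb hc; rewrite /distinct_tangents /tangent_det !hb ?hc.
have nz : cubic_part_disc (U * (B1 * (B2 * B3))) != 0.
  rewrite (cubic_disc_product _ (B0 _ _ c1 s1) (B0 _ _ c2 s2) (B0 _ _ c3 s3)).
  have U0 : U`_0`_0 != 0 by rewrite -(cU 0%N 0%N isT).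
  by rewrite mulf_neq0 ?expf_neq0 ?mulf_neq0 ?(D _ _ _ _ c1 c2) ?(D _ _ _ _ c1 c3) ?(D _ _ _ _ c2 c3).
have mv := meval_chart _ gv x0 y0.
have F0 F : F.@[v] = 0 -> (mmap (polyC \o polyC) (local_eq_rep g 'X ('X)%:P) F)`_0`_0 = 0.
  by move=> hF; rewrite mv.
move: nz; rewrite /cubic_part_disc -!e // -/(cubic_part_disc _) !PhiM.
rewrite (cubic_disc_product _ (F0 _ h1) (F0 _ h2) (F0 _ h3)) mv.
split; first by apply: contraNneq nz => ->; rewrite expr0n mul0r.
move=> par; move: nz; rewrite (tangent_det_parallel _ par) ?mul0r ?expr0n ?mulr0 ?eqxx // => i.
exact: local_eq_rep_00 gv x0 y0.
Qed.

End TruncatedSeries.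

(** * Points on three of the conics *)

Section SingularPoints.
Variables (K : fieldType) (k : nat) (q : 'I_k -> {mpoly K[3]}).
Local Notation f := (\prod_i q i).

Lemma sing_point_mul (A B : {mpoly K[3]}) v :
  nonzero3 v -> A.@[v] = 0 -> B.@[v] = 0 -> sing_point (A * B) v.
Proof.
move=> nz hA hB; split=> //; split; first by rewrite mevalM hA mul0r.
by move=> i; rewrite /pd mderivM mevalD !mevalM hA hB mul0r mulr0 addr0.
Qed.

Lemma prod_three i j l : uniq [:: i; j; l] ->
  f = (\prod_(s | s \notin [:: i; j; l]) q s) * (q i * (q j * q l)).
Proof.
rewrite /= !inE !negb_or andbT => /andP[/andP[ij il] jl].
rewrite (bigD1 i) //= (bigD1 j) 1?eq_sym //= (bigD1 l) /=; last by rewrite eq_sym il eq_sym jl.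
rewrite [RHS]mulrC !mulrA; congr (_ * _); apply: eq_bigl => s.
by rewrite !inE !negb_or andbA.
Qed.

Hypothesis f_sing : forall v, sing_point f v ->
  A_sing 1 f v \/ ord_triple f v \/ A_sing 3 f v \/ A_sing 5 f v \/ A_sing 7 f v.

(** Such a point is singular and of multiplicity at least 3, so among the allowed types only the
    ordinary triple point remains. *)
Lemma concurrent_transverse i j l v : uniq [:: i; j; l] -> nonzero3 v ->
  (q i).@[v] = 0 -> (q j).@[v] = 0 -> (q l).@[v] = 0 ->
  (forall m, m \notin [:: i; j; l] -> (q m).@[v] != 0) /\
  ~ forall s t, (mderiv s (q i)).@[v] * (mderiv t (q j)).@[v] =
                (mderiv s (q j)).@[v] * (mderiv t (q i)).@[v].
Proof.
move=> u nz hi hj hl; have fE := prod_three u; set G := \prod_(s | s \notin _) _ in fE.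
have noA n : ~ A_sing n f v by rewrite fE => /A_sing_two; apply.
have : ord_triple f v.
  have := f_sing (v := v); rewrite {1}fE mulrCA => h.
  case: h => [|/noA|[|[/noA|[/noA|/noA]]]] //.
  by apply: sing_point_mul; rewrite // !mevalM hj mul0r mulr0.
rewrite fE => /ord_triple_transverse /(_ hi hj hl) [hG hd]; split=> // m hm.
by apply: contraNneq hG => h0; rewrite /G (bigD1 m) //= mevalM h0 mul0r.
Qed.

End SingularPoints.

Lemma parallel_of_cross (K : comNzRingType) (a b : 'I_3 -> K) :
  [/\ a o1 * b o2 - a o2 * b o1 = 0, a o2 * b o0 - a o0 * b o2 = 0 & a o0 * b o1 - a o1 * b o0 = 0] ->
  forall s t, a s * b t = b s * a t.
Proof.
case=> /subr0_eq h0 /subr0_eq h1 /subr0_eq h2.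
by elim/ord3P; elim/ord3P; first [exact: mulrC|rewrite [RHS]mulrC].
Qed.

(** * From a free arrangement to an annihilating derivation *)

Section FreeConicArrangements.
Variable R : realType.
Local Notation C := R[i].
Local Notation mpoly3 := {mpoly C[3]}.

Lemma smooth_conic_of (q : mpoly3) : smooth_conic q -> smooth (conic_of q).
Proof.
move=> [hq [_ hs]]; apply/(smooth_gradP hq) => v hv i; apply/eqP/negPn/negP => nz.
apply: (hs v); split; first by exists i.
split=> //; have n2 : 2 != 0 :> C by rewrite pnatr_eq0.
apply: (mulfI n2); rewrite mulr0 -mevalZ -(euler_homog hq) raddf_sum big1 // => j _ /=.
by rewrite mevalM hv mulr0.
Qed.

Lemma nonzero3_pt (x y z : C) : ~ [/\ x = 0, y = 0 & z = 0] -> nonzero3 (pt x y z).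
Proof.
move=> nz; have [x0|x0] := eqVneq x 0; last by exists o0.
have [y0|y0] := eqVneq y 0; last by exists o1.
by exists o2; apply/eqP => z0; apply: nz.
Qed.

Variables (k : nat) (q : 'I_k -> mpoly3).
Hypothesis q_smooth : forall i, smooth_conic (q i).
Hypothesis q_distinct : forall i j, i != j -> forall c : C, q i != c *: q j.
Hypothesis q_sing : forall v, sing_point (\prod_i q i) v ->
  A_sing 1 (\prod_i q i) v \/ ord_triple (\prod_i q i) v \/ A_sing 3 (\prod_i q i) v \/
  A_sing 5 (\prod_i q i) v \/ A_sing 7 (\prod_i q i) v.

Lemma conics_not_proportional i j : i != j -> ~ proportional (conic_of (q i)) (conic_of (q j)).
Proof.
move=> ij [c hc]; have ji : j != i by rewrite eq_sym.
have /eqP := q_distinct ji c; apply; apply/eqP; rewrite -subr_eq0; apply/eqP.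
apply: mpoly_eq0 => x y z; rewrite mevalB mevalZ.
have ei := conic_of_qf (q_smooth i).1 x y z; have ej := conic_of_qf (q_smooth j).1 x y z.
have ec := etrans (hc x y z) (congr1 (fun a => c * a) (esym ei)).
by apply/eqP; rewrite subr_eq0; apply/eqP; exact: etrans ej ec.
Qed.

Lemma conics_no_four : no_four_concurrent (fun i => conic_of (q i)).
Proof.
move=> i j l m x y z u hi hj hl hm; apply: contrapT => /nonzero3_pt nz.
have e n : qf (conic_of (q n)) x y z = 0 -> (q n).@[pt x y z] = 0.
  by move=> h; exact: etrans (conic_of_qf (q_smooth n).1 x y z) h.
have u3 : uniq [:: i; j; l].
  by move: u; rewrite -[[:: i; j; l; m]]/([:: i; j; l] ++ [:: m]) cat_uniq => /andP[].
have um : m \notin [:: i; j; l].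
  move: u; rewrite /= !inE !negb_or => /and4P[/and3P[_ _ im] /andP[_ jm] lm _].
  by rewrite eq_sym im eq_sym jm eq_sym lm.
have [h _] := concurrent_transverse q_sing u3 nz (e _ hi) (e _ hj) (e _ hl).
by move/eqP: (h m um); apply; exact: e.
Qed.

Lemma conics_independent_triples : independent_triples (fun i => conic_of (q i)).
Proof.
move=> i j l x y z u hi hj hl hd; apply: contrapT => /nonzero3_pt nz.
have e n : qf (conic_of (q n)) x y z = 0 -> (q n).@[pt x y z] = 0.
  by move=> h; exact: etrans (conic_of_qf (q_smooth n).1 x y z) h.
have [_] := concurrent_transverse q_sing u nz (e _ hi) (e _ hj) (e _ hl); apply.
have hi2 := (q_smooth i).1; have hj2 := (q_smooth j).1.
pose a s := (mderiv s (q i)).@[pt x y z]; pose b s := (mderiv s (q j)).@[pt x y z].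
apply: (@parallel_of_cross _ a b).
exact: (iffRL (cross_scale (conic_of_gx hi2 x y z) (conic_of_gy hi2 x y z) (conic_of_gz hi2 x y z)
  (conic_of_gx hj2 x y z) (conic_of_gy hj2 x y z) (conic_of_gz hj2 x y z)) hd).
Qed.

(** The generator of smaller degree is used: d1 <= d2 and d1 + d2 = 2k - 1 give d1 <= k - 1, and
    with m = d1 - 1 this is m + 3 <= k + 1. It is nonzero because the two generators are
    independent. *)
Lemma free_annihilated : (2 <= k)%N -> free_curve (\prod_i q i) (2 * k) ->
  exists m th, (m + 3 <= k + 1)%N /\ annihilated m q th.
Proof.
move=> k2 [d1 [d2 [r1 [r2 [[/andP[d1_gt0 d12] dsum] [hr1 _] [sr1 _] _ indep]]]]].
exists d1.-1, r1; split; first by lia.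
split.
- by move=> i; case: (q_smooth i).
- by move=> i; exact: smooth_conic_of.
- exact: conics_not_proportional.
- exact: conics_no_four.
- exact: conics_independent_triples.
- by rewrite prednK.
- apply: contrapT => h; have r0 i : r1 i = 0 by apply/eqP/negPn/negP => nz; apply: h; exists i.
  have [|/eqP] := indep 1 0; last by rewrite oner_eq0.
  by move=> i; rewrite r0 mulr0 mul0r addr0.
- exact: sr1.
Qed.

End FreeConicArrangements.

Theorem theorem2p2 (R : realType) (k : nat) (q : 'I_k -> {mpoly (R[i])[3]}) :
  (2 <= k)%N ->
  (forall i, smooth_conic (q i)) ->
  (forall i j, i != j -> forall c : R[i], q i != c *: q j) ->
  (forall v, sing_point (\prod_(i < k) q i) v ->
     A_sing 1 (\prod_(i < k) q i) v \/ ord_triple (\prod_(i < k) q i) v \/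
     A_sing 3 (\prod_(i < k) q i) v \/ A_sing 5 (\prod_(i < k) q i) v \/
     A_sing 7 (\prod_(i < k) q i) v) ->
  free_curve (\prod_(i < k) q i) (2 * k) ->
  (2 <= k <= 4)%N.
Proof.
move=> k2 q_smooth q_distinct q_sing q_free; rewrite k2 leqNgt; apply/negP => k5.
have [m [th [mk han]]] := free_annihilated q_smooth q_distinct q_sing k2 q_free.
exact: annihilated_contradiction k5 mk han.
Qed.
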